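(* Assume the Elliott–Halberstam Conjecture (EH): for every $\varepsilon>0$ and $A>0$, $$\sum_{m\le x^{1-\varepsilon}}\max_{(a,m)=1}\left|E(x;m,a)\right|\ll_{A,\varepsilon}\frac{x}{(\log x)^A},\qquad\text{where } E(x;m,a):=\sum_{\substack{p\le x \text{ prime}\\ p\equiv a \pmod m}}\Lambda(p)-\frac{\psi(x)}{\varphi(m)}.$$ Then, as $Q\to+\infty$, $$\frac{1}{Q}\sum_{Q<q\le 2Q}\left|\gamma_q-\log q\right| = o(\log Q),$$ where the sum runs over all integers $q$ with $Q<q\le 2Q$.
   Context: For a number field $K$, the Euler–Kronecker constant is $\gamma_K:=\lim_{s\to1^+}\left(\frac{\zeta_K'(s)}{\zeta_K(s)}+\frac{1}{s-1}\right)$, where $\zeta_K$ is the Dedekind zeta function of $K$. For a positive integer $q$, $\gamma_q:=\gamma_{K_q}$ where $K_q=\mathbb{Q}(\zeta_q)$ is the $q$-th cyclotomic field ($\zeta_q$ a primitive $q$-th root of unity). Here $\Lambda$ is the von Mangoldt function, $\psi(x)=\sum_{n\le x}\Lambda(n)$ is the Chebyshev function, and $\varphi$ is Euler's totient function. *)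

(* Defs.v *)
From HB Require Import structures.
From mathcomp Require Import all_boot all_order all_algebra all_field.
From mathcomp Require Import algC algnum.
From mathcomp Require Import all_classical all_reals all_analysis.
Set Implicit Arguments. Unset Strict Implicit. Unset Printing Implicit Defensive.
Import Order.TTheory GRing.Theory Num.Theory.
Import numFieldNormedType.Exports.
Local Open Scope classical_set_scope.
Local Open Scope ring_scope.

Definition cycl_field (q : nat) : set algC :=
  [set x | exists (z : algC) (p : {poly rat}),
     q.-primitive_root z /\ x = (map_poly ratr p).[z]].

Definition cycl_ints (q : nat) : set algC :=
  [set x | cycl_field q x /\ x \in Aint].

Definition nz_ideal (q : nat) (I : set algC) : Prop :=
  [/\ I `<=` cycl_ints q, I 0,
      (forall x y, I x -> I y -> I (x - y)),
      (forall r x, cycl_ints q r -> I x -> I (r * x)) &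
      exists x, I x /\ x != 0].

Definition ideal_norm (q : nat) (I : set algC) : nat :=
  xget 0%N [set n : nat |
    [set [set y | cycl_ints q y /\ I (x - y)] | x in cycl_ints q] #= `I_n]%card.

(* Dedekind zeta function of K_q, for real s > 1 *)
Definition dedekind_zeta {R : realType} (q : nat) (s : R) : R :=
  fine (\esum_(I in nz_ideal q) (((ideal_norm q I)%:R : R) `^ (- s))%:E).

Definition EK_const {R : realType} (q : nat) : R :=
  lim ((('D_1 (@dedekind_zeta R q) s) / dedekind_zeta q s + (s - 1)^-1)
         @[s --> 1^'+]).

Definition vonMangoldt {R : realType} (n : nat) : R :=
  if size (primes n) == 1%N then ln (pdiv n)%:R else 0.

Definition chebyshev_psi {R : realType} (x : R) : R :=
  \sum_(n < (Num.truncn x).+1) vonMangoldt n.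

Definition EH_error {R : realType} (x : R) (m a : nat) : R :=
  \sum_(p < (Num.truncn x).+1 | prime p && (p == a %[mod m])) vonMangoldt p
  - chebyshev_psi x / (totient m)%:R.

Definition EH_conjecture (R : realType) : Prop :=
  forall eps A : R, 0 < eps -> 0 < A ->
  exists C : R, \forall x \near +oo,
    \sum_(1 <= m < (Num.truncn (x `^ (1 - eps))).+1)
       \big[Num.max/0]_(a < m | coprime a m) `|EH_error x m a|
    <= C * (x / (ln x) `^ A).

(* Main.v *)
(* By the Dedekind factorisation of the ideals of Z[zeta_q], the logarithmic
   derivative of the Dedekind zeta function of K_q is, up to sign, the Dirichlet
   series with coefficients phi(q) Lambda(n) at the primes n = 1 mod q, plus
   contributions of proper prime powers and of the primes dividing q.  Subtracting
   the Riemann zeta function and summing by parts,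
     gamma_q = c0 - \sum_N phi(q) E(N; q, 1) / (N (N + 1)) - R_q.
   The terms N > X = (3Q)^(1/(1-eps)) are small on average by EH.  Those with
   N <= X contribute ln X + O(1), which is within 2 eps ln Q + O(1) of ln q, minus
   phi(q) times the sum of (ln p) / p over the primes p <= X with p = 1 mod q: for
   these p = 1 + q k is also 1 mod k with k <= X / Q small, so EH for the moduli k
   bounds their average by O(eps ln Q).  Proper prime powers contribute O(1) on
   average.  A prime p | q with q = p^a m contributes at most 2 (ln p) / i, where
   p^f = 1 + m i with f the order of p mod m; the pair (m, i) determines (p, q), so
   few pairs (p, q) have both p large and i small. *)
Require Import Defs.
From HB Require Import structures.
From mathcomp Require Import all_boot all_order all_algebra all_solvable all_field.
From mathcomp Require Import algC algnum.
From mathcomp Require Import all_classical all_reals all_analysis.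
From mathcomp Require Import ring lra zify.
Set Implicit Arguments. Unset Strict Implicit. Unset Printing Implicit Defensive.
Import Order.TTheory GRing.Theory Num.Theory.
Import numFieldNormedType.Exports.
Local Open Scope classical_set_scope.
Local Open Scope ring_scope.

(** * Indices of subgroups and sums over fibres *)

(** [dedekind_zeta] is built from bare sets of algebraic numbers, so the ideal theory is derived
    here. Its pivot is the notion [good]: an element [l] such that [x ^+ N] is congruent to [x]
    modulo [l] for all [x]. One such element over each prime [p] makes maximal ideals invertible,
    shows that Z[zeta_q] is integrally closed and, being squarefree, gives the total log-norm of the
    primes above [p] without counting them. No Euler product occurs: expanding ln N(I) over the
    prime powers dividing I gives a convolution identity between nonnegative coefficients, which
    transfers convergence for s > 1 and yields the logarithmic derivative. EH is applied with two
    exponents. The switched sum over the moduli k always uses 1/2, so its constant [Ch] is fixed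
    before eps; it multiplies eps ln Q, and eps is then chosen small against it. The constant [C]
    that comes with eps is uncontrolled, but it enters only the tail N > X, where A = 2 makes the
    sum over N converge and leaves O(C Q), negligible against Q ln Q. *)

Section Index.
Variable F : numFieldType.
Implicit Types (A B C : set F) (x y : F).

Definition subgrp B := B 0 /\ forall x y, B x -> B y -> B (x - y).

Lemma subgrpN B x : subgrp B -> B x -> B (- x).
Proof. by move=> [B0 BB] Bx; rewrite -sub0r; apply: BB. Qed.

Lemma subgrpD B x y : subgrp B -> B x -> B y -> B (x + y).
Proof. by move=> gB Bx By; rewrite -[y]opprK; apply: gB.2 => //; apply: subgrpN. Qed.

Lemma subgrpC B x y : subgrp B -> B (x - y) -> B (y - x).
Proof. by move=> gB h; rewrite -opprB; apply: subgrpN. Qed.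

Lemma subgrp_trans B y x z : subgrp B -> B (x - y) -> B (y - z) -> B (x - z).
Proof. by move=> gB h1 h2; rewrite -[x](subrK y) -addrA; apply: subgrpD. Qed.

Lemma subgrp_sum B (I : Type) (r : seq I) (P : pred I) (f : I -> F) :
  subgrp B -> (forall i, P i -> B (f i)) -> B (\sum_(i <- r | P i) f i).
Proof.
move=> gB h; elim/big_rec: _ => [|i x Pi Bx]; first exact: gB.1.
by apply: subgrpD => //; apply: h.
Qed.

Lemma subgrpMn B x n : subgrp B -> B x -> B (x *+ n).
Proof.
move=> gB Bx; elim: n => [|n IH]; first by rewrite mulr0n; case: gB.
by rewrite mulrS; apply: subgrpD.
Qed.

(** The index (A : B), witnessed by a transversal [t]: no quotient group is formed and all groups
    remain plain sets of field elements. *)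
Definition idx A B n := exists t : 'I_n -> F,
  [/\ forall i, A (t i), forall i j, B (t i - t j) -> i = j
    & forall x, A x -> exists i, B (x - t i)].

Lemma idx_leq A B n m : subgrp B -> idx A B n -> idx A B m -> (n <= m)%N.
Proof.
move=> gB [t [tA tI _]] [u [_ _ uc]].
pose f i := projT1 (cid (uc (t i) (tA i))).
have fP i : B (t i - u (f i)) by rewrite /f; case: cid.
rewrite -[n]card_ord -[m]card_ord; apply: (@leq_card _ _ f) => i j fij.
apply: tI; apply: (subgrp_trans (y := u (f i))) => //.
by rewrite fij; apply: subgrpC.
Qed.

Lemma idx_inj A B n m : subgrp B -> idx A B n -> idx A B m -> n = m.
Proof. by move=> gB h1 h2; apply/eqP; rewrite eqn_leq !(idx_leq gB h1 h2, idx_leq gB h2 h1). Qed.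

Lemma idx_gt0 A B n : A 0 -> idx A B n -> (0 < n)%N.
Proof. by move=> A0 [t [_ _ /(_ 0 A0)[[i lti] _]]]; apply: leq_trans lti. Qed.

Lemma idx_pigeon A B n (f : nat -> F) : subgrp B -> idx A B n ->
  (forall i, A (f i)) -> exists i j, [/\ (i < j)%N, (j <= n)%N & B (f j - f i)].
Proof.
move=> gB [t [_ _ tc]] fA.
pose g (i : 'I_n.+1) := projT1 (cid (tc (f i) (fA i))).
have gP (i : 'I_n.+1) : B (f i - t (g i)) by rewrite /g; case: cid.
have /injectivePn [i [j nij gij]] : ~~ injectiveb g.
  by apply/negP => /injectiveP /leq_card; rewrite !card_ord ltnn.
wlog ltij : i j nij gij / (i < j)%N.
  move=> H; have [/H|/H|eij] := ltngtP i j; [exact| |].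
    by apply; [rewrite eq_sym|].
  by move: nij; rewrite (val_inj eij) eqxx.
exists i, j; split=> //; first by rewrite -ltnS.
by apply: (subgrp_trans (y := t (g j))) => //; rewrite -gij; apply: subgrpC.
Qed.

(** Thinning the covering list to pairwise incongruent elements leaves a transversal. This yields
    both finiteness of an index and upper bounds for it. *)
Lemma idx_cover A B (s : seq F) : subgrp B -> (forall x, x \in s -> A x) ->
  (forall x, A x -> exists2 y, y \in s & B (x - y)) ->
  exists2 n, (n <= size s)%N & idx A B n.
Proof.
move=> gB sA sc.
have [u [us usz uI uc]] : exists u : seq F, [/\ {subset u <= s}, (size u <= size s)%N,
   forall i j, (i < size u)%N -> (j < size u)%N -> B (u`_i - u`_j) -> i = j
   & forall x, x \in s -> exists2 y, y \in u & B (x - y)].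
  elim: s {sA sc} => [|x s [u [us usz uI uc]]].
    by exists [::]; split.
  have [[y yu Bxy]|nex] := pselect (exists2 y, y \in u & B (x - y)).
    exists u; split=> [w /us|||w]; rewrite ?inE; first by move=> ->; rewrite orbT.
    - exact: leqW.
    - exact: uI.
    - by case/predU1P=> [->|/uc//]; exists y.
  exists (x :: u); split=> [w||i j|w]; rewrite ?inE.
  - by case/predU1P=> [->|/us ->]; rewrite ?eqxx ?orbT.
  - by rewrite ltnS.
  - case: i j => [|i] [|j] //=; rewrite ?ltnS => hi hj h.
    + by case: nex; exists u`_j => //; apply: mem_nth.
    + by case: nex; exists u`_i; [apply: mem_nth|apply: subgrpC].
    + by rewrite (uI i j).
  - case/predU1P=> [->|/uc [y yu Bxy]]; last by exists y; rewrite ?inE ?yu ?orbT.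
    by exists x; rewrite ?inE ?eqxx // subrr; case: gB.
exists (size u) => //; exists (fun i => u`_i); split.
- by move=> i; apply/sA/us/mem_nth.
- by move=> i j h; apply/val_inj/(uI i j).
- move=> x /sc [y ys Bxy]; have [w wu Byw] := uc _ ys.
  have wi : (index w u < size u)%N by rewrite index_mem.
  by exists (Ordinal wi); rewrite /= nth_index //; apply: subgrp_trans Byw.
Qed.

(** A transversal of A modulo C covers A modulo B, and those of its members that lie in B cover B
    modulo C. *)
Lemma idx_between A B C n : subgrp C -> subgrp B -> C `<=` B -> B `<=` A ->
  idx A C n -> exists a b, idx A B a /\ idx B C b.
Proof.
move=> gC gB CB BA [t [tA tI tc]].
have [a _ ha] : exists2 a, (a <= size [seq t i | i <- enum 'I_n])%N & idx A B a.
  apply: idx_cover => // [_ /mapP[i _ ->]//|x /tc[i Ci]].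
  by exists (t i); [apply: map_f; rewrite mem_enum|apply: CB].
have [b _ hb] : exists2 b, (b <= size [seq t i | i <- enum 'I_n & `[<B (t i)>]])%N & idx B C b.
  apply: idx_cover => // [y /mapP[i + ->]|x Bx].
    by rewrite mem_filter => /andP[/asboolP].
  have [i Ci] := tc _ (BA _ Bx); exists (t i) => //; apply: map_f.
  rewrite mem_filter mem_enum andbT; apply/asboolP.
  rewrite -[t i](subKr x); apply: gB.2 => //; exact: CB.
by exists a, b.
Qed.

Lemma idx_mul A B C a b : subgrp C -> subgrp B -> subgrp A -> C `<=` B -> B `<=` A ->
  idx A B a -> idx B C b -> idx A C (a * b).
Proof.
move=> gC gB gA CB BA [t [tA tI tc]] [u [uB uI uc]].
have cardE : #|{: 'I_a * 'I_b}| = (a * b)%N by rewrite card_prod !card_ord.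
rewrite -cardE; exists (fun k => let: (i, j) := enum_val k in t i + u j); split.
- by move=> k; case: (enum_val k) => i j; apply: subgrpD => //; apply: BA.
- move=> k l; case Ek: (enum_val k) => [i j]; case El: (enum_val l) => [i' j'] h.
  have ii' : i = i'.
    apply: tI; have -> : t i - t i' = (t i + u j - (t i' + u j')) - (u j - u j') by ring.
    by apply: gB.2; [apply: CB|apply: gB.2].
  have jj' : j = j'.
    by apply: uI; move: h; rewrite ii'; congr C; ring.
  by apply: enum_val_inj; rewrite Ek El ii' jj'.
- move=> x /tc [i Bi]; have [j Cj] := uc _ Bi.
  by exists (enum_rank (i, j)); rewrite enum_rankK; move: Cj; congr C; ring.
Qed.

Lemma idx1 A B : subgrp A -> subgrp B -> idx A B 1 -> B `<=` A -> A = B.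
Proof.
move=> gA gB [t [tA _ tc]] BA; apply/seteqP; split=> // x Ax.
have [i Bi] := tc _ Ax; have [j Bj] := tc _ gA.1.
rewrite -[x]subr0; apply: (subgrp_trans (y := t i)) => //.
by rewrite (ord1 i) -(ord1 j); apply: subgrpC.
Qed.

Lemma idx_refl A : subgrp A -> idx A A 1.
Proof.
move=> gA; exists (fun=> 0); split=> [_|i j _|x Ax]; first by case: gA.
- by rewrite !ord1.
- by exists ord0; rewrite subr0.
Qed.

(** Bridge from transversals to the set of cosets whose cardinality defines [ideal_norm]. *)
Lemma idx_card_cosets A B n : subgrp A -> subgrp B -> B `<=` A -> idx A B n ->
  ([set [set y | A y /\ B (x - y)] | x in A] #= `I_n)%card.
Proof.
move=> gA gB BA [t [tA tI tc]]; rewrite card_eq_sym; apply/card_set_bijP.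
case: n t tA tI tc => [|n] t tA tI tc; first by have [[]] := tc _ gA.1.
exists (fun k => [set y | A y /\ B (t (inord k) - y)]); split.
- by move=> k _; exists (t (inord k)).
- move=> k l; rewrite !inE /= => lk ll E.
  have : [set y | A y /\ B (t (inord l) - y)] (t (inord k)).
    by rewrite -E /=; split=> //; rewrite subrr; case: gB.
  by move=> [_ /tI /(congr1 val)]; rewrite /= !inordK.
- move=> _ [x Ax <-]; have [i Bi] := tc _ Ax.
  exists (val i); first exact: ltn_ord.
  apply/seteqP; split=> y /= [Ay]; rewrite inord_val => h; split=> //.
    exact: subgrp_trans h.
  by apply: subgrp_trans h => //; apply: subgrpC.
Qed.

End Index.

(** * Sums of nonnegative extended reals over sets *)

Section Esum.
Variable R : realType.
Local Open Scope ereal_scope.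

Lemma esum_ge1 (T : choiceType) (S : set T) (a : T -> \bar R) i :
  S i -> a i <= \esum_(j in S) a j.
Proof.
move=> Si; apply: esum_ge; exists [set i]; last by rewrite fsbig_set1.
by split=> [|_ ->]; [exact: finite_set1|].
Qed.

Lemma esumZl_fin (T : choiceType) (S : set T) (a : T -> \bar R) (r : R) : (0 <= r)%R ->
  (forall i, 0 <= a i) -> \esum_(i in S) (r%:E * a i) = r%:E * \esum_(i in S) a i.
Proof.
move=> r0 a0.
have le (s : R) (b : T -> \bar R) : (0 <= s)%R -> (forall i, 0 <= b i) ->
    \esum_(i in S) (s%:E * b i) <= s%:E * \esum_(i in S) b i.
  move=> s0 b0; apply: ge_ereal_sup => _ [X [finX XS] <-].
  rewrite -ge0_mule_fsumr //.
  by apply: lee_wpmul2l; rewrite ?lee_fin //; apply: ereal_sup_ubound; exists X.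
apply/eqP; rewrite eq_le le //=.
have [->|rn0] := eqVneq r 0%R.
  by rewrite mul0e; apply: esum_ge0 => i Si; rewrite mul0e.
have {}r0 : (0 < r)%R by rewrite lt_def rn0.
rewrite -lee_pdivlMl //.
have ra0 i : 0 <= r%:E * a i by rewrite mule_ge0 // lee_fin ltW.
have r'0 : (0 <= r^-1)%R by rewrite invr_ge0 ltW.
apply: (le_trans _ (le _ _ r'0 ra0)).
by apply: le_esum => i Si; rewrite muleA -EFinM mulVf ?gt_eqF // mul1e.
Qed.

Lemma esumZl (T : choiceType) (S : set T) (a : T -> \bar R) (r : \bar R) : 0 <= r ->
  (forall i, 0 <= a i) -> \esum_(i in S) (r * a i) = r * \esum_(i in S) a i.
Proof.
move=> + a0; case: r => [r||] //; first by rewrite lee_fin => r0; exact: esumZl_fin.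
move=> _; have [[i Si ai]|nex] := pselect (exists2 i, S i & 0 < a i).
  rewrite [RHS]gt0_mulye; last by apply: lt_le_trans ai _; exact: esum_ge1.
  apply/eqP; rewrite -leye_eq; apply: le_trans (esum_ge1 _ Si).
  by rewrite gt0_mulye.
have a00 i : S i -> a i = 0.
  move=> Si; apply/eqP; rewrite eq_le a0 andbT leNgt; apply/negP => h.
  by apply: nex; exists i.
by rewrite !esum1 ?mule0 // => i /a00 ->; rewrite mule0.
Qed.

Lemma esumZr (T : choiceType) (S : set T) (a : T -> \bar R) (r : \bar R) : 0 <= r ->
  (forall i, 0 <= a i) -> \esum_(i in S) (a i * r) = (\esum_(i in S) a i) * r.
Proof.
by move=> r0 a0; rewrite muleC -esumZl //; apply: eq_esum => i _; rewrite muleC.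
Qed.

(** Regrouping by the value of [nu]. With [nu] the norm, a sum over ideals becomes a Dirichlet
    series; nonnegativity makes convergence irrelevant. *)
Lemma esum_fiber (T : choiceType) (S : set T) (w : T -> \bar R) (nu : T -> nat)
    (h : nat -> \bar R) : (forall x, 0 <= w x) -> (forall n, 0 <= h n) ->
  \esum_(x in S) (w x * h (nu x)) =
  \esum_(n in [set: nat]) ((\esum_(x in [set x | S x /\ nu x = n]) w x) * h n).
Proof.
move=> w0 h0.
transitivity (\esum_(n in [set: nat]) \esum_(x in [set x | S x /\ nu x = n]) (w x * h n)).
  rewrite esum_esum; last by move=> *; rewrite mule_ge0.
  rewrite (reindex_esum S _ (fun x => (nu x, x))) //.
  split=> [x Sx|x y _ _ [_ ->]|[n x] [/= _ [Sx <-]]] //.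
  by exists x.
by apply: eq_esum => n _; rewrite esumZr.
Qed.

End Esum.

(** * Ideals and their norms *)

Section Dedekind.
Variables (F : numFieldType) (A : set F).
Implicit Types (I J L M : set F) (x y : F).

Definition subring := [/\ A 1, forall x y, A x -> A y -> A (x - y)
                       & forall x y, A x -> A y -> A (x * y)].

Definition nzi I := [/\ I `<=` A, I 0, (forall x y, I x -> I y -> I (x - y)),
  (forall r x, A r -> I x -> I (r * x)) & exists x, I x /\ x != 0].

Definition princ x : set F := [set y | exists2 a, A a & y = x * a].

(** The congruence makes A modulo [l] reduced, as for a product of finite fields: [l] behaves like a
    squarefree element. *)
Definition good l := [/\ A l, l != 0 &
  exists2 N, (1 < N)%N & forall x, A x -> princ l (x ^+ N - x)].

Definition maxi M := [/\ nzi M, ~ M 1 &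
  forall J, nzi J -> M `<=` J -> J = M \/ J 1].

Definition invI M : set F := [set x | forall y, M y -> A (x * y)].
(** The product ideal M J, described as the [x] that the inverse of M carries into J. For invertible
    M this is the usual product, and finite sums of products never have to be handled. *)
Definition mulI M J : set F := [set x | forall y, invI M y -> J (x * y)].
Definition divI M I : set F := [set x | forall y, M y -> I (x * y)].

Definition Nm I : nat := xget 0%N [set n | idx A I n].

Hypothesis rA : subring.
Hypothesis finA : forall I, nzi I -> exists n, idx A I n.
(** This takes the place of integral closedness: it is what makes every maximal ideal invertible. *)
Hypothesis locA : forall M, maxi M -> exists2 l, good l & M l.

Lemma A1 : A 1. Proof. by case: rA. Qed.
Lemma AB x y : A x -> A y -> A (x - y). Proof. by case: rA => _ + _; apply. Qed.
Lemma AM x y : A x -> A y -> A (x * y). Proof. by case: rA => _ _; apply. Qed.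
Lemma A0 : A 0. Proof. by rewrite -(subrr 1); apply: AB; apply: A1. Qed.
Lemma A_subgrp : subgrp A. Proof. by split; [apply: A0|apply: AB]. Qed.
Lemma AD x y : A x -> A y -> A (x + y). Proof. exact: subgrpD A_subgrp. Qed.
Lemma AN x : A x -> A (- x). Proof. exact: subgrpN A_subgrp. Qed.
Lemma AX x n : A x -> A (x ^+ n).
Proof. by move=> Ax; elim: n => [|n IH]; [apply: A1|rewrite exprS; apply: AM]. Qed.
Lemma A_nat n : A n%:R.
Proof. exact: subgrpMn A_subgrp A1. Qed.

Lemma nzi_subgrp I : nzi I -> subgrp I. Proof. by case. Qed.
Lemma nziA I : nzi I -> I `<=` A. Proof. by case. Qed.
Lemma nziM I r x : nzi I -> A r -> I x -> I (r * x). Proof. by case=> _ _ _ + _; apply. Qed.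
Lemma nziMr I r x : nzi I -> A r -> I x -> I (x * r).
Proof. by rewrite mulrC; apply: nziM. Qed.

Lemma nzi_A : nzi A.
Proof.
split=> //; [exact: A0|exact: AB|exact: AM|].
by exists 1; split; [exact: A1|exact: oner_neq0].
Qed.

Lemma nzi1 I : nzi I -> I 1 -> I = A.
Proof.
move=> hI I1; apply/seteqP; split; first exact: nziA.
by move=> x Ax; rewrite -[x]mulr1; apply: nziM.
Qed.

Lemma princ_nzi x : A x -> x != 0 -> nzi (princ x).
Proof.
move=> Ax x0; split.
- by move=> _ [a Aa ->]; apply: AM.
- by exists 0; [exact: A0|rewrite mulr0].
- by move=> _ _ [a Aa ->] [b Ab ->]; exists (a - b); [exact: AB|rewrite mulrBr].
- by move=> r _ Ar [a Aa ->]; exists (r * a); [exact: AM|rewrite mulrCA].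
- by exists x; split=> //; exists 1; [exact: A1|rewrite mulr1].
Qed.

Lemma NmE I n : nzi I -> idx A I n -> Nm I = n.
Proof.
by move=> hI h; apply: xget_unique => // m /idx_inj; apply => //; apply: nzi_subgrp.
Qed.

Lemma NmP I : nzi I -> idx A I (Nm I).
Proof. by move=> hI; have [n hn] := finA hI; rewrite (NmE hI hn). Qed.

Lemma Nm_gt0 I : nzi I -> (0 < Nm I)%N.
Proof. by move=> hI; apply: idx_gt0 A0 (NmP hI). Qed.

Lemma Nm_A : Nm A = 1%N.
Proof. exact: NmE nzi_A (idx_refl A_subgrp). Qed.

Lemma Nm_eq1 I : nzi I -> Nm I = 1%N -> I = A.
Proof.
move=> hI h; apply/esym/idx1; [exact: A_subgrp|exact: nzi_subgrp| |exact: nziA].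
by rewrite -h; apply: NmP.
Qed.

Lemma Nm_idx I J b : nzi I -> nzi J -> I `<=` J -> idx J I b -> Nm I = (Nm J * b)%N.
Proof.
move=> hI hJ IJ h; apply: NmE => //.
apply: idx_mul (NmP hJ) h => //; last exact: nziA.
- exact: nzi_subgrp.
- exact: nzi_subgrp.
- exact: A_subgrp.
Qed.

Lemma Nm_lt I J : nzi I -> nzi J -> I `<=` J -> I <> J -> (Nm J < Nm I)%N.
Proof.
move=> hI hJ IJ nIJ.
have [a [b [ha hb]]] := idx_between (nzi_subgrp hI) (nzi_subgrp hJ) IJ (nziA hJ) (NmP hI).
rewrite (Nm_idx hI hJ IJ hb) -[ltnLHS]muln1 ltn_pmul2l ?Nm_gt0 //.
rewrite ltn_neqAle (idx_gt0 (nzi_subgrp hJ).1 hb) andbT; apply/eqP => b1.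
by case: nIJ; apply/esym/idx1; rewrite ?b1 //; apply: nzi_subgrp.
Qed.

(** Descent on the norm: a proper ideal that is not maximal lies strictly inside a proper ideal,
    whose norm is smaller. *)
Lemma max_exists I : nzi I -> ~ I 1 -> exists2 M, maxi M & I `<=` M.
Proof.
have [n] := ubnP (Nm I); elim: n => // n IH in I * => In hI nI1.
have [mI|] := pselect (maxi I); first by exists I.
move=> nM; have [J [hJ IJ nJI nJ1]] : exists J, [/\ nzi J, I `<=` J, J <> I & ~ J 1].
  apply: contra_notP nM => nex; split=> // J hJ IJ.
  have [->|nJI] := pselect (J = I); first by left.
  by right; apply: contra_notP nex => nJ1; exists J.
have [|M mM JM] := IH J _ hJ nJ1; last by exists M => // x /IJ/JM.
rewrite ltnS in In; apply: leq_trans In; apply: Nm_lt => // h; exact: nJI.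
Qed.

Lemma max_prime M x y : maxi M -> A x -> A y -> M (x * y) -> M x \/ M y.
Proof.
move=> [hM nM1 mM] Ax Ay Mxy.
have [|nMx] := pselect (M x); [by left|right].
pose J : set F := [set w | exists m a, [/\ M m, A a & w = m + x * a]].
have [M0 gM] := nzi_subgrp hM.
have MJ : M `<=` J by move=> m Mm; exists m, 0; split=> //; [exact: A0|rewrite mulr0 addr0].
have hJ : nzi J.
  split.
  - by move=> _ [m [a [Mm Aa ->]]]; apply: AD; [exact: nziA Mm|exact: AM].
  - exact: MJ.
  - move=> _ _ [m [a [Mm Aa ->]]] [n [b [Mn Ab ->]]]; exists (m - n), (a - b).
    by split; [exact: gM|exact: AB|ring].
  - move=> r _ Ar [m [a [Mm Aa ->]]]; exists (r * m), (r * a).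
    by split; [exact: nziM|exact: AM|ring].
  - by case: hM => _ _ _ _ [w [Mw w0]]; exists w; split=> //; exact: MJ.
case: (mM _ hJ MJ) => [JM|[m [a [Mm Aa E]]]].
  by case: nMx; rewrite -JM; exists 0, 1; split; rewrite ?mulr1 ?add0r //; exact: A1.
rewrite -[y]mul1r E mulrDl; apply: subgrpD; [exact: nzi_subgrp|exact: nziMr|].
by rewrite mulrAC; apply: nziMr.
Qed.

Lemma max_primeX M x n : maxi M -> A x -> M (x ^+ n) -> M x.
Proof.
move=> mM Ax; elim: n => [|n IH]; first by rewrite expr0; case: mM.
by rewrite exprS => /(max_prime mM Ax (AX n Ax)) [].
Qed.

Lemma good_pow l N x k : good l -> (forall x, A x -> princ l (x ^+ N - x)) -> A x ->
  princ l (x ^+ (N ^ k)%N - x).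
Proof.
move=> [Al l0 _] HN Ax; have hl := princ_nzi Al l0.
elim: k => [|k IH]; first by rewrite expn0 expr1 subrr; case: hl.
rewrite expnSr exprM; apply: (subgrp_trans (y := x ^+ (N ^ k)%N)) => //; first exact: nzi_subgrp.
by apply: HN; apply: AX.
Qed.

(* [x ^+ N = x] modulo [l] rules out nilpotents. *)
Lemma good_radical l x j : good l -> A x -> princ l (x ^+ j) -> princ l x.
Proof.
move=> gl Ax [a Aa E]; have [Al l0 [N N1 HN]] := gl; have hl := princ_nzi Al l0.
have h1 := good_pow j gl HN Ax.
have lej : (j <= N ^ j)%N by apply/ltnW/ltn_expl.
rewrite -[x](subKr (x ^+ (N ^ j))); apply: (nzi_subgrp hl).2 => //.
rewrite -(subnK lej) exprD E; apply: nziM => //; first exact: AX.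
by exists a.
Qed.

(** Let [t i] represent M modulo [l] and [e i = 1 - t i ^+ N.-1]. Then [t i * e i] is a multiple of
    [l] and [e i] is 1 modulo M, so the product [c] of all [e i] is 1 modulo M and multiplies every
    class of M into the multiples of [l]. Were [c] itself a multiple of [l], then 1 would lie in
    M. *)
Lemma good_split l M : good l -> maxi M -> M l ->
  exists c, [/\ A c, M (1 - c), ~ princ l c & invI M (c / l)].
Proof.
move=> gl mM Ml; have [Al l0 [N N1 HN]] := gl; have [hM nM1 _] := mM.
have hl := princ_nzi Al l0.
have lM : princ l `<=` M by move=> _ [a Aa ->]; apply: nziMr.
have [_ [b [_ [t [tM _ tc]]]]] :=
  idx_between (nzi_subgrp hl) (nzi_subgrp hM) lM (nziA hM) (NmP hl).
have N0 : (0 < N.-1)%N by case: N N1 {HN} => [|[]].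
pose e i := 1 - t i ^+ N.-1.
have tA i : A (t i) by apply: (nziA hM).
have eA i : A (e i) by apply: AB; [exact: A1|exact: AX].
pose c := \prod_i e i.
have prodA (P : pred 'I_b) : A (\prod_(i | P i) e i).
  by apply: (big_ind A) => // [|x y]; [exact: A1|exact: AM].
have Ac : A c by exact: prodA.
have Mc : M (1 - c).
  apply: (big_ind (fun x => M (1 - x))) => [|x y Mx My|i _].
  - by rewrite subrr; case: (nzi_subgrp hM).
  - have -> : 1 - x * y = (1 - x) + (1 - y) - (1 - x) * (1 - y) by ring.
    have gM := nzi_subgrp hM; apply: gM.2; first exact: subgrpD.
    by apply: nziM => //; exact: nziA Mx.
  - by rewrite subKr -(prednK N0) exprS; apply: nziMr => //; exact: AX.
exists c; split=> //.
- move=> [a Aa E]; case: nM1; rewrite -[1](subrK c); apply: subgrpD => //.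
    exact: nzi_subgrp.
  by rewrite E; apply: nziMr.
- move=> y My; have [i [a Aa Ea]] := tc _ My.
  have [d Ad Ed] : princ l (t i * e i).
    have [d Ad Ed] := HN _ (tA i).
    exists (- d); first exact: AN.
    rewrite mulrN -Ed opprB /e mulrBr mulr1 -exprS prednK //; exact: ltnW.
  have -> : c / l * y = (\prod_(j | j != i) e j) * d + a * c.
    have -> : y = l * a + t i by rewrite -Ea subrK.
    rewrite /c (bigD1 i) //=; set P := \prod_(_ | _) _.
    have -> : e i * P / l * (l * a + t i) = (t i * e i) * P / l + a * (e i * P) * (l / l) by ring.
    by rewrite Ed divff // mulr1; congr (_ + _); field.
  by apply: AD; apply: AM.
Qed.

(** The relation is 1 = (1 - c) 1 + l (c / l) with the [c] of [good_split]. Multiplying any [x] by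
    these two terms is the way every later identity between [mulI] and [divI] is proved. *)
Lemma max_invertible M : maxi M -> exists a1 b1 a2 b2,
  [/\ M a1, M a2, invI M b1, invI M b2 & a1 * b1 + a2 * b2 = 1].
Proof.
move=> mM; have [l gl Ml] := locA mM; have [hM _ _] := mM.
have [Al l0 _] := gl; have [c [Ac Mc _ ic]] := good_split gl mM Ml.
exists (1 - c), 1, l, (c / l); split=> //; last by field.
by move=> y My; rewrite mul1r; exact: nziA My.
Qed.

Lemma invI1 M : maxi M -> invI M 1.
Proof. by move=> [hM _ _] y My; rewrite mul1r; apply: nziA My. Qed.

Lemma mulI_sub M J : maxi M -> mulI M J `<=` J.
Proof. by move=> mM x /(_ _ (invI1 mM)); rewrite mulr1. Qed.

Lemma mulI_max M J : maxi M -> nzi J -> mulI M J `<=` M.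
Proof.
move=> mM hJ x Hx; have [a1 [b1 [a2 [b2 [Ma1 Ma2 h1 h2 E]]]]] := max_invertible mM.
have [hM _ _] := mM.
have -> : x = (x * b1) * a1 + (x * b2) * a2 by rewrite -[LHS]mulr1 -E; ring.
by apply: subgrpD; [exact: nzi_subgrp|apply: nziM => //; apply: (nziA hJ); apply: Hx..].
Qed.

Lemma mulI_nzi M J : maxi M -> nzi J -> nzi (mulI M J).
Proof.
move=> mM hJ; have [hM _ _] := mM; split.
- by move=> x /(mulI_sub mM); apply: nziA.
- by move=> y _; rewrite mul0r; case: hJ.
- by move=> x y hx hy w hw; rewrite mulrBl; apply: (nzi_subgrp hJ).2; [apply: hx|apply: hy].
- by move=> r x Ar hx w hw; rewrite -mulrA; apply: nziM => //; apply: hx.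
- case: hM => _ _ _ _ [m [Mm m0]]; case: (hJ) => _ _ _ _ [x [Jx x0]].
  exists (x * m); split; last by rewrite mulf_neq0.
  by move=> w hw; rewrite -mulrA; apply: nziMr => //; rewrite mulrC; apply: hw.
Qed.

Lemma divI_nzi M I : maxi M -> nzi I -> I `<=` M -> nzi (divI M I).
Proof.
move=> mM hI IM; have [hM _ _] := mM.
have [a1 [b1 [a2 [b2 [Ma1 Ma2 h1 h2 E]]]]] := max_invertible mM; split.
- move=> x Hx; have -> : x = b1 * (x * a1) + b2 * (x * a2) by rewrite -[LHS]mulr1 -E; ring.
  by apply: AD; [apply: h1|apply: h2]; apply: IM; apply: Hx.
- by move=> y _; rewrite mul0r; case: hI.
- by move=> x y hx hy w hw; rewrite mulrBl; apply: (nzi_subgrp hI).2; [apply: hx|apply: hy].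
- by move=> r x Ar hx w hw; rewrite -mulrA; apply: nziM => //; apply: hx.
- case: (hI) => _ _ _ _ [x [Ix x0]]; exists x; split=> // y My.
  by apply: nziMr => //; exact: nziA My.
Qed.

Lemma mulIK M J : maxi M -> nzi J -> divI M (mulI M J) = J.
Proof.
move=> mM hJ; have [hM _ _] := mM; apply/seteqP; split=> x.
  have [a1 [b1 [a2 [b2 [Ma1 Ma2 h1 h2 E]]]]] := max_invertible mM => Hx.
  have -> : x = (x * a1 * b1) + (x * a2 * b2) by rewrite -[LHS]mulr1 -E; ring.
  by apply: subgrpD; [exact: nzi_subgrp|apply: Hx..].
by move=> Jx y My w iw; rewrite -mulrA; apply: nziMr => //; rewrite mulrC; apply: iw.
Qed.

Lemma divIK M I : maxi M -> nzi I -> I `<=` M -> mulI M (divI M I) = I.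
Proof.
move=> mM hI IM; have [hM _ _] := mM; apply/seteqP; split=> x.
  have [a1 [b1 [a2 [b2 [Ma1 Ma2 h1 h2 E]]]]] := max_invertible mM => Hx.
  have -> : x = (x * b1 * a1) + (x * b2 * a2) by rewrite -[LHS]mulr1 -E; ring.
  by apply: subgrpD; [exact: nzi_subgrp|apply: Hx..].
by move=> Ix y iy w Mw; rewrite -mulrA; apply: nziMr => //; apply: iy.
Qed.

Lemma mulI_inj M J L : maxi M -> nzi J -> nzi L -> mulI M J = mulI M L -> J = L.
Proof. by move=> mM hJ hL E; rewrite -(mulIK mM hJ) E mulIK. Qed.

Lemma mulIC M L J : mulI M (mulI L J) = mulI L (mulI M J).
Proof.
by apply/seteqP; split=> x Hx y hy w hw; rewrite mulrAC; apply: Hx.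
Qed.

Lemma mulI_A M : maxi M -> mulI M A = M.
Proof.
move=> mM; apply/seteqP; split; first exact: mulI_max nzi_A.
by move=> x Mx y iy; rewrite mulrC; apply: iy.
Qed.

(* If [J = M J] then [y = c / l] in the inverse of [M] stabilises [J], so the pigeonhole
   principle modulo [x A] makes [y] integral, contradicting [good_radical]. *)
Lemma mulI_proper M J : maxi M -> nzi J -> exists2 x, J x & ~ mulI M J x.
Proof.
move=> mM hJ; apply: contrapT => nex.
have JM x : J x -> mulI M J x.
  by move=> Jx; apply: contrapT => nx; apply: nex; exists x.
have [l gl Ml] := locA mM; have [hM _ _] := mM.
have [Al l0 _] := gl; have [c [Ac Mc nc ic]] := good_split gl mM Ml.
have [_ _ _ _ [x [Jx x0]]] := hJ.
have Jk k : J (x * (c / l) ^+ k).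
  elim: k => [|k IH]; first by rewrite mulr1.
  by rewrite exprSr mulrA; apply: JM.
have hx := princ_nzi (nziA hJ Jx) x0.
have [i [j [ltij _ [a Aa E]]]] := idx_pigeon (nzi_subgrp hx) (NmP hx) (fun k => nziA hJ (Jk k)).
have {}E : (c / l) ^+ j = (c / l) ^+ i + a.
  by apply: (mulfI x0); rewrite mulrDr -E addrC subrK.
apply: nc; apply: (good_radical (j := j)) => //.
have -> : c ^+ j = l * (l ^+ (j - i).-1 * c ^+ i + l ^+ j.-1 * a).
  have lj : l ^+ j != 0 by rewrite expf_neq0.
  have j0 : (0 < j)%N by apply: leq_ltn_trans ltij.
  have -> : c ^+ j = (c / l) ^+ j * l ^+ j by rewrite -exprMn divfK.
  rewrite E mulrDr !mulrA -!exprS !prednK ?subn_gt0 // mulrDl [a * _]mulrC; congr (_ + _).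
  rewrite -{1}(subnK (ltnW ltij)) exprD mulrCA expr_div_n divfK ?expf_neq0 //.
exists (l ^+ (j - i).-1 * c ^+ i + l ^+ j.-1 * a) => //.
by apply: AD; apply: AM; rewrite //; apply: AX.
Qed.

Lemma mulI_neq M J : maxi M -> nzi J -> mulI M J <> J.
Proof. by move=> mM hJ E; have [x Jx] := mulI_proper mM hJ; rewrite E. Qed.

Lemma factor_max I : nzi I -> ~ I 1 -> exists M J,
  [/\ maxi M, nzi J, I = mulI M J & (Nm J < Nm I)%N].
Proof.
move=> hI nI1; have [M mM IM] := max_exists hI nI1; have hJ := divI_nzi mM hI IM.
exists M, (divI M I); split; rewrite ?divIK //.
apply: Nm_lt => // [x Ix y My|E].
  by apply: nziMr => //; case: mM => hM _ _; exact: nziA My.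
by apply: (mulI_neq mM hJ); rewrite divIK.
Qed.

Lemma divI_le M J L : J `<=` L -> divI M J `<=` divI M L.
Proof. by move=> JL x Hx y /Hx/JL. Qed.

(** Induction on the norm of J: a maximal ideal containing J is divided out of all three ideals,
    until J = A, where the claim is the maximality of M. *)
Lemma between M J L : maxi M -> nzi J -> nzi L -> mulI M J `<=` L -> L `<=` J ->
  L = J \/ L = mulI M J.
Proof.
move=> mM; have [n] := ubnP (Nm J); elim: n => // n IH in J L * => Jn hJ hL JL LJ.
have [J1|nJ1] := pselect (J 1).
  have {}J1 := nzi1 hJ J1; subst J; rewrite mulI_A // in JL *.
  case: (mM) => hM _ /(_ _ hL JL)[->|L1]; [by right|left; exact: nzi1].
have [M1 [J1 [mM1 hJ1 EJ ltJ]]] := factor_max hJ nJ1.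
have JM1 : J `<=` M1 by rewrite EJ; exact: mulI_max.
have LM1 : L `<=` M1 by move=> x /LJ/JM1.
have hL1 := divI_nzi mM1 hL LM1.
have J1n : (Nm J1 < n)%N by rewrite ltnS in Jn; apply: leq_trans Jn.
have [|||E] := IH J1 (divI M1 L) J1n hJ1 hL1.
- rewrite -(mulIK mM1 (mulI_nzi mM hJ1)); apply: divI_le.
  by rewrite mulIC -EJ.
- by rewrite -(mulIK mM1 hJ1) -EJ; apply: divI_le.
- by move=> E; left; rewrite -(divIK mM1 hL LM1) E.
- by right; rewrite -(divIK mM1 hL LM1) E mulIC -EJ.
Qed.

(** J modulo M J is one-dimensional over A modulo M: for [x] in J outside M J, multiplication by [x]
    carries a transversal of M to one of M J in J. It is injective because the [a] with [x * a] in M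
    J form an ideal containing M but not 1, and surjective because x A + M J exceeds M J, hence is J
    by [between]. *)
Lemma Nm_mulI M J : maxi M -> nzi J -> Nm (mulI M J) = (Nm M * Nm J)%N.
Proof.
move=> mM hJ; have [x Jx nx] := mulI_proper mM hJ; have [hM nM1 maxM] := mM.
have hMJ := mulI_nzi mM hJ; have gMJ := nzi_subgrp hMJ.
rewrite mulnC; apply: Nm_idx => //; first exact: mulI_sub.
have Ax := nziA hJ Jx.
have Mx m : M m -> mulI M J (x * m).
  by move=> Mm w iw; rewrite -mulrA; apply: nziMr => //; rewrite mulrC; apply: iw.
have [t [tA tI tc]] := NmP hM.
exists (fun i => x * t i); split.
- by move=> i; apply: nziMr.
- move=> i j; rewrite -mulrBr => h; apply: tI.
  pose L : set F := [set a | A a /\ mulI M J (x * a)].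
  have ML : M `<=` L by move=> m Mm; split; [exact: nziA Mm|exact: Mx].
  have hL : nzi L.
    split; first by move=> a [].
    - by split; [exact: A0|rewrite mulr0; case: gMJ].
    - move=> a b [Aa ha] [Ab hb]; split; first exact: AB.
      by rewrite mulrBr; apply: gMJ.2.
    - by move=> r a Ar [Aa ha]; split; [exact: AM|rewrite mulrCA; exact: nziM hMJ Ar ha].
    - by case: hM => _ _ _ _ [m [Mm m0]]; exists m; split=> //; exact: ML.
  case: (maxM _ hL ML) => [<-|[_]]; last by rewrite mulr1.
  by split=> //; exact: AB.
- pose L : set F := [set w | exists a m, [/\ A a, mulI M J m & w = x * a + m]].
  have ML : mulI M J `<=` L by move=> m Mm; exists 0, m; split; rewrite ?mulr0 ?add0r //; exact: A0.
  have LJ : L `<=` J.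
    move=> _ [a [m [Aa Mm ->]]]; apply: subgrpD; [exact: nzi_subgrp|exact: nziMr|].
    exact: mulI_sub Mm.
  have hL : nzi L.
    split.
    - by move=> w /LJ; apply: nziA.
    - by apply: ML; case: gMJ.
    - move=> _ _ [a [m [Aa Mm ->]]] [b [n [Ab Mn ->]]]; exists (a - b), (m - n).
      by split; [exact: AB|exact: gMJ.2|ring].
    - move=> r _ Ar [a [m [Aa Mm ->]]]; exists (r * a), (r * m).
      by split; [exact: AM|exact: nziM hMJ Ar Mm|ring].
    - by case: hMJ => _ _ _ _ [m [Mm m0]]; exists m; split=> //; exact: ML.
  move=> w Jw; have : L w.
    case: (between mM hJ hL ML LJ) => [->//|E]; case: nx; rewrite -E.
    by exists 1, 0; split; rewrite ?mulr1 ?addr0 //; [exact: A1|case: gMJ].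
  move=> [a [m [Aa Mm ->]]]; have [i Mi] := tc _ Aa; exists i.
  have -> : x * a + m - x * t i = x * (a - t i) + m by ring.
  by apply: (subgrpD gMJ) => //; exact: Mx.
Qed.

Lemma maxi_Nm_gt1 M : maxi M -> (1 < Nm M)%N.
Proof.
move=> [hM nM1 _]; rewrite ltn_neqAle Nm_gt0 // andbT eq_sym; apply/eqP => /(Nm_eq1 hM) E.
by apply: nM1; rewrite E; exact: A1.
Qed.

Lemma iter_mulI_nzi M J k : maxi M -> nzi J -> nzi (iter k (mulI M) J).
Proof. by move=> mM hJ; elim: k => //= k; apply: mulI_nzi. Qed.

Lemma iter_mulI_inj M J L k : maxi M -> nzi J -> nzi L ->
  iter k (mulI M) J = iter k (mulI M) L -> J = L.
Proof.
by move=> mM hJ hL; elim: k => //= k IH /mulI_inj E; apply: IH; apply: E => //; apply: iter_mulI_nzi.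
Qed.

Lemma Nm_iter_mulI M J k : maxi M -> nzi J ->
  Nm (iter k (mulI M) J) = (Nm M ^ k * Nm J)%N.
Proof.
move=> mM hJ; elim: k => [|k IH] /=; first by rewrite expn0 mul1n.
by rewrite Nm_mulI ?IH ?expnS ?mulnA //; apply: iter_mulI_nzi.
Qed.

Lemma iter_mulIC M L J k : iter k (mulI M) (mulI L J) = mulI L (iter k (mulI M) J).
Proof. by elim: k => //= k ->; rewrite mulIC. Qed.

(** The prime powers M^(k+1) that divide I. The number of [k] paired with M is the exponent of M in
    I, so unique factorisation is carried by this set alone. *)
Definition powdiv I : set (set F * nat) :=
  [set Mk | maxi Mk.1 /\ exists2 J, nzi J & I = iter Mk.2.+1 (mulI Mk.1) J].

Lemma powdiv_A : powdiv A = set0.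
Proof.
apply/seteqP; split=> // -[M k] [/= mM [J hJ E]].
case: (mM) => _ nM1 _; case: nM1; have := A1; rewrite {1}E.
by apply: mulI_max => //; apply: iter_mulI_nzi.
Qed.

Lemma max_sub M L : maxi M -> maxi L -> M `<=` L -> M = L.
Proof. by move=> [_ _ mM] [hL nL1 _] /(mM _ hL) []. Qed.

(** Euclid's lemma for ideals. For [y] in L outside M and any [x] in J, the product [x * y] lies in
    L J, hence in M, so [x] is in M; thus M divides J, and it can be divided out to lower [k]. *)
Lemma powdiv_neq M L J k : maxi M -> maxi L -> nzi J -> M <> L ->
  powdiv (mulI L J) (M, k) -> powdiv J (M, k).
Proof.
move=> mM mL hJ nML [/= _ [K hK E]]; split=> //=.
have [y Ly nMy] : exists2 y, L y & ~ M y.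
  apply: contrapT => h; apply: nML; apply/esym/max_sub => // y Ly.
  by apply: contrapT => nMy; apply: h; exists y.
have [hM _ _] := mM; have [hL _ _] := mL.
have JM J' k' : nzi J' -> mulI L J' = iter k'.+1 (mulI M) K -> J' `<=` M.
  move=> hJ' E' x Jx; have Ax := nziA hJ' Jx; have Ay := nziA hL Ly.
  have : mulI L J' (x * y).
    by move=> w iw; rewrite -mulrA; apply: nziMr => //; rewrite mulrC; apply: iw.
  rewrite E' => /(mulI_max mM (iter_mulI_nzi k' mM hK)).
  by case/(max_prime mM Ax Ay).
elim: k => [|k IH] in J hJ E *.
  by exists (divI M J); [apply/divI_nzi/(JM _ 0%N)|rewrite /= divIK //; apply: (JM _ 0%N)].
have hJM := JM _ k.+1 hJ E.
have hJ0 := divI_nzi mM hJ hJM; have EJ := divIK mM hJ hJM.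
have [|K' hK' EK'] := IH (divI M J) hJ0.
  apply: (mulI_inj mM); [exact: mulI_nzi|exact: (iter_mulI_nzi k.+1)|].
  by rewrite mulIC EJ.
by exists K' => //; rewrite -EJ EK'.
Qed.

(** Multiplication by L raises only the exponent of L: the pairs over L move up by one and leave
    [(L, 0)] free. *)
Definition powdiv_shift L (Mk : set F * nat) : set F * nat :=
  if pselect (Mk.1 = L) then (Mk.1, Mk.2.+1) else Mk.

Lemma powdiv_mulI L J : maxi L -> nzi J ->
  powdiv (mulI L J) = (L, 0%N) |` (powdiv_shift L @` powdiv J).
Proof.
move=> mL hJ; apply/seteqP; split=> [[M k] h|[M k] [|]].
- have [E|nE] := pselect (M = L).
    subst M; case: k h => [|k] h; [by left|right].
    exists (L, k); last by rewrite /powdiv_shift; case: pselect.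
    case: h => /= _ [K hK E]; split=> //=; exists K => //.
    by apply: mulI_inj E => //; apply: (iter_mulI_nzi k.+1).
  right; exists (M, k); last by rewrite /powdiv_shift; case: pselect.
  by have [mM _] := h; apply: powdiv_neq h.
- by move=> /= [-> ->]; split=> //=; exists J.
- move=> [[M' k'] [/= mM [K hK E]]]; rewrite /powdiv_shift /=.
  case: pselect => [E'|nE] [<- <-]; split=> //=.
    by exists K => //; rewrite E E'.
  by exists (mulI L K); [exact: mulI_nzi|rewrite iter_mulIC E /= mulIC].
Qed.

Lemma powdiv_shift_inj L : injective (powdiv_shift L).
Proof.
move=> [M k] [M' k']; rewrite /powdiv_shift /=.
case: pselect => [E|nE] /=; case: pselect => [E'|nE'] /= [].
- by move=> -> ->.
- by move=> h; rewrite -h in nE'.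
- by move=> h; rewrite h in nE.
- by move=> -> ->.
Qed.

Lemma powdiv_shift0 L Mk : powdiv_shift L Mk <> (L, 0%N).
Proof. by case: Mk => M k; rewrite /powdiv_shift /=; case: pselect => [E|nE] []. Qed.

(** A good element is squarefree: if M^2 divided it, the [c] of [good_split] would lie in M,
    although it is 1 modulo M. *)
Lemma powdiv_princ l : good l ->
  powdiv (princ l) = [set Mk | [/\ maxi Mk.1, Mk.1 l & Mk.2 = 0%N]].
Proof.
move=> gl; have [Al l0 _] := gl; have hl := princ_nzi Al l0.
apply/seteqP; split=> [[M k] [/= mM [J hJ E]]|[M k] /= [mM Ml ->]]; last first.
  split=> //=; have lM : princ l `<=` M.
    by move=> _ [a Aa ->]; apply: nziMr => //; case: mM.
  by exists (divI M (princ l)); [exact: divI_nzi|rewrite divIK].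
have Ml : M l.
  have : princ l l by exists 1; [exact: A1|rewrite mulr1].
  by rewrite E; apply: mulI_max => //; apply: iter_mulI_nzi.
split=> //; case: k E => // k /= E.
have [c [Ac Mc _ ic]] := good_split gl mM Ml.
have : divI M (princ l) c.
  by move=> y My; exists (c / l * y); [exact: ic|field].
rewrite E mulIK //; last exact: (iter_mulI_nzi k.+1).
move=> /(mulI_max mM (iter_mulI_nzi k mM hJ)) Mc'.
have [hM nM1 _] := mM; case: nM1; rewrite -[1](subrK c); apply: subgrpD => //.
exact: nzi_subgrp.
Qed.

(** * The logarithm of the norm as a sum over prime powers *)

Section Log.
Variable R : realType.

Lemma ln_Nm_ge0 I : (0 <= (ln (Nm I)%:R : R)%:E)%E.
Proof.
rewrite lee_fin; case: (Nm I) => [|n]; first by rewrite ln0.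
by apply: ln_ge0; rewrite ler1n.
Qed.

(** The ideal version of the identity expressing ln n as the sum of the von Mangoldt function over
    divisors. Splitting off one maximal factor adds the single pair [(M, 0)] and multiplies the norm
    by that of M. *)
Lemma esum_powdiv I : nzi I ->
  (\esum_(Mk in powdiv I) (ln (Nm Mk.1)%:R : R)%:E = (ln (Nm I)%:R)%:E)%E.
Proof.
have [n] := ubnP (Nm I); elim: n => // n IH in I * => In hI.
have [I1|nI1] := pselect (I 1).
  by rewrite (nzi1 hI I1) powdiv_A esum_set0 Nm_A ln1.
have [M [J [mM hJ E ltJ]]] := factor_max hI nI1.
rewrite E powdiv_mulI // (esumID [set (M, 0%N)]); last by move=> *; exact: ln_Nm_ge0.
rewrite setIUl setIid.
rewrite (_ : powdiv_shift M @` powdiv J `&` [set (M, 0%N)] = set0); last first.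
  by apply/seteqP; split=> // _ [[Mk _ <-] /powdiv_shift0].
rewrite setU0 esum_set1; last exact: ln_Nm_ge0.
rewrite setIUl setICr set0U (_ : _ `&` ~` _ = powdiv_shift M @` powdiv J); last first.
  by apply/seteqP; split=> [x []//|x [Mk h <-]]; split; [exists Mk|exact: powdiv_shift0].
rewrite esum_image; last by move=> x y _ _; apply: powdiv_shift_inj.
rewrite (eq_esum (b := fun Mk => (ln (Nm Mk.1)%:R)%:E)); last first.
  by move=> [L k] _; rewrite /powdiv_shift; case: pselect.
rewrite IH //=; last by rewrite ltnS in In; apply: leq_trans In.
have [hM _ _] := mM.
by rewrite Nm_mulI // natrM lnM ?posrE ?ltr0n ?Nm_gt0 // EFinD.
Qed.

(** As [l] is squarefree, each maximal ideal containing it occurs once. Applied to [lam], this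
    evaluates a sum over the primes above [p] whose number is never computed. *)
Lemma esum_good l : good l ->
  (\esum_(M in [set M | maxi M /\ M l]) (ln (Nm M)%:R : R)%:E = (ln (Nm (princ l))%:R)%:E)%E.
Proof.
move=> gl; have [Al l0 _] := gl; rewrite -esum_powdiv; last exact: princ_nzi.
rewrite powdiv_princ //.
rewrite (reindex_esum [set M | maxi M /\ M l] _ (fun M => (M, 0%N))) //.
split=> [M [mM Ml]|M M' _ _ [//]|[M k] /= [mM Ml ->]]; first by split.
by exists M.
Qed.

End Log.

(** Two of the integers from 0 to the norm agree modulo I by pigeonhole; their difference divides
    the factorial. *)
Lemma Nm_nat I : nzi I -> I ((Nm I)`!)%:R.
Proof.
move=> hI.
have [i [j [ltij lej]]] := idx_pigeon (nzi_subgrp hI) (NmP hI) A_nat.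
rewrite -natrB; last exact: ltnW.
have /dvdnP[k ->] : (j - i %| (Nm I)`!)%N.
  by apply: dvdn_fact; rewrite subn_gt0 ltij (leq_trans (leq_subr _ _)).
by rewrite natrM; apply: nziM => //; exact: A_nat.
Qed.

(** An ideal of norm n contains n!, hence is determined by the representatives modulo n! that it
    contains. *)
Lemma finite_ideals n : finite_set [set I | nzi I /\ Nm I = n].
Proof.
have hn : nzi (princ (n`!)%:R).
  by apply: princ_nzi; [exact: A_nat|rewrite pnatr_eq0 -lt0n fact_gt0].
have [t [tA _ tc]] := NmP hn; set m := Nm _ in t tA tc.
pose G (S : {set 'I_m}) : set F := [set x | A x /\ exists2 i, i \in S & princ (n`!)%:R (x - t i)].
apply: (@sub_finite_set _ _ (G @` setT)); last exact/finite_image/finite_finset.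
move=> I [hI EI]; exists [set i | `[<I (t i)>]]%SET => //.
have sub x : princ (n`!)%:R x -> I x.
  by move=> [a Aa ->]; apply: nziMr => //; rewrite -EI; apply: Nm_nat.
apply/seteqP; split=> x.
  move=> [Ax [i]]; rewrite inE => /asboolP Ii /sub h.
  by rewrite -[x](subrK (t i)); apply: subgrpD => //; exact: nzi_subgrp.
move=> Ix; have Ax := nziA hI Ix; split=> //; have [i h] := tc _ Ax; exists i => //.
rewrite inE; apply/asboolP; rewrite -[t i](subKr x); apply: (nzi_subgrp hI).2 => //.
exact: sub.
Qed.

(** * Ideal counts and the convolution identity *)

Section Dirichlet.
Variable R : realType.
Local Open Scope ereal_scope.

Definition ideal_count n : \bar R := \esum_(I in [set I | nzi I /\ Nm I = n]) 1.

(** The von Mangoldt function of ideals, collected by norm: the coefficients of minus the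
    logarithmic derivative of the zeta function. *)
Definition prime_count n : \bar R :=
  \esum_(Mk in [set Mk | maxi Mk.1 /\ (Nm Mk.1 ^ Mk.2.+1)%N = n]) (ln (Nm Mk.1)%:R : R)%:E.

Lemma ideal_count_ge0 n : 0 <= ideal_count n.
Proof. by apply: esum_ge0 => *; rewrite lee01. Qed.

Lemma ideal_count_fin n : ideal_count n \is a fin_num.
Proof.
rewrite /ideal_count esum_fset //; last exact: finite_ideals.
by rewrite fsbig_finite //=; [apply/sum_fin_numP|exact: finite_ideals].
Qed.

Lemma esum_ideal_count (h : nat -> R) : (forall n, 0 <= h n)%R ->
  \esum_(I in nzi) (h (Nm I))%:E = \esum_(n in [set: nat]) ideal_count n * (h n)%:E.
Proof.
move=> h0; rewrite -(@esum_fiber _ _ nzi (fun=> 1) Nm (fun n => (h n)%:E)) //.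
by apply: eq_esum => I _; rewrite mul1e.
Qed.

(** Expand ln N(I) over the prime powers dividing I and write I = M^(k+1) J: the triples (M, k, J)
    correspond bijectively to the pairs of I and a member of [powdiv I]. A general nonnegative
    weight [g] allows truncated weights later, before any convergence is known. *)
Lemma esum_ln_ideal (g : nat -> R) : (forall n, 0 <= g n)%R ->
  \esum_(I in nzi) (ln (Nm I)%:R * g (Nm I))%:E =
  \esum_(d in [set: nat]) (prime_count d *
     \esum_(m in [set: nat]) ideal_count m * (g (d * m)%N)%:E).
Proof.
move=> g0.
have gE0 n : 0 <= (g n)%:E by rewrite lee_fin.
transitivity (\esum_(I in nzi) \esum_(Mk in powdiv I)
    (ln (Nm Mk.1)%:R)%:E * (g (Nm I))%:E).
  apply: eq_esum => I hI; rewrite esumZr //; last by move=> *; exact: ln_Nm_ge0.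
  by rewrite esum_powdiv.
rewrite esum_esum; last by move=> *; rewrite mule_ge0 ?ln_Nm_ge0.
pose K : set (set F * nat) := [set Mk | maxi Mk.1].
rewrite (reindex_esum (K `*`` (fun=> nzi)) _ 
    (fun x : (set F * nat) * set F => (iter x.1.2.+1 (mulI x.1.1) x.2, x.1))); last first.
  split=> [[[M k] J] [/= mM hJ]|[[M k] J] [[M' k'] J'] |[I [M k]] [/= hI [/= mM [J hJ E]]]].
  - by split=> /=; [apply: (iter_mulI_nzi k.+1)|split=> //=; exists J].
  - rewrite !inE => -[/= mM hJ] [/= mM' hJ'] [E EM Ek]; subst M' k'.
    by rewrite (iter_mulI_inj (k := k.+1) mM hJ hJ' E).
  - by exists ((M, k), J) => //=; rewrite E.
rewrite -(@esum_esum _ _ _ K (fun=> nzi) (fun Mk J => (ln (Nm Mk.1)%:R)%:E *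
   (g (Nm (iter Mk.2.+1 (mulI Mk.1) J)))%:E)) /=; last first.
  by move=> *; rewrite mule_ge0 ?ln_Nm_ge0.
transitivity (\esum_(Mk in K) (ln (Nm Mk.1)%:R)%:E *
   \esum_(m in [set: nat]) ideal_count m * (g (Nm Mk.1 ^ Mk.2.+1 * m)%N)%:E).
  apply: eq_esum => -[M k] /= mM; rewrite -esum_ideal_count //.
  rewrite -esumZl //; last exact: ln_Nm_ge0.
  by apply: eq_esum => J hJ; rewrite -(Nm_iter_mulI k.+1).
rewrite (@esum_fiber _ _ K (fun Mk => (ln (Nm Mk.1)%:R)%:E) (fun Mk => (Nm Mk.1 ^ Mk.2.+1)%N)
  (fun d => \esum_(m in [set: nat]) ideal_count m * (g (d * m)%N)%:E)) //.
- by move=> *; exact: ln_Nm_ge0.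
- by move=> d; apply: esum_ge0 => *; rewrite mule_ge0 ?ideal_count_ge0.
Qed.

End Dirichlet.

End Dedekind.

(** * Cyclotomic integers *)

Section Residue.
Variables (F : numFieldType) (A : set F).
Hypothesis rA : subring A.
Implicit Types (x y l : F) (M : set F).

Lemma princM l x y : princ A l x -> A y -> princ A l (x * y).
Proof. by move=> [a Aa ->] Ay; exists (a * y); [exact: AM|rewrite mulrA]. Qed.

Lemma princMl l x y : princ A l x -> A y -> princ A l (y * x).
Proof. by rewrite mulrC; exact: princM. Qed.

Lemma princ_subgrp l : subgrp (princ A l).
Proof.
split; first by exists 0; [exact: A0|rewrite mulr0].
by move=> _ _ [a Aa ->] [b Ab ->]; exists (a - b); [exact: AB|rewrite mulrBr].
Qed.

Lemma princ_id l : princ A l l.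
Proof. by exists 1; [exact: A1|rewrite mulr1]. Qed.

Lemma princ_trans l k : princ A l k -> princ A k `<=` princ A l.
Proof. by move=> lk _ [a Aa ->]; exact: princM. Qed.

Lemma A_sum n (f : 'I_n -> F) : (forall i, A (f i)) -> A (\sum_i f i).
Proof. by move=> Af; apply: subgrp_sum => //; exact: A_subgrp. Qed.

Lemma princ_frob p l x y k : prime p -> princ A l p%:R -> A x -> A y ->
  princ A l ((x + y) ^+ (p ^ k) - (x ^+ (p ^ k) + y ^+ (p ^ k))).
Proof.
move=> pr_p lp Ax Ay; have gl := princ_subgrp l.
have step u v : A u -> A v -> princ A l ((u + v) ^+ p - (u ^+ p + v ^+ p)).
  move=> Au Av; case: p pr_p lp => [|p] // pr_p lp.
  rewrite exprDn big_ord_recr big_ord_recl /= subn0 subnn bin0 binn !mulr1n !expr0 mulr1 mul1r.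
  rewrite (_ : _ - _ = \sum_(i < p) u ^+ (p.+1 - bump 0 i) * v ^+ bump 0 i *+ 'C(p.+1, bump 0 i)).
    apply: subgrp_sum => // i _; have /dvdnP[c ->] : (p.+1 %| 'C(p.+1, bump 0 i))%N.
      by apply: prime_dvd_bin => //; rewrite /bump /= add1n ltnS ltn_ord.
    rewrite -mulr_natr natrM mulrA; apply: princMl => //.
    by do !apply: AM => //; [exact: AX|exact: AX|exact: A_nat].
  by ring.
elim: k => [|k IH]; first by rewrite expn0 !expr1 subrr; case: gl.
rewrite expnSr !exprM; set X := x ^+ _ in IH *; set Y := y ^+ _ in IH *; set W := (x + y) ^+ _ in IH *.
have AX' : A X by exact: AX. have AY : A Y by exact: AX.
have AW : A W by apply: AX => //; exact: AD.
apply: (subgrp_trans (y := (X + Y) ^+ p)) => //; last exact: step.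
rewrite subrXX; apply: princM => //; apply: A_sum => i.
by apply: AM => //; apply: AX => //; exact: AD.
Qed.

Lemma unity_sub1 l u k : A u -> princ A l (u - 1) -> princ A l (u ^+ k - 1).
Proof.
move=> Au h; rewrite subrX1; apply: princM => //.
by apply: A_sum => i; exact: AX.
Qed.

(** The powers of [u] sum to 0, and each is 1 modulo [u - 1]. *)
Lemma prim_root_natr d u : d.-primitive_root u -> (1 < d)%N -> A u ->
  princ A (u - 1) d%:R.
Proof.
move=> pu d1 Au; have gl := princ_subgrp (u - 1).
have S0 : \sum_(i < d) u ^+ i = 0.
  apply/eqP; have /eqP := subrX1 u d; rewrite (prim_expr_order pu) subrr eq_sym mulf_eq0.
  case/orP=> // /eqP u1; move: (prim_order_dvd pu 1); rewrite expr1.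
  by move/eqP: u1; rewrite subr_eq0 => ->; rewrite dvdn1 gtn_eqF.
have -> : d%:R = - \sum_(i < d) (u ^+ i - 1).
  by rewrite sumrB S0 sub0r opprK sumr_const card_ord.
apply: (subgrpN gl); apply: (subgrp_sum _ gl) => i _.
by apply: unity_sub1 => //; exact: princ_id.
Qed.

(* Synthetic division: [monf D g] says that [g] is a monic polynomial function of degree [D]
   with coefficients in [A]. *)
Fixpoint monf (D : nat) (g : F -> F) : Prop :=
  match D with
  | 0 => forall y, g y = 1
  | D'.+1 => exists c h, [/\ A c, monf D' h & forall y, g y = c + y * h y]
  end.

Lemma monfA D g y : monf D g -> A y -> A (g y).
Proof.
elim: D g => [|D IH] g /=; first by move=> -> _; exact: A1.
move=> [c [h [Ac mh ->]]] Ay; apply: AD => //; apply: AM => //; exact: IH.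
Qed.

Lemma monf_add D g h x : monf D.+1 g -> monf D h -> A x ->
  monf D.+1 (fun y => g y + x * h y).
Proof.
elim: D g h => [|D IH] g h [c [k [Ac mk Eg]]].
  move=> /= Eh Ax; exists (c + x), k; split=> //; first exact: AD.
  by move=> y; rewrite Eg Eh; ring.
move=> [c' [k' [Ac' mk' Eh]]] Ax; exists (c + x * c'), (fun y => k y + x * k' y); split.
- by apply: AD => //; exact: AM.
- exact: IH.
- by move=> y; rewrite Eg Eh; ring.
Qed.

Lemma monf_div D g x : monf D.+1 g -> A x ->
  exists2 h, monf D h & forall y, g y - g x = (y - x) * h y.
Proof.
elim: D g => [|D IH] g [c [h [Ac mh Eg]]] Ax.
  by exists (fun=> 1) => // y; rewrite !Eg !mh; ring.
have [h' mh' Eh'] := IH h mh Ax; exists (fun y => h y + x * h' y); first exact: monf_add.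
move=> y; rewrite !Eg; have -> : h x = h y - (y - x) * h' y by rewrite -Eh' subKr.
by ring.
Qed.

Lemma monf_roots M D g (n : nat) (t : nat -> F) : maxi A M -> monf D g ->
  (forall i, (i < n)%N -> A (t i)) ->
  (forall i j, (i < n)%N -> (j < n)%N -> M (t i - t j) -> i = j) ->
  (forall i, (i < n)%N -> M (g (t i))) -> (n <= D)%N.
Proof.
move=> mM; have [hM nM1 _] := mM.
elim: D g n => [|D IH] g [|n] // mg tA tI tg.
  by case: nM1; rewrite -(mg (t 0%N)); apply: tg.
have [h mh Eh] := monf_div mg (tA n (ltnSn n)).
rewrite ltnS; apply: (IH h) => //.
- by move=> i lti; apply: tA; exact: ltnW.
- by move=> i j lti ltj; apply: tI; exact: ltnW.
- move=> i lti; have Ai := tA i (ltnW lti).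
  have : M ((t i - t n) * h (t i)).
    by rewrite -Eh; apply: (nzi_subgrp hM).2; apply: tg => //; exact: ltnW.
  case/(max_prime rA mM _ (monfA mh Ai)) => //; first by apply: AB => //; exact: tA.
  by move=> /(tI _ _ (ltnW lti) (ltnSn n)) E; move: lti; rewrite E ltnn.
Qed.

Lemma monf_XnX N : (1 < N)%N -> monf N (fun y => y ^+ N - y).
Proof.
have mX k : monf k (fun y => y ^+ k).
  elim: k => [|k IH] //=; exists 0, (fun y => y ^+ k); split=> //; first exact: A0.
  by move=> y; rewrite exprS add0r.
case: N => [|[|k]] // _; exists 0, (fun y => -1 + y * y ^+ k); split; first exact: A0.
  by exists (-1), (fun y => y ^+ k); split=> //; apply: AN => //; exact: A1.
by move=> y; rewrite !exprS; ring.
Qed.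

Lemma max_card_le M N n : maxi A M -> (1 < N)%N -> idx A M n ->
  (forall x, A x -> M (x ^+ N - x)) -> (n <= N)%N.
Proof.
move=> mM N1 [t [tA tI _]] H; case: n t tA tI => // n t tA tI.
apply: (monf_roots (t := fun i => t (inord i)) mM (monf_XnX N1)) => //.
- by move=> i j lti ltj /tI /(congr1 val); rewrite /= !inordK.
- by move=> i _; exact: H.
Qed.

(* Multiplication by [x] permutes the nonzero classes of [A / M]. *)
Lemma max_fermat M n x : maxi A M -> idx A M n -> A x -> ~ M x -> M (x ^+ n.-1 - 1).
Proof.
move=> mM [t [tA tI tc]] Ax nMx; have [hM nM1 _] := mM; have gM := nzi_subgrp hM.
have [i0 Mi0] := tc 0 (A0 rA).
pose s i := projT1 (cid (tc (x * t i) (AM rA Ax (tA i)))).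
have sP i : M (x * t i - t (s i)) by rewrite /s; case: cid.
have s_inj : injective s.
  move=> i j sij; apply: tI; have : M (x * (t i - t j)).
    rewrite mulrBr; apply: (subgrp_trans (y := t (s i))) => //.
    by rewrite sij; apply: subgrpC.
  by case/(max_prime rA mM Ax (AB rA (tA i) (tA j))).
have Mt0 : M (t i0) by rewrite -[t i0]opprK -[- t i0]sub0r; exact: subgrpN.
have s0 : s i0 = i0.
  apply: tI; apply: gM.2 => //; rewrite -[t (s i0)](subKr (x * t i0)).
  by apply: gM.2; [exact: nziM hM Ax Mt0|exact: sP].
have nz i : i != i0 -> ~ M (t i).
  by move=> ni Mi; move/eqP: ni; apply; apply: tI; exact: gM.2.
pose P := \prod_(i | i != i0) t i.
have AP : A P by apply: (big_ind A) => // [|u v]; [exact: A1|exact: AM].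
have nMP : ~ M P.
  apply: (big_ind (fun v => A v /\ ~ M v) _ _ _).2 => [|u v [Au nu] [Av nv]|i ni].
  - by split=> //; exact: A1.
  - by split; [exact: AM|case/(max_prime rA mM Au Av)].
  - by split=> //; exact: nz.
have E1 : M (\prod_(i | i != i0) (x * t i) - \prod_(i | i != i0) t (s i)).
  have: [/\ A (\prod_(i | i != i0) (x * t i)), A (\prod_(i | i != i0) t (s i))
    & M (\prod_(i | i != i0) (x * t i) - \prod_(i | i != i0) t (s i))]; last by case.
  apply: (big_ind2 (fun u v => [/\ A u, A v & M (u - v)])) => [|u v u' v' [Au Av h] [Au' Av' h']|i _].
  - by split; [exact: A1|exact: A1|rewrite subrr; case: gM].
  - split; [exact: AM|exact: AM|].
    have -> : u * u' - v * v' = (u - v) * u' + v * (u' - v') by ring.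
    by apply: (subgrpD gM); [exact: nziMr hM Au' h|exact: nziM hM Av h'].
  - by split=> //; exact: AM.
have E2 : \prod_(i | i != i0) t (s i) = P.
  rewrite /P [RHS](reindex_inj s_inj); apply: eq_bigl => i /=.
  by rewrite -{2}s0 (inj_eq s_inj).
have E3 : \prod_(i | i != i0) (x * t i) = x ^+ n.-1 * P.
  rewrite big_split /= prodr_const; congr (_ ^+ _ * _).
  by rewrite (eq_card (B := predC1 i0)) // cardC1 card_ord.
have : M (P * (x ^+ n.-1 - 1)).
  by move: E1; rewrite E2 E3; congr M; ring.
case/(max_prime rA mM AP) => //.
by apply: AB => //; [exact: AX|exact: A1].
Qed.

End Residue.

Definition mpart (p q : nat) : nat := (q %/ p ^ logn p q)%N.

Lemma mpartE p q : (p ^ logn p q * mpart p q)%N = q.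
Proof. by rewrite mulnC divnK // pfactor_dvdnn. Qed.

Lemma mpart_gt0 p q : (0 < q)%N -> (0 < mpart p q)%N.
Proof. by rewrite -{1}(mpartE p q) muln_gt0 => /andP[]. Qed.

Lemma coprime_mpart p q : prime p -> (0 < q)%N -> coprime p (mpart p q).
Proof.
move=> pr_p q0; have [m cm Em] := pfactor_coprime pr_p q0.
by rewrite /mpart {1}Em mulnK // expn_gt0 prime_gt0.
Qed.

Lemma mpart_id p q : ~~ (p %| q)%N -> mpart p q = q.
Proof.
by move=> npq; rewrite /mpart lognE (negbTE npq) !andbF expn0 divn1.
Qed.

Section Cyclo.
Implicit Types (x y z : algC).

Definition Zadj z : set algC := [set x | exists p : {poly int}, x = (map_poly intr p).[z]].

Lemma Zadj_subring z : subring (Zadj z).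
Proof.
split; first by exists 1; rewrite rmorph1 hornerC.
- by move=> _ _ [p ->] [r ->]; exists (p - r); rewrite rmorphB /= hornerD hornerN.
- by move=> _ _ [p ->] [r ->]; exists (p * r); rewrite rmorphM /= hornerM.
Qed.

Lemma Zadj_gen z : Zadj z z.
Proof. by exists 'X; rewrite map_polyX hornerX. Qed.

Lemma Zadj_int z (c : int) : Zadj z c%:~R.
Proof. by exists c%:P; rewrite map_polyC hornerC. Qed.

(** Lets a congruence compatible with the ring operations be checked at the generator [z] only. *)
Lemma Zadj_ind z (S : set algC) : S 1 -> (forall x y, S x -> S y -> S (x - y)) ->
  (forall x y, S x -> S y -> S (x * y)) -> S z -> Zadj z `<=` S.
Proof.
move=> S1 SB SM Sz _ [p ->]; have rS : subring S by split.
have Sint (c : int) : S c%:~R.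
  by case: c => n; [exact: A_nat|rewrite NegzE rmorphN; apply: AN => //; exact: A_nat].
elim/poly_ind: p => [|p c IH]; first by rewrite rmorph0 horner0; exact: A0.
rewrite rmorphD rmorphM /= map_polyX map_polyC hornerD hornerM hornerX hornerC.
by apply: (AD rS); [exact: SM|exact: Sint].
Qed.

Lemma Zadj_sub z w : Zadj w z -> Zadj z `<=` Zadj w.
Proof. by have [? ? ?] := Zadj_subring w; exact: Zadj_ind. Qed.

Lemma Zadj_Aint z : z \in Aint -> forall x, Zadj z x -> x \in Aint.
Proof.
move=> Az x; apply: (@Zadj_ind z [set x | x \in Aint]) => //= [u v|u v]; first exact: rpredB.
exact: rpredM.
Qed.

Lemma eq_mod_small (u v N : nat) (w : int) : (u < N)%N -> (v < N)%N ->
  u%:Z - v%:Z - N%:Z * w = 0 -> u = v.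
Proof.
move=> lu lv h.
have [w1|[w0|w1]] : (w <= -1) \/ (w = 0) \/ (1 <= w) by lia.
- nia.
- by rewrite w0 in h; lia.
- nia.
Qed.

(** * The power basis of Z[z] *)

Section Basis.
Variables (m : nat) (z : algC).
Hypothesis pz : m.-primitive_root z.
Let n := totient m.

Definition bas (c : 'I_n -> int) : algC := \sum_i (c i)%:~R * z ^+ i.

Lemma basE (p : {poly int}) : (size p <= n)%N -> (map_poly intr p).[z] = bas (fun i => p`_i).
Proof.
move=> sp; rewrite (@horner_coef_wide _ n); last by apply: leq_trans (size_poly _ _) sp.
by apply: eq_bigr => i _; rewrite coef_map.
Qed.

Lemma Zadj_bas x : Zadj z x -> exists c, x = bas c.
Proof.
move=> [p ->]; pose P := 'Phi_m; have mP : P \is monic := Cyclotomic_monic m.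
rewrite {1}(Pdiv.RingMonic.rdivp_eq mP p).
exists (fun i => (Pdiv.Ring.rmodp p P)`_i); rewrite -basE.
  rewrite rmorphD rmorphM /= hornerD hornerM.
  have -> : (map_poly intr P).[z] = 0 :> algC.
    apply/eqP; change (root (map_poly (intr : int -> algC) P) z).
    by rewrite (Cintr_Cyclotomic pz) root_cyclotomic.
  by rewrite mulr0 add0r.
have := Pdiv.Ring.ltn_rmodpN0 p (monic_neq0 mP).
by rewrite /P size_Cyclotomic ltnS.
Qed.

(** The cyclotomic polynomial is the minimal polynomial of [z], so no nonzero integer polynomial of
    degree below [n] vanishes there. *)
Lemma bas_eq0 c : bas c = 0 -> forall i, c i = 0.
Proof.
move=> E i; pose p : {poly int} := \poly_(j < n) (if insub j is Some k then c k else 0).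
have sp : (size p <= n)%N by exact: size_poly.
have pc k : p`_(val k) = c k.
  by rewrite coef_poly ltn_ord valK.
have pz0 : (map_poly intr p).[z] = 0 :> algC.
  by rewrite basE // -E; apply: eq_bigr => k _; rewrite pc.
have [P [EP mP] HP] := minCpolyP z.
have sP : size P = n.+1.
  by have := size_cyclotomic z m; rewrite -(minCpoly_cyclotomic pz) EP size_map_poly.
have : (P %| map_poly intr p)%R.
  rewrite -HP -map_poly_comp /root; apply/eqP; rewrite -[RHS]pz0; congr (_.[_]).
  by apply: eq_map_poly => k /=; rewrite ratr_int.
have [p0 _|pn0 /dvdp_leq] := eqVneq (map_poly (intr : int -> rat) p) 0.
  rewrite -pc; apply/eqP; rewrite -(intr_eq0 rat) -(coef_map (intr : int -> rat)) p0.
  by rewrite coef0.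
move=> /(_ pn0); rewrite sP => h; exfalso.
by have := leq_trans h (leq_trans (size_poly _ _) sp); rewrite ltnn.
Qed.

Lemma Zadj_bas_mem c : Zadj z (bas c).
Proof.
have rZ := Zadj_subring z; apply: A_sum => // i; apply: AM => //; first exact: Zadj_int.
by apply: AX => //; exact: Zadj_gen.
Qed.

Lemma bas_mod N x : (0 < N)%N -> Zadj z x -> exists t : {ffun 'I_n -> 'I_N},
  princ (Zadj z) N%:R (x - bas (fun i => (t i : nat)%:Z)).
Proof.
move=> N0 /Zadj_bas [c ->]; have Nn0 : N%:Z != 0 by rewrite -lt0n in N0 *; case: N N0.
have lt i : (`|(c i %% N)%Z| < N)%N.
  by have := ltz_mod (c i) Nn0; have := modz_ge0 (c i) Nn0; lia.
exists [ffun i => Ordinal (lt i)]; exists (bas (fun i => (c i %/ N)%Z)).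
  exact: Zadj_bas_mem.
rewrite /bas mulr_sumr -sumrB; apply: eq_bigr => i _; rewrite ffunE /=.
rewrite gez0_abs ?modz_ge0 // {1}(divz_eq (c i) N) rmorphD rmorphM /=.
by rewrite -pmulrn; ring.
Qed.

(** Coordinates between 0 and N - 1 in the power basis give the transversal. *)
Lemma idx_nat N : (0 < N)%N -> idx (Zadj z) (princ (Zadj z) N%:R) (N ^ n).
Proof.
move=> N0; have cE : #|{ffun 'I_n -> 'I_N}| = (N ^ n)%N by rewrite card_ffun !card_ord.
pose T := {ffun 'I_n -> 'I_N}.
rewrite -cE; exists (fun k : 'I_#|{: T}| => bas (fun i => ((enum_val k : T) i : nat)%:Z)); split.
- by move=> k; exact: Zadj_bas_mem.
- move=> k l [a /Zadj_bas [b ->] E]; apply: enum_val_inj; apply/ffunP => i.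
  set f : T := enum_val k in E *; set g : T := enum_val l in E *.
  have /bas_eq0 /(_ i) : bas (fun i => ((f i : nat)%:Z - (g i : nat)%:Z - N%:Z * b i)) = 0.
    transitivity (bas (fun i => (f i : nat)%:Z) - bas (fun i => (g i : nat)%:Z) - N%:R * bas b);
      last by rewrite E subrr.
    rewrite /bas mulr_sumr -!sumrB; apply: eq_bigr => j _.
    by rewrite !rmorphB rmorphM /= -!pmulrn; ring.
  move=> h; apply: val_inj; have := ltn_ord (f i); have := ltn_ord (g i).
  by move=> lu lv; exact: eq_mod_small lv lu h.
- move=> x /(bas_mod N0) [t ht]; exists (enum_rank t).
  by rewrite enum_rankK.
Qed.

End Basis.

(** * Integrality, and the primes of the cyclotomic ring *)

Section Field.
Variables (q : nat) (z : algC).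
Hypothesis pz : q.-primitive_root z.
Local Notation A := (Zadj z).
Let rA : subring A := Zadj_subring z.

Let q_gt0 : (0 < q)%N. Proof. exact: prim_order_gt0 pz. Qed.

(** For q = p^a m with a > 0 the power of [z] is a primitive root of unity of order p^a. In both
    cases [lam] generates the product of the distinct primes above p. *)
Definition lam (p : nat) : algC := if (p %| q)%N then z ^+ mpart p q - 1 else p%:R.

Lemma Azk k : A (z ^+ k). Proof. by apply: AX => //; exact: Zadj_gen. Qed.

Lemma lamA p : A (lam p).
Proof.
rewrite /lam; case: ifP => _; last exact: A_nat.
by apply: AB => //; [exact: Azk|exact: A1].
Qed.

Lemma lam_neq0 p : prime p -> lam p != 0.
Proof.
move=> pr_p; rewrite /lam; case: ifP => [pq|_]; last by rewrite pnatr_eq0 -lt0n prime_gt0.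
rewrite subr_eq0 -(prim_order_dvd pz); apply/negP => /(dvdn_leq (mpart_gt0 p q_gt0)).
rewrite leqNgt => /negP; apply.
rewrite -{2}(mpartE p q) -[ltnLHS]mul1n ltn_mul2r mpart_gt0 //=.
by rewrite -[1%N](expn0 p) ltn_exp2l ?prime_gt1 // logn_gt0 mem_primes pr_p q_gt0.
Qed.

Lemma lam_dvd p : prime p -> princ A (lam p) p%:R.
Proof.
move=> pr_p; rewrite /lam; case: ifP => [pq|_]; last exact: princ_id.
have a0 : (0 < logn p q)%N by rewrite logn_gt0 mem_primes pr_p q_gt0.
have pw := dvdn_prim_root pz pq.
have Ew : (q %/ p)%N = ((mpart p q) * p ^ (logn p q).-1)%N.
  by rewrite -{1}(mpartE p q) -{1}(prednK a0) expnS -mulnA mulKn ?prime_gt0 // mulnC.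
apply: (princ_trans rA _ (prim_root_natr rA pw (prime_gt1 pr_p) (Azk _))).
rewrite Ew exprM; apply: unity_sub1 => //; first exact: Azk.
exact: princ_id.
Qed.

(** In the ramified case lam + 1 has p^a-th power 1, and Frobenius modulo p turns this into
    lam^(p^a) = 0 modulo p. *)
Lemma dvd_lam p : prime p -> exists2 E, (0 < E)%N & princ A p%:R (lam p ^+ E).
Proof.
move=> pr_p; rewrite /lam; case: ifP => [pq|_]; last by exists 1%N => //; exact: princ_id.
exists (p ^ logn p q)%N; first by rewrite expn_gt0 prime_gt0.
set u := z ^+ _; have Au : A u by exact: Azk.
have Au1 : A (u - 1) by apply: AB => //; exact: A1.
have := princ_frob rA (logn p q) pr_p (princ_id rA p%:R) Au1 (A1 rA).
rewrite subrK -exprM mulnC mpartE (prim_expr_order pz) expr1n opprD addrCA subrr addr0.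
by move=> h; rewrite -[_ ^+ _]opprK; apply: subgrpN => //; exact: princ_subgrp.
Qed.

(** Modulo [lam], which divides p, raising to the power p^f is a ring endomorphism, so only [z] has
    to be tested; there z^(p^f - 1) is a power of z^m, which is 1 modulo [lam]. *)
Lemma lam_pow p f : prime p -> (p ^ f = 1 %[mod (mpart p q)])%N ->
  forall x, A x -> princ A (lam p) (x ^+ (p ^ f) - x).
Proof.
move=> pr_p Ef; pose l := lam p; have gl := princ_subgrp rA l.
have N0 : (0 < p ^ f)%N by rewrite expn_gt0 prime_gt0.
have frob x y := @princ_frob _ _ rA p l x y f pr_p (lam_dvd pr_p).
pose S : set algC := [set x | A x /\ princ A l (x ^+ (p ^ f) - x)].
have SD x y : S x -> S y -> S (x + y).
  move=> [Ax hx] [Ay hy]; split; first exact: AD.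
  apply: (subgrp_trans (y := x ^+ (p ^ f) + y ^+ (p ^ f))) => //; first exact: frob.
  by rewrite opprD addrACA; exact: subgrpD.
have SM x y : S x -> S y -> S (x * y).
  move=> [Ax hx] [Ay hy]; split; first exact: AM.
  rewrite exprMn (_ : _ - _ = (x ^+ (p ^ f) - x) * y ^+ (p ^ f) + x * (y ^+ (p ^ f) - y)); last by ring.
  apply: (subgrpD gl); first by apply: princM => //; exact: AX.
  exact: princMl.
have S1 : S 1 by split; [exact: A1|rewrite expr1n subrr; case: gl].
have SN1 : S (-1).
  split; first by apply: AN => //; exact: A1.
  have := frob 1 (-1) (A1 rA) (AN rA (A1 rA)).
  rewrite subrr expr0n gtn_eqF // mulr0n expr1n sub0r => h.
  by rewrite opprK addrC -[_ + _]opprK; exact: subgrpN.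
have SB x y : S x -> S y -> S (x - y) by move=> hx hy; apply: SD => //; rewrite -mulN1r; exact: SM.
have Sz : S z.
  split; first exact: Zadj_gen.
  have [j Ej] : exists j, (p ^ f - 1 = (mpart p q) * j)%N.
    by move/eqP: Ef; rewrite eqn_mod_dvd // => /dvdnP[j ->]; exists j; rewrite mulnC.
  have -> : z ^+ (p ^ f) - z = z * ((z ^+ (mpart p q)) ^+ j - 1).
    by rewrite -exprM -Ej mulrBr mulr1 -exprS subn1 prednK.
  apply: princMl => //; last exact: Zadj_gen.
  rewrite /l /lam; case: ifPn => [pq|npq].
    by apply: unity_sub1 => //; [exact: Azk|exact: princ_id].
  by rewrite mpart_id // (prim_expr_order pz) expr1n subrr; case: (princ_subgrp rA p%:R).
by move=> x Ax; have [] := Zadj_ind S1 SB SM Sz Ax.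
Qed.

Lemma lam_good p : prime p -> good A (lam p).
Proof.
move=> pr_p; split; [exact: lamA|exact: lam_neq0|].
exists (p ^ totient (mpart p q))%N.
  by rewrite -[1%N](expn0 p) ltn_exp2l ?prime_gt1 // totient_gt0 mpart_gt0.
apply: lam_pow => //; apply: Euler_exp_totient; exact: coprime_mpart.
Qed.

Lemma Aint_coef y : y \in Aint -> forall i, (minCpoly y)`_i = (Num.floor (minCpoly y)`_i)%:~R.
Proof. by move=> /polyOverP Py i; apply/esym/eqP; rewrite -intrEfloor. Qed.

(** Integral closedness at p. Scaling the minimal equation of [y] shows that a power of
    [w = lam p * y] is a multiple of [lam p]; since A is reduced modulo [lam p], so is [w]. *)
Lemma Aint_lam p y : prime p -> y \in Aint -> A (lam p * y) -> A y.
Proof.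
move=> pr_p Ay Aly; have gl := lam_good pr_p; have l0 := lam_neq0 pr_p.
set l := lam p in Aly gl l0 *; set w := l * y in Aly.
have Pint := Aint_coef Ay.
pose P := minCpoly y; pose n := (size P).-1.
have sP : size P = n.+1 by rewrite prednK // ltnW // size_minCpoly.
have n0 : (0 < n)%N by rewrite -ltnS -sP size_minCpoly.
have Pn : P`_n = 1 by have := minCpoly_monic y; rewrite monicE lead_coefE => /eqP.
have E : w ^+ n = l * - \sum_(i < n) P`_i * l ^+ (n - i).-1 * w ^+ i.
  have := root_minCpoly y; rewrite /root horner_coef -/P sP big_ord_recr /= Pn mul1r => /eqP h.
  have {}h : y ^+ n = - \sum_(i < n) P`_i * y ^+ i by apply/eqP; rewrite -addr_eq0 addrC h.
  rewrite /w exprMn h !mulrN !mulr_sumr; congr (- _); apply: eq_bigr => i _.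
  rewrite -{1}(subnK (ltnW (ltn_ord i))) exprD -{1}(prednK (_ : 0 < n - i)%N) ?subn_gt0 //.
  by rewrite exprS exprMn; ring.
have [a Aa Ea] : princ A l w.
  apply: (good_radical rA (j := n) gl Aly); rewrite E.
  eexists; last by [].
  apply: AN => //; apply: A_sum => // i; rewrite /P Pint.
  by do !apply: AM => //; [exact: Zadj_int|apply: AX => //; exact: lamA|exact: AX].
by rewrite (mulfI l0 Ea).
Qed.

(** One prime factor p of n is removed at a time: p divides a power of [lam p], and [Aint_lam]
    cancels each factor of that power. *)
Lemma Aint_nat n y : (0 < n)%N -> y \in Aint -> A (n%:R * y) -> A y.
Proof.
have [k] := ubnP n; elim: k => // k IH in n y * => nk n0 Ay Any.
have [n1|n1] := leqP n 1.
  by move: Any; rewrite (_ : n = 1%N) ?mul1r //; apply/eqP; rewrite eqn_leq n1.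
have pr_p := pdiv_prime n1; set p := pdiv n in pr_p.
have /dvdnP[d Ed] := pdiv_dvd n; rewrite -/p in Ed.
have d0 : (0 < d)%N by move: n0; rewrite Ed muln_gt0 => /andP[].
apply: (IH d) => //.
  by rewrite ltnS in nk; apply: leq_trans nk; rewrite Ed ltn_Pmulr ?prime_gt1.
have Ady : d%:R * y \in Aint by rewrite rpredM // Aint_Cnat.
have [E E0 [u Au Eu]] := dvd_lam pr_p.
have : A (lam p ^+ E * (d%:R * y)).
  rewrite Eu mulrAC mulrA -natrM mulnC -Ed mulrC; exact: AM.
have Al : lam p \in Aint by apply: Zadj_Aint (lamA p); exact: Aint_prim_root pz.
elim: E {E0 Eu} => [|E IHE]; first by rewrite expr0 mul1r.
rewrite exprS -mulrA => /(Aint_lam pr_p) h; apply: IHE; apply: h.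
by rewrite rpredM // rpredX.
Qed.

(** Z[zeta_q] is the whole ring of integers: an integral element of the field has a nonzero integer
    multiple in A, obtained by clearing denominators, and [Aint_nat] removes the integer. *)
Lemma cycl_intsE : cycl_ints q = A.
Proof.
apply/seteqP; split=> [x [[w [p [pw Ex]] Ax]]|x Ax]; last first.
  split; last by apply: Zadj_Aint Ax; exact: Aint_prim_root pz.
  case: Ax => p Ep; exists z, (map_poly intr p); split=> //.
  rewrite Ep -map_poly_comp; congr (_.[_]).
  by apply: eq_map_poly => k /=; rewrite ratr_int.
have [P [a a0 Ep]] := rat_poly_scale p.
have [k _ Ek] : exists2 k, (k < q)%N & w = z ^+ k.
  have [k Ek] := prim_rootP pz (prim_expr_order pw).
  by exists k.
have Aw : A w by rewrite Ek; exact: Azk.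
have : A (a%:~R * x).
  rewrite Ex Ep map_polyZ /= hornerZ mulrA.
  rewrite (_ : ratr _ = a%:~R^-1); last by rewrite fmorphV /= ratr_int.
  have -> : map_poly ratr (map_poly intr P) = map_poly intr P :> {poly algC}.
    by rewrite -map_poly_comp; apply: eq_map_poly => k' /=; rewrite ratr_int.
  rewrite divff ?intr_eq0 // mul1r; apply: (Zadj_sub Aw); by exists P.
move=> h; apply: (@Aint_nat `|a|%N); rewrite ?absz_gt0 //.
rewrite -[_%:R]/(`|a|%N%:~R) abszE; case: (intP a) h {a0 Ep} => [|n|n] h.
- by rewrite normr0.
- by rewrite ger0_norm.
- by rewrite ltr0_norm // opprK -[_%:~R]opprK -rmorphN mulNr; apply: AN.
Qed.

(** The lowest nonzero coefficient of an integral equation of a nonzero [x] in I is an integer [d]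
    in I, after division by a power of [x]. Thus I lies between d A, of known index, and A. *)
Lemma finite_index I : nzi A I -> exists n, idx A I n.
Proof.
move=> hI; have [_ _ _ _ [x [Ix x0]]] := hI; have Ax := nziA hI Ix.
have gI := nzi_subgrp hI.
have ind n : forall c : nat -> int, \sum_(i < n) (c i)%:~R * x ^+ i = 0 ->
    (exists2 i, (i < n)%N & c i != 0) -> exists2 d : int, d != 0 & I d%:~R.
  elim: n => [|n IH] c; first by move=> _ [].
  rewrite big_ord_recl /= expr0 mulr1 => E [i lti ci].
  have E' : \sum_(i < n) (c (bump 0 i))%:~R * x ^+ bump 0 i =
      x * \sum_(i < n) (c i.+1)%:~R * x ^+ i.
    by rewrite mulr_sumr; apply: eq_bigr => j _; rewrite /bump /= add1n exprS mulrCA.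
  rewrite E' in E; have [c0|c0] := eqVneq (c 0%N) 0.
    move: E; rewrite c0 add0r => /eqP; rewrite mulf_eq0 (negbTE x0) /= => /eqP E.
    apply: (IH (fun i => c i.+1)) => //; case: i lti ci => [|i] lti ci; last by exists i.
    by rewrite c0 eqxx in ci.
  exists (c 0%N) => //; have -> : (c 0%N)%:~R = - (x * \sum_(i < n) (c i.+1)%:~R * x ^+ i).
    by apply/eqP; rewrite -addr_eq0 E.
  apply: (subgrpN gI); apply: (nziMr hI) => //; apply: A_sum => // j.
  by apply: AM => //; [exact: Zadj_int|exact: AX].
have [d d0 Id] : exists2 d : int, d != 0 & I d%:~R.
  have Aix : x \in Aint by apply: Zadj_Aint Ax; exact: Aint_prim_root pz.
  have Pint := Aint_coef Aix.
  apply: (ind (size (minCpoly x)) (fun i => Num.floor (minCpoly x)`_i)).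
    have := root_minCpoly x; rewrite /root horner_coef => /eqP h; rewrite -[RHS]h.
    by apply: eq_bigr => i _; rewrite -Pint.
  have s0 : (0 < size (minCpoly x))%N by apply: ltnW; exact: size_minCpoly.
  exists (size (minCpoly x)).-1; first by rewrite prednK.
  rewrite -(intr_eq0 algC) -Pint.
  by have := minCpoly_monic x; rewrite monicE lead_coefE => /eqP ->; exact: oner_neq0.
have Id' : I (`|d|%N)%:R.
  by case: (intP d) Id d0 => [|k|k] //; rewrite ?abszN // rmorphN => /(subgrpN gI); rewrite opprK.
have sub : princ A (`|d|%N)%:R `<=` I by move=> _ [a Aa ->]; exact: nziMr hI Aa Id'.
have d0' : (0 < `|d|)%N by rewrite absz_gt0.
have [n [_ [h _]]] := idx_between (princ_subgrp rA _) gI sub (nziA hI) (idx_nat pz d0').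
by exists n.
Qed.

Lemma max_contains_prime M : maxi A M -> exists2 p, prime p & M p%:R.
Proof.
move=> mM; have [hM nM1 _] := mM.
have := Nm_nat rA finite_index hM; set n := (Nm A M)`!; have : (0 < n)%N by rewrite fact_gt0.
have [k] := ubnP n; elim: k n => // k IH n nk n0 Mn.
have [n1|n1] := leqP n 1.
  by case: nM1; move: Mn; rewrite (_ : n = 1%N) //; apply/eqP; rewrite eqn_leq n1.
have pr_p := pdiv_prime n1; have /dvdnP[d Ed] := pdiv_dvd n.
have d0 : (0 < d)%N by move: n0; rewrite {1}Ed muln_gt0 => /andP[].
move: Mn; rewrite {1}Ed natrM => /(max_prime rA mM (A_nat rA d) (A_nat rA _)) [Md|]; last by exists (pdiv n).
apply: (IH d) => //; rewrite ltnS in nk; apply: leq_trans nk.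
by rewrite [ltnRHS]Ed ltn_Pmulr ?prime_gt1.
Qed.

Lemma max_lam M p : maxi A M -> prime p -> M (lam p) <-> M p%:R.
Proof.
move=> mM pr_p; have [hM _ _] := mM; split=> [Ml|Mp].
  by have [a Aa ->] := lam_dvd pr_p; exact: nziMr hM Aa Ml.
have [E _ [a Aa Ea]] := dvd_lam pr_p; apply: (max_primeX rA mM (lamA p) (n := E)).
by rewrite Ea; exact: nziMr hM Aa Mp.
Qed.

Lemma local_good M : maxi A M -> exists2 l, good A l & M l.
Proof.
move=> mM; have [p pr_p Mp] := max_contains_prime mM.
by exists (lam p); [exact: lam_good|apply/max_lam].
Qed.

Let NmP' := NmP finite_index.

(** Roots of unity of order prime to p stay distinct modulo M: if u is one of order d > 1 with u - 1
    in M, then d is in M, and with p also 1. Fermat in A modulo M therefore makes m divide N(M) -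
    1. *)
Lemma Nm_max_dvd M p k : maxi A M -> prime p -> M p%:R ->
  Nm A M = (p ^ k)%N -> (p ^ k = 1 %[mod mpart p q])%N.
Proof.
move=> mM pr_p Mp EN; have [hM nM1 _] := mM; set m := mpart p q.
have nMz : ~ M z.
  move=> Mz; apply: nM1; rewrite -(prim_expr_order pz) -(prednK q_gt0) exprS.
  by apply: (nziMr hM) Mz; exact: Azk.
have pk0 : (0 < p ^ k)%N by rewrite expn_gt0 prime_gt0.
have h := max_fermat rA mM (NmP' hM) (Zadj_gen z) nMz; rewrite EN in h.
apply/eqP; rewrite eqn_mod_dvd // subn1.
set N := (p ^ k).-1 in h *; pose a := (p ^ logn p q)%N.
have m0 : (0 < m)%N := mpart_gt0 p q_gt0.
have a0 : (0 < a)%N by rewrite expn_gt0 prime_gt0.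
have pe : m.-primitive_root (z ^+ a).
  have := dvdn_prim_root pz (_ : m %| q)%N; rewrite -{1 2}(mpartE p q) dvdn_mull // => /(_ isT).
  by rewrite mulnK.
have pu := exp_prim_root pe N; set d := (m %/ gcdn N m)%N in pu.
have dm : (d %| m)%N by apply: dvdn_div; exact: dvdn_gcdr.
have g0 : (0 < gcdn N m)%N by rewrite gcdn_gt0 m0 orbT.
have [d1|d1] := leqP d 1.
  have {}d1 : d = 1%N.
    by apply/eqP; rewrite eqn_leq d1 (prim_order_gt0 pu).
  have -> : m = gcdn N m by rewrite -[RHS]mul1n -d1 divnK ?dvdn_gcdr.
  exact: dvdn_gcdl.
have Au : A ((z ^+ a) ^+ N) by apply: AX => //; exact: Azk.
have Md : M d%:R.
  have [b Ab ->] := prim_root_natr rA pu d1 Au; apply: (nziMr hM) => //.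
  rewrite -exprM mulnC exprM.
  have [c Ac Ec] := unity_sub1 rA a (Azk N) (princ_id rA _).
  by rewrite Ec; apply: (nziMr hM).
case: nM1; have cpd : coprime p d by apply: coprime_dvdr dm (coprime_mpart pr_p q_gt0).
have [u v E _] := egcdnP d (prime_gt0 pr_p); rewrite (eqP cpd) in E.
have -> : 1 = u%:R * p%:R - v%:R * d%:R :> algC by rewrite -!natrM E natrD addrAC subrr add0r.
by apply: (nzi_subgrp hM).2; apply: nziM hM _ _ => //; exact: A_nat.
Qed.

Lemma Nm_max_pow M p : maxi A M -> prime p -> M p%:R ->
  exists2 k, (0 < k)%N & Nm A M = (p ^ k)%N.
Proof.
move=> mM pr_p Mp; have [hM nM1 _] := mM.
have p0 := prime_gt0 pr_p.
have hp : nzi A (princ A p%:R).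
  by apply: princ_nzi => //; [exact: A_nat|rewrite pnatr_eq0 -lt0n].
have sub : princ A p%:R `<=` M by move=> _ [a Aa ->]; exact: nziMr hM Aa Mp.
have [_ [b [_ hb]]] := idx_between (nzi_subgrp hp) (nzi_subgrp hM) sub (nziA hM) (NmP' hp).
have E := Nm_idx rA finite_index hp hM sub hb.
rewrite (NmE hp (idx_nat pz p0)) in E.
have /(dvdn_pfactor _ _ pr_p) [k _ Ek] : (Nm A M %| p ^ totient q)%N by rewrite E dvdn_mulr.
exists k => //; rewrite lt0n; apply/eqP => k0.
by have := maxi_Nm_gt1 rA finite_index mM; rewrite Ek k0.
Qed.

Definition res_deg p : nat :=
  xget 1%N [set f | [/\ (0 < f)%N, (p ^ f = 1 %[mod mpart p q])%N &
    forall k, (0 < k)%N -> (p ^ k = 1 %[mod mpart p q])%N -> (f <= k)%N]].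

Lemma res_degP p : prime p -> [/\ (0 < res_deg p)%N, (p ^ res_deg p = 1 %[mod mpart p q])%N &
    forall k, (0 < k)%N -> (p ^ k = 1 %[mod mpart p q])%N -> (res_deg p <= k)%N].
Proof.
move=> pr_p; apply: (@xgetPex _ 1%N [set f | [/\ (0 < f)%N, (p ^ f = 1 %[mod mpart p q])%N &
    forall k, (0 < k)%N -> (p ^ k = 1 %[mod mpart p q])%N -> (f <= k)%N]]).
have ex : exists k, (0 < k)%N && (p ^ k == 1 %[mod mpart p q])%N.
  exists (totient (mpart p q)); rewrite totient_gt0 mpart_gt0 //=.
  by apply/eqP/Euler_exp_totient/coprime_mpart.
case: (ex_minnP ex) => f /andP[f0 /eqP Ef] mf; exists f; split=> // k k0 Ek.
by apply: mf; rewrite k0; apply/eqP.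
Qed.

Lemma res_deg_dvd p k : prime p -> (p ^ k = 1 %[mod mpart p q])%N <-> (res_deg p %| k)%N.
Proof.
move=> pr_p; have [f0 Ef mf] := res_degP pr_p.
have E1 d : (p ^ (d * res_deg p) = 1 %[mod mpart p q])%N.
  by rewrite mulnC expnM -modnXm Ef modnXm exp1n.
split=> [Ek|/dvdnP[d ->]//].
rewrite /dvdn; apply: contraT; rewrite -lt0n => r0.
have := ltn_pmod k f0; rewrite ltnNge => /negP; case; apply: mf => //.
by rewrite -Ek [in RHS](divn_eq k (res_deg p)) expnD -[in RHS]modnMml E1 modnMml mul1n.
Qed.

(** At most, since all residues are roots of y^(p^f) - y; at least, since [res_deg] is the least
    exponent allowed by [Nm_max_dvd]. *)
Lemma Nm_max M p : maxi A M -> prime p -> M p%:R -> Nm A M = (p ^ res_deg p)%N.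
Proof.
move=> mM pr_p Mp; have [hM _ _] := mM; have [k k0 Ek] := Nm_max_pow mM pr_p Mp.
have [f0 Ef mf] := res_degP pr_p; apply/eqP; rewrite eqn_leq; apply/andP; split.
  apply: (max_card_le rA mM _ (NmP' hM)).
    by rewrite -[1%N](expn0 p) ltn_exp2l ?prime_gt1.
  move=> x Ax; have [a Aa ->] := lam_pow pr_p Ef Ax.
  by apply: (nziMr hM Aa); apply/max_lam.
rewrite Ek leq_exp2l ?prime_gt1 //; apply: mf => //.
exact: Nm_max_dvd Ek.
Qed.

Lemma Nm_lam_unram p : prime p -> ~~ (p %| q)%N -> Nm A (princ A (lam p)) = (p ^ totient q)%N.
Proof.
move=> pr_p npq; apply: NmE; first by apply: princ_nzi; [exact: rA|exact: lamA|exact: lam_neq0].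
rewrite /lam (negbTE npq); apply: idx_nat => //; exact: prime_gt0.
Qed.

(** Modulo [lam] the generator [z] equals z^(p^F) for F a multiple of the residue degree with F >=
    a, and this lies in Z[e], where e = z^(p^a) has order m. Coordinates modulo p in the power basis
    of Z[e] then cover A. *)
Lemma Nm_lam_ram p : prime p -> (Nm A (princ A (lam p)) <= p ^ totient (mpart p q))%N.
Proof.
move=> pr_p; set m := mpart p q; pose a := (p ^ logn p q)%N; pose e := z ^+ a.
have hl : nzi A (princ A (lam p)) by apply: princ_nzi; [exact: rA|exact: lamA|exact: lam_neq0].
have gl := nzi_subgrp hl.
have pe : m.-primitive_root e.
  have := dvdn_prim_root pz (_ : m %| q)%N; rewrite -{1 2}(mpartE p q) dvdn_mull // => /(_ isT).
  by rewrite mulnK ?mpart_gt0.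
have eA : Zadj e `<=` A by apply: Zadj_sub; exact: Azk.
have cong x : A x -> exists2 y, Zadj e y & princ A (lam p) (x - y).
  have re := Zadj_subring e.
  pose S : set algC := [set u | A u /\ exists2 y, Zadj e y & princ A (lam p) (u - y)].
  have [S1 SB SM Sz] : [/\ S 1, forall u v, S u -> S v -> S (u - v),
      forall u v, S u -> S v -> S (u * v) & S z].
    split.
    - by split; [exact: A1|exists 1; [exact: A1|rewrite subrr; case: gl]].
    - move=> u v [Au [y ey hy]] [Av [w ew hw]]; split; first exact: AB.
      exists (y - w); first exact: AB.
      have -> : u - v - (y - w) = (u - y) - (v - w) by ring.
      exact: gl.2.
    - move=> u v [Au [y ey hy]] [Av [w ew hw]]; split; first exact: AM.
      exists (y * w); first exact: AM.
      have -> : u * v - y * w = (u - y) * v + y * (v - w) by ring.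
      apply: (subgrpD gl); first exact: princM.
      by apply: princMl => //; exact: eA.
    - split; first exact: Zadj_gen.
      have [F [F1 Fa]] : exists F, (p ^ F = 1 %[mod m])%N /\ (logn p q <= F)%N.
        exists (res_deg p * logn p q)%N; split; last first.
          by rewrite leq_pmull //; case: (res_degP pr_p).
        by apply/res_deg_dvd => //; exact: dvdn_mulr.
      exists (z ^+ (p ^ F)).
        by rewrite -(subnKC Fa) expnD exprM; apply: AX => //; exact: Zadj_gen.
      by apply: (subgrpC gl); apply: lam_pow => //; exact: Zadj_gen.
  by move=> Ax; have [] := Zadj_ind S1 SB SM Sz Ax.
pose T := {ffun 'I_(totient m) -> 'I_p}.
pose s := [seq bas e (fun i => ((t : T) i : nat)%:Z) | t <- enum {: T}].
have [n sn hn] : exists2 n, (n <= size s)%N & idx A (princ A (lam p)) n.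
  apply: idx_cover => // [x /mapP[t _ ->]|x Ax].
    by apply: eA; exact: Zadj_bas_mem.
  have [y ey hy] := cong _ Ax.
  have [t [b eb Eb]] := bas_mod pe (prime_gt0 pr_p) ey.
  exists (bas e (fun i => (t i : nat)%:Z)); first by apply/mapP; exists t; rewrite ?mem_enum.
  apply: (subgrp_trans gl hy); rewrite Eb; apply: princM => //; first exact: lam_dvd.
  exact: eA.
rewrite (NmE hl hn); apply: leq_trans sn _.
by rewrite size_map -cardE card_ffun !card_ord.
Qed.

End Field.
End Cyclo.

(** * The coefficients of the logarithmic derivative *)

Section PrimeCount.
Variables (R : realType) (q : nat) (z : algC).
Hypothesis pz : q.-primitive_root z.
Local Notation A := (Zadj z).

Lemma prime_count_mem M k n : maxi A M -> (Nm A M ^ k.+1)%N = n ->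
  exists p, [/\ prime p, M p%:R & n = (p ^ (res_deg q p * k.+1))%N].
Proof.
move=> mM <-; have [p pr_p Mp] := max_contains_prime pz mM.
by exists p; split=> //; rewrite (Nm_max pz mM pr_p Mp) expnM.
Qed.

Lemma prime_count_eq0 n : (forall p j, prime p -> (0 < j)%N -> n <> (p ^ j)%N) ->
  prime_count A R n = 0%E.
Proof.
move=> Hn; apply: esum1 => -[M k] /= [mM E]; exfalso.
have [p [pr_p _ En]] := prime_count_mem mM E; apply: (Hn _ _ pr_p _ En).
by rewrite muln_gt0; case: (res_degP pz pr_p) => ->.
Qed.

(** All primes above p share the residue degree f, so j = f (k + 1) fixes k, and the sum that
    remains runs over the maximal ideals containing [lam]: it is evaluated by [esum_good]. *)
Lemma prime_count_pow p j : prime p -> (0 < j)%N ->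
  prime_count A R (p ^ j) =
  if (p ^ j == 1 %[mod mpart p q])%N then (ln (Nm A (princ A (lam q z p)))%:R)%:E else 0%E.
Proof.
move=> pr_p j0; have [f0 _ _] := res_degP pz pr_p; have rA := Zadj_subring z.
have memP M k : maxi A M /\ (Nm A M ^ k.+1)%N = (p ^ j)%N <->
    [/\ maxi A M, M (lam q z p) & (res_deg q p * k.+1)%N = j].
  split=> [[mM E]|[mM Ml E]].
    have [r [pr_r Mr En]] := prime_count_mem mM E.
    have {}pr : r = p.
      have : (r %| p ^ j)%N.
        by rewrite En Euclid_dvdX // dvdnn muln_gt0; case: (res_degP pz pr_r) => ->.
      by rewrite Euclid_dvdX // => /andP[+ _]; rewrite dvdn_prime2 // => /eqP.
    subst r; split=> //; first by apply/(max_lam pz mM pr_p).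
    by apply/esym; apply: (expnI (prime_gt1 pr_p)).
  split=> //; rewrite (Nm_max pz mM pr_p); last by apply/(max_lam pz mM pr_p).
  by rewrite -expnM E.
case: ifP => [/eqP Ej|nEj]; last first.
  apply: esum1 => -[M k] /memP [_ _ Ek]; exfalso; move/negP: nEj; apply; apply/eqP.
  by apply/(res_deg_dvd pz _ pr_p); rewrite -Ek dvdn_mulr.
have /dvdnP[[|k] Ek] : (res_deg q p %| j)%N by apply/(res_deg_dvd pz _ pr_p).
  by rewrite Ek in j0.
rewrite -(esum_good rA (finite_index pz) (local_good pz) R (lam_good pz pr_p)).
rewrite /prime_count (reindex_esum [set M | maxi A M /\ M (lam q z p)] _ (fun M => (M, k))) //.
split=> [M [mM Ml]|M M' _ _ [//]|[M k'] /memP [mM Ml Ek']].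
  by apply/memP; split=> //; rewrite mulnC.
exists M => //=; congr (_, _); apply/eqP; rewrite -eqSS -(eqn_pmul2l f0).
by rewrite Ek' Ek mulnC.
Qed.

End PrimeCount.

(** The interface between arithmetic and analysis: [a] counts ideals by norm and [c] is the ideal
    von Mangoldt function, exact at primes not dividing q and bounded at the others. *)
Lemma cyclotomic_dirichlet (R : realType) (q : nat) : (0 < q)%N ->
  exists a c : nat -> R,
  [/\ (forall n, 0 <= a n) /\ 1 <= a 1%N,
      (forall s : R, dedekind_zeta q s = fine (\esum_(n in [set: nat]) (a n * n%:R `^ (- s))%:E)),
      (forall g : nat -> R, (forall n, 0 <= g n) ->
         \esum_(n in [set: nat]) (a n * ln n%:R * g n)%:E =
         \esum_(d in [set: nat]) ((c d)%:E * \esum_(m in [set: nat]) (a m * g (d * m)%N)%:E)%E),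
      (forall n, (forall p j, prime p -> (0 < j)%N -> n <> (p ^ j)%N) -> c n = 0) &
      forall p j, prime p -> (0 < j)%N ->
        if (p %| q)%N
        then is_true (0 <= c (p ^ j)%N <=
          (if (p ^ j == 1 %[mod mpart p q])%N then (totient (mpart p q))%:R * ln p%:R else 0))
        else c (p ^ j)%N = if (p ^ j == 1 %[mod q])%N then (totient q)%:R * ln p%:R else 0].
Proof.
move=> q0; have [z pz] := C_prim_root_exists q0; have rA := Zadj_subring z.
have finA := finite_index pz; have locA := local_good pz.
have ln_nat0 n : 0 <= ln n%:R :> R.
  by case: n => [|n]; [rewrite ln0|apply: ln_ge0; rewrite ler1n].
have Nl0 p : prime p -> (0 < Nm (Zadj z) (princ (Zadj z) (lam q z p)))%N.
  move=> pr_p; apply: Nm_gt0 => //; apply: princ_nzi => //; first exact: lamA.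
  exact: lam_neq0.
have pc_fin n : prime_count (Zadj z) R n \is a fin_num.
  have [[p [j [pr_p j0 ->]]]|nex] := pselect (exists p j, [/\ prime p, (0 < j)%N & n = (p ^ j)%N]).
    by rewrite (prime_count_pow R pz) //; case: ifP.
  rewrite (prime_count_eq0 R pz) // => p j pr_p j0 E; apply: nex; by exists p, j.
exists (fun n => fine (ideal_count (Zadj z) R n)), (fun n => fine (prime_count (Zadj z) R n)).
have aE n (x : R) : (fine (ideal_count (Zadj z) R n) * x)%:E = (ideal_count (Zadj z) R n * x%:E)%E.
  by rewrite EFinM fineK // ideal_count_fin.
split.
- split=> [n|]; first by rewrite fine_ge0 // ideal_count_ge0.
  rewrite -lee_fin fineK ?ideal_count_fin //.
  by apply: (@esum_ge1 _ _ _ (fun=> 1%E) (Zadj z)); split; [exact: nzi_A|exact: Nm_A].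
- move=> s; rewrite /dedekind_zeta; congr fine.
  transitivity (\esum_(I in nzi (Zadj z)) ((Nm (Zadj z) I)%:R `^ (- s) : R)%:E).
    have -> : nz_ideal q = nzi (Zadj z).
      by apply/funext => I; rewrite /nz_ideal /nzi (cycl_intsE pz).
    apply: eq_esum => I hI; congr (_%:R `^ _)%:E.
    rewrite /ideal_norm (cycl_intsE pz); apply: xget_unique.
      exact: (idx_card_cosets (A_subgrp rA) (nzi_subgrp hI) (nziA hI) (NmP finA hI)).
    have hc := idx_card_cosets (A_subgrp rA) (nzi_subgrp hI) (nziA hI) (NmP finA hI).
    by move=> n hn; apply/card_eq_II; apply: card_eq_trans hc; rewrite card_eq_sym.
  rewrite (@esum_ideal_count _ (Zadj z) R (fun n => n%:R `^ (- s))) //.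
  by apply: eq_esum => n _; rewrite aE.
- move=> g g0.
  have lg0 n : 0 <= ln n%:R * g n by rewrite mulr_ge0.
  have := @esum_ideal_count _ (Zadj z) R _ lg0.
  rewrite (esum_ln_ideal rA finA locA g0) => E.
  transitivity (\esum_(n in [set: nat]) ideal_count (Zadj z) R n * (ln n%:R * g n)%:E)%E.
    by apply: eq_esum => n _; rewrite -mulrA aE.
  rewrite -E; apply: eq_esum => d _; rewrite fineK //; congr (_ * _)%E.
  by apply: eq_esum => m _; rewrite aE.
- by move=> n hn; rewrite (prime_count_eq0 R pz).
- move=> p j pr_p j0; rewrite (prime_count_pow R pz) //.
  have lnX k : ln (p ^ k)%:R = k%:R * ln p%:R :> R.
    by rewrite natrX lnXn ?ltr0n ?prime_gt0 // mulr_natl.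
  case: ifPn => [pq|npq]; last first.
    by rewrite (mpart_id npq); case: ifP => //= _; rewrite (Nm_lam_unram pz) // lnX.
  case: ifP => /= _; rewrite ?lexx //; apply/andP; split; first exact: ln_nat0.
  have N0 := Nl0 _ pr_p; have p0 := prime_gt0 pr_p.
  by rewrite -lnX ler_ln ?posrE ?ltr0n ?expn_gt0 ?p0 // ler_nat; exact: Nm_lam_ram.
Qed.

(** * Series *)

Section Series.
Variable R : realType.
Implicit Types (u v w : nat -> R).

Definition summ u := cvgn (series u).
Definition tsum u : R := limn (series u).

Lemma eq_tsum u v : u =1 v -> tsum u = tsum v.
Proof. by move=> /funext ->. Qed.

Lemma eq_summ u v : u =1 v -> summ u -> summ v.
Proof. by move=> /funext ->. Qed.

Lemma summ_cvg u : summ u -> (fun N => \sum_(k < N) u k) @ \oo --> tsum u.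
Proof.
by move=> h; under eq_fun do rewrite -(big_mkord xpredT u); exact: h.
Qed.

Lemma tsum_unique u l : (fun N => \sum_(k < N) u k) @ \oo --> l -> summ u /\ tsum u = l.
Proof.
move=> h; have E : (fun N => \sum_(k < N) u k) = series u.
  by apply/funext => N; rewrite /series /= big_mkord.
by rewrite /summ /tsum -E; split; [apply/cvg_ex; exists l|apply/cvg_lim].
Qed.

Lemma summD u v : summ u -> summ v -> summ (fun n => u n + v n).
Proof. exact: is_cvg_seriesD. Qed.

Lemma summB u v : summ u -> summ v -> summ (fun n => u n - v n).
Proof. exact: is_cvg_seriesB. Qed.

Lemma summZ (k : R) u : summ u -> summ (fun n => k * u n).
Proof. exact: is_cvg_seriesZ. Qed.

Lemma tsumD u v : summ u -> summ v -> tsum (fun n => u n + v n) = tsum u + tsum v.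
Proof. exact: lim_seriesD. Qed.

Lemma tsumB u v : summ u -> summ v -> tsum (fun n => u n - v n) = tsum u - tsum v.
Proof. exact: lim_seriesB. Qed.

Lemma tsumZ (k : R) u : summ u -> tsum (fun n => k * u n) = k * tsum u.
Proof. by move=> h; rewrite /tsum -[RHS](lim_seriesZ k h). Qed.

Lemma summZr (k : R) u : summ u -> summ (fun n => u n * k).
Proof. by move=> h; apply: eq_summ (summZ (k := k) h) => n; rewrite mulrC. Qed.

Lemma tsumZr (k : R) u : summ u -> tsum (fun n => u n * k) = tsum u * k.
Proof. by move=> h; rewrite mulrC -tsumZ //; apply: eq_tsum => n; rewrite mulrC. Qed.

Lemma le_tsum u v : summ u -> summ v -> (forall n, u n <= v n) -> tsum u <= tsum v.
Proof. exact: lim_series_le. Qed.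

Lemma summ_le u v : (forall n, `|u n| <= v n) -> summ v -> summ u.
Proof.
move=> uv hv; apply: normed_cvg; apply: (series_le_cvg _ _ _ hv) => n /=; [exact: normr_ge0| |exact: uv].
exact: le_trans (normr_ge0 _) (uv n).
Qed.

Lemma tsum_norm_le u v : (forall n, `|u n| <= v n) -> summ v -> `|tsum u| <= tsum v.
Proof.
move=> uv hv; have hu := summ_le uv hv.
rewrite ler_norml; apply/andP; split; last first.
  by apply: le_tsum => // n; exact: le_trans (ler_norm _) (uv n).
rewrite -mulN1r -tsumZ //; apply: le_tsum => //; first exact: summZ.
by move=> n; have := uv n; rewrite ler_norml mulN1r => /andP[].
Qed.

Lemma tsum0 : tsum (fun=> 0) = 0.
Proof.
by apply: (tsum_unique _).2; under eq_fun do rewrite big1 //; exact: cvg_cst.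
Qed.

Lemma tsum_ge0 u : (forall n, 0 <= u n) -> 0 <= tsum u.
Proof.
move=> u0; have [hu|nhu] := pselect (summ u).
  rewrite -tsum0; apply: le_tsum => //; apply: (tsum_unique (l := 0) _).1.
  by under eq_fun do rewrite big1 //; exact: cvg_cst.
by rewrite /tsum dvgP // => ?; exact: nhu.
Qed.

Lemma psum_le_tsum u N : (forall n, 0 <= u n) -> summ u -> \sum_(k < N) u k <= tsum u.
Proof.
move=> u0 hu; apply: (limr_ge hu); near=> K.
have NK : (N <= K)%N by near: K; exact: nbhs_infty_ge.
rewrite /series /= -(big_mkord xpredT u) (big_cat_nat _ NK) //= lerDl.
by apply: sumr_ge0.
Unshelve. all: by end_near. Qed.

Lemma summ_bounded u (B : R) : (forall n, 0 <= u n) -> (forall N, \sum_(k < N) u k <= B) ->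
  summ u /\ tsum u <= B.
Proof.
move=> u0 uB; have hu : summ u.
  apply: nondecreasing_is_cvgn.
    by apply/nondecreasing_seqP => n; rewrite /series /= big_nat_recr //= lerDl.
  by exists B => _ [N _ <-]; rewrite /series /= big_mkord.
by split=> //; apply: (limr_le hu); near=> K; rewrite /series /= big_mkord.
Unshelve. all: by end_near. Qed.

(** Zeros replace the first terms, so a tail keeps the indexing of its series. *)
Definition tail u N := fun n => if (n < N)%N then 0 else u n.

Lemma psum_tail u N K : (N <= K)%N -> \sum_(k < K) tail u N k = \sum_(k < K) u k - \sum_(k < N) u k.
Proof.
move=> NK; rewrite -!(big_mkord xpredT) [X in X - _](big_cat_nat _ NK) //= addrAC subrr add0r.
rewrite (big_cat_nat _ NK) //= big_nat big1 ?add0r; last by move=> i /andP[_ iN]; rewrite /tail iN.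
by apply: eq_big_nat => i /andP[Ni _]; rewrite /tail ltnNge Ni.
Qed.

Lemma tsum_tail u N : summ u -> summ (tail u N) /\ tsum u = \sum_(k < N) u k + tsum (tail u N).
Proof.
move=> hu; have : (fun K => \sum_(k < K) tail u N k) @ \oo --> tsum u - \sum_(k < N) u k.
  apply: cvg_trans (cvgB (summ_cvg hu) (cvg_cst (\sum_(k < N) u k))).
  apply: near_eq_cvg; near=> K; rewrite psum_tail //.
  by near: K; exact: nbhs_infty_ge.
by case/tsum_unique=> h ->; split=> //; rewrite addrC subrK.
Unshelve. all: by end_near. Qed.

Lemma esum_summ u : (forall n, 0 <= u n) -> summ u ->
  \esum_(n in [set: nat]) (u n)%:E = (tsum u)%:E.
Proof.
move=> u0 hu; rewrite -nneseries_esumT; last by move=> n; rewrite lee_fin.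
rewrite -EFin_lim //; congr (limn _); apply/funext => N.
by rewrite /= /series /= sumEFin.
Qed.

Lemma summ_esum u : (forall n, 0 <= u n) ->
  (\esum_(n in [set: nat]) (u n)%:E < +oo)%E -> summ u.
Proof.
move=> u0; rewrite -nneseries_esumT; last by move=> n; rewrite lee_fin.
exact: nnseries_is_cvg.
Qed.

(** Dominated convergence for series: beyond a cut where the tail of [v] is at most e / 3 both sums
    are small, and the finite part converges termwise. *)
Lemma tannery (f : R -> nat -> R) w v : summ v ->
  (\forall s \near 1^'+, forall n, `|f s n| <= v n) -> (forall n, `|w n| <= v n) ->
  (forall n, f s n @[s --> 1^'+] --> w n) -> tsum (f s) @[s --> 1^'+] --> tsum w.
Proof.
move=> hv fv wv fw; apply/cvgrPdist_le => e e0.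
have v0 n : 0 <= v n by apply: le_trans (wv n).
have [N hN] : exists N, tsum (tail v N) <= e / 3.
  have /cvgrPdist_le /(_ (e / 3)) := summ_cvg hv.
  case; first by rewrite divr_gt0.
  move=> N _ /(_ N (leqnn N)) /= h; exists N.
  have [_ E] := tsum_tail N hv; move: h; rewrite E addrC addKr.
  by apply: le_trans; exact: ler_norm.
have tl u : (forall n, `|u n| <= v n) -> `|tsum u - \sum_(k < N) u k| <= e / 3.
  move=> uv; have [_ ->] := tsum_tail N (summ_le uv hv); rewrite addrC addKr.
  apply: le_trans hN; apply: tsum_norm_le; last by case: (tsum_tail N hv).
  by move=> n; rewrite /tail; case: ifP; rewrite ?normr0.
have : \sum_(k < N) f s k @[s --> 1^'+] --> \sum_(k < N) w k.
  elim: {hN tl} N => [|N IH]; first by under eq_fun do rewrite big_ord0; rewrite big_ord0; exact: cvg_cst.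
  by under eq_fun do rewrite big_ord_recr /=; rewrite big_ord_recr /=; apply: cvgD.
move=> /cvgrPdist_le /(_ (e / 3)) /(_ ltac:(by rewrite divr_gt0)) h.
near=> s.
have fs : forall n, `|f s n| <= v n by near: s.
have h1 := tl _ fs; have h2 := tl _ wv.
have h3 : `|\sum_(k < N) w k - \sum_(k < N) f s k| <= e / 3 by near: s.
have -> : tsum w - tsum (f s) = (tsum w - \sum_(k < N) w k) +
   (\sum_(k < N) w k - \sum_(k < N) f s k) - (tsum (f s) - \sum_(k < N) f s k) by ring.
apply: le_trans (ler_normB _ _) _; apply: le_trans (lerD (ler_normD _ _) (lexx _)) _.
by move: h1 h2 h3; lra.
Unshelve. all: by end_near. Qed.

Lemma abel_psum (b w : nat -> R) K :
  \sum_(n < K.+1) b n * w n =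
  (\sum_(n < K.+1) b n) * w K + \sum_(N < K) (\sum_(n < N.+1) b n) * (w N - w N.+1).
Proof.
elim: K => [|K IH]; first by rewrite !big_ord1 big_ord0 addr0.
by rewrite big_ord_recr /= IH [in RHS]big_ord_recr /= [X in _ = _ + X]big_ord_recr /=; ring.
Qed.

Lemma abel_tsum (b w : nat -> R) : let B N := \sum_(n < N.+1) b n in
  (fun K => B K * w K) @ \oo --> (0 : R) -> summ (fun N => B N * (w N - w N.+1)) ->
  summ (fun n => b n * w n) /\ tsum (fun n => b n * w n) = tsum (fun N => B N * (w N - w N.+1)).
Proof.
move=> B hB hS; apply: tsum_unique; rewrite -cvg_shiftS /=.
rewrite (_ : (fun n => \sum_(k < n.+1) b k * w k) =
    (fun K => B K * w K + \sum_(N < K) B N * (w N - w N.+1))); last first.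
  by apply/funext => K; rewrite abel_psum.
by have h := cvgD hB (summ_cvg hS); rewrite add0r in h; exact: h.
Qed.

End Series.

(** * Dirichlet series *)

Section Powers.
Variable R : realType.
Implicit Types (s x y : R) (n : nat).

Lemma ln_nat_ge0 n : 0 <= ln n%:R :> R.
Proof. by case: n => [|n]; [rewrite ln0|apply: ln_ge0; rewrite ler1n]. Qed.

Lemma ln_le_sub1 x : 0 < x -> ln x <= x - 1.
Proof. by move=> x0; have := expR_ge1Dx (ln x); rewrite lnK ?posrE //; lra. Qed.

Lemma expR_quad_ge0 x : 0 <= expR x - 1 - x.
Proof. by have := expR_ge1Dx x; lra. Qed.

Lemma expR_quad_le0 x : x <= 0 -> expR x - 1 - x <= x ^+ 2.
Proof.
move=> x0; have h1 := expR_ge1Dx x; have h2 : expR x - 1 <= x * expR x.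
  have := expR_ge1Dx (- x); have := expR_gt0 x; rewrite expRN.
  set E := expR x => E0 h; have : (1 - x) * E <= E^-1 * E by rewrite ler_wpM2r // ltW.
  by rewrite mulVf ?gt_eqF //; lra.
by nra.
Qed.

Lemma expR_quad x : expR x - 1 - x <= x ^+ 2 * expR `|x|.
Proof.
have [x0|x0] := leP 0 x; last first.
  apply: le_trans (expR_quad_le0 (ltW x0)) _; rewrite ler_peMr ?sqr_ge0 //.
  by have := expR_ge1Dx `|x|; have := normr_ge0 x; lra.
rewrite ger0_norm //; have h1 := expR_ge1Dx x.
have h2 : expR x - 1 <= x * expR x.
  have := expR_ge1Dx (- x); have := expR_gt0 x; rewrite expRN.
  set E := expR x => E0 h; have : (1 - x) * E <= E^-1 * E by rewrite ler_wpM2r // ltW.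
  by rewrite mulVf ?gt_eqF //; lra.
by have := expR_gt0 x; nra.
Qed.

Definition npow s n : R := n%:R `^ (- s).

Lemma npow_ge0 s n : 0 <= npow s n. Proof. exact: powR_ge0. Qed.

Lemma npowE s n : npow s n.+1 = expR (- s * ln n.+1%:R).
Proof. by rewrite /npow /powR pnatr_eq0. Qed.

Lemma npow0 s : s != 0 -> npow s 0 = 0.
Proof. by move=> s0; rewrite /npow powR0 // oppr_eq0. Qed.

Lemma npow_gt0 s n : 0 < npow s n.+1.
Proof. by rewrite npowE expR_gt0. Qed.

Lemma npowM s d m : npow s (d * m) = npow s d * npow s m.
Proof. by rewrite /npow natrM powRM ?ler0n. Qed.

Lemma npowD s t n : npow (s + t) n.+1 = npow s n.+1 * npow t n.+1.
Proof. by rewrite !npowE -expRD; congr expR; ring. Qed.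

Lemma npow_1 n : npow 1 n.+1 = n.+1%:R^-1.
Proof. by rewrite npowE mulN1r expRN lnK // posrE ltr0n. Qed.

Lemma npow_le s t n : t <= s -> npow s n.+1 <= npow t n.+1.
Proof.
move=> ts; rewrite !npowE ler_expR; have := ln_nat_ge0 n.+1; nra.
Qed.

Lemma npow_le1 s n : 0 <= s -> npow s n.+1 <= 1.
Proof.
move=> s0; apply: le_trans (npow_le n s0) _.
by rewrite npowE oppr0 mul0r expR0.
Qed.

Lemma ln_le_npow s n : 0 < s -> ln n%:R <= s^-1 * npow (- s) n.
Proof.
move=> s0; case: n => [|n]; first by rewrite ln0 // mulr_ge0 ?npow_ge0 // invr_ge0 ltW.
rewrite npowE opprK -ler_pdivrMl ?invr_gt0 // invrK.
by have := expR_ge1Dx (s * ln n.+1%:R); lra.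
Qed.

Lemma ln_succ n : ln n.+2%:R - ln n.+1%:R = ln (1 + n.+1%:R^-1) :> R.
Proof.
have n0 : 0 < n.+1%:R :> R by rewrite ltr0n.
rewrite -ln_div ?posrE ?ltr0n //; congr ln.
by rewrite -[n.+2%:R]natr1 mulrDl divff ?gt_eqF // mul1r.
Qed.

Lemma ln_succ_le n : ln n.+2%:R - ln n.+1%:R <= n.+1%:R^-1 :> R.
Proof.
rewrite ln_succ; apply: le_trans (ln_le_sub1 _) _; last by rewrite addrC addKr.
by rewrite ltr_pwDl // invr_ge0.
Qed.

Lemma ln_succ_ge n : n.+2%:R^-1 <= ln n.+2%:R - ln n.+1%:R :> R.
Proof.
have n0 : 0 < n.+1%:R :> R by rewrite ltr0n.
have n1 : 0 < n.+2%:R :> R by rewrite ltr0n.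
rewrite -opprB lerNr -ln_div ?posrE //.
apply: le_trans (ln_le_sub1 _) _; first by rewrite divr_gt0.
have -> : n.+1%:R = n.+2%:R - 1 :> R by rewrite -[n.+2%:R]natr1 addrK.
by rewrite mulrBl divff ?gt_eqF // mul1r addrAC subrr sub0r.
Qed.

Lemma npow_diff_le s n : 0 < s -> npow s n.+1 - npow s n.+2 <= s * npow (s + 1) n.+1.
Proof.
move=> s0; rewrite npowD npow_1; pose t : R := ln n.+2%:R - ln n.+1%:R.
have E : npow s n.+2 = npow s n.+1 * expR (- s * t).
  by rewrite !npowE -expRD; congr expR; rewrite /t; ring.
rewrite E -[X in X - _]mulr1 -mulrBr mulrCA ler_wpM2l ?npow_ge0 //.
have := expR_ge1Dx (- s * t); have := ln_succ_le n; rewrite -/t.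
move: (n.+1%:R^-1) (expR _) => v e h1 h2.
have : s * t <= s * v by rewrite ler_wpM2l // ltW.
by rewrite mulNr in h2; move: (s * t) (s * v) h2 => x y; lra.
Qed.

Lemma npow_diff_ge s n : 0 < s -> s * npow (s + 1) n.+2 <= npow s n.+1 - npow s n.+2.
Proof.
move=> s0; rewrite npowD npow_1; pose t : R := ln n.+2%:R - ln n.+1%:R.
have E : npow s n.+1 = npow s n.+2 * expR (s * t).
  by rewrite !npowE -expRD; congr expR; rewrite /t; ring.
rewrite E -[X in _ - X]mulr1 -mulrBr mulrCA ler_wpM2l ?npow_ge0 //.
have := expR_ge1Dx (s * t); have := ln_succ_ge n; rewrite -/t.
move: (n.+2%:R^-1) (expR _) => v e h1 h2.
have : s * v <= s * t by rewrite ler_wpM2l // ltW.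
by move: (s * t) (s * v) h2 => x y; lra.
Qed.

Lemma npow_cvg0 s : 0 < s -> npow s n.+1 @[n --> \oo] --> (0 : R).
Proof.
move=> s0; apply/cvgrPdist_le => e e0; near=> n; rewrite sub0r normrN ger0_norm ?npow_ge0 //.
rewrite npowE -[e]lnK ?posrE // ler_expR.
have h : expR (- ln e / s) <= n%:R by near: n; exact: nbhs_infty_ger.
rewrite mulNr lerNl -ler_pdivrMl // mulrC.
rewrite -[leLHS]expRK ler_ln ?posrE ?expR_gt0 ?ltr0n //.
by apply: le_trans h _; rewrite ler_nat.
Unshelve. all: by end_near. Qed.

Lemma psum_npow s N : 1 < s -> \sum_(k < N) npow s k <= 1 + (s - 1)^-1.
Proof.
move=> s1; have s0 : 0 < s - 1 by rewrite subr_gt0.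
have sn0 : s != 0 by rewrite gt_eqF // (lt_trans ltr01).
suff H K : \sum_(k < K.+2) npow s k <= 1 + (s - 1)^-1 * (1 - npow (s - 1) K.+1).
  have le0 : 0 <= (s - 1)^-1 by rewrite invr_ge0 ltW.
  have HK K : 1 + (s - 1)^-1 * (1 - npow (s - 1) K.+1) <= 1 + (s - 1)^-1.
    by rewrite lerD2l ler_piMr // gerBl npow_ge0.
  case: N => [|[|N]]; last exact: le_trans (H N) (HK N).
    by rewrite big_ord0 addr_ge0.
  by rewrite big_ord1 npow0 // addr_ge0.
elim: K => [|K IH].
  rewrite !big_ord_recl big_ord0 /= npow0 // add0r addr0 /bump /= addn0.
  rewrite !npowE ln1 !mulr0 expR0 subrr mulr0 addr0 //.
rewrite big_ord_recr /=; apply: le_trans (lerD IH (lexx _)) _.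
have := npow_diff_ge K s0; rewrite subrK; set A := npow s _; set B := npow _ K.+1; set C := npow _ K.+2.
rewrite -ler_pdivlMl //; lra.
Qed.

Lemma summ_npow s : 1 < s -> summ (npow s).
Proof.
by move=> s1; apply: (summ_bounded (npow_ge0 s) (fun N => psum_npow N s1)).1.
Qed.

End Powers.

(** A quadratic remainder identifies the derivative, so a series can be differentiated by estimating
    remainders term by term. *)
Lemma derive_quad (R : realType) (F : R -> R) (s d K eta : R) : 0 < eta ->
  (forall h, `|h| <= eta -> `|F (s + h) - F s - h * d| <= K * h ^+ 2) -> 'D_1 F s = d.
Proof.
move=> eta0 H; apply/cvg_lim => //; apply/cvgrPdist_le => e e0.
have K1 : 0 < `|K| + 1 by rewrite ltr_wpDl.
near=> h.
have h0 : h != 0 by near: h; exact: nbhs_dnbhs_neq.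
have hn0 : 0 < `|h| by rewrite normr_gt0.
have hle : `|h| <= Num.min eta (e / (`|K| + 1)).
  near: h; apply: dnbhs0_le; rewrite lt_min eta0 divr_gt0 //.
have /H hH : `|h| <= eta by apply: le_trans hle _; rewrite ge_min lexx.
have hK : (`|K| + 1) * `|h| <= e.
  by rewrite -ler_pdivlMl // mulrC; apply: le_trans hle _; rewrite ge_min lexx orbT.
rewrite /= -[h *: 1]/(h * 1) mulr1 [h + s]addrC -[h^-1 *: _]/(h^-1 * _).
have -> : d - h^-1 * (F (s + h) - F s) = - (h^-1 * (F (s + h) - F s - h * d)).
  by rewrite [in RHS]mulrBr mulrA mulVf // mul1r; ring.
rewrite normrN normrM normfV -ler_pdivlMl ?invr_gt0 // invrK.
apply: le_trans hH _; rewrite -real_normK ?num_real // expr2 mulrCA ler_wpM2l //.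
apply: le_trans hK; rewrite ler_wpM2r //; have := ler_norm K; lra.
Unshelve. all: by end_near. Qed.

(** * Convergence and logarithmic derivative from a convolution identity *)

Section Dirichlet.
Variables (R : realType) (a c : nat -> R).
Hypotheses (a0 : forall n, 0 <= a n) (c0 : forall n, 0 <= c n) (c00 : c 0%N = 0).
Hypothesis conv : forall g : nat -> R, (forall n, 0 <= g n) ->
  \esum_(n in [set: nat]) (a n * ln n%:R * g n)%:E =
  \esum_(d in [set: nat]) ((c d)%:E * \esum_(m in [set: nat]) (a m * g (d * m)%N)%:E)%E.
Hypothesis cs : forall s, 1 < s -> summ (fun n => c n * npow s n).

Lemma summ_finite (u : nat -> R) N : (forall n, (N <= n)%N -> u n = 0) ->
  summ u /\ tsum u = \sum_(k < N) u k.
Proof.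
move=> u0; apply: tsum_unique; apply: cvg_near_cst; near=> K.
have NK : (N <= K)%N by near: K; exact: nbhs_infty_ge.
rewrite -!(big_mkord xpredT u) (big_cat_nat _ NK) //= [X in _ + X]big_nat [X in _ + X]big1 ?addr0 //.
by move=> i /andP[/u0].
Unshelve. all: by end_near. Qed.

(** The convolution identity for the weight n^(-s) cut at N. The cut weight satisfies g(d m) <=
    d^(-s) g(m), because d m < N forces m < N; everything is finite before convergence is known. *)
Lemma dirichlet_psum_ln s N : 1 < s ->
  \sum_(k < N) a k * ln k%:R * npow s k <=
  tsum (fun n => c n * npow s n) * \sum_(k < N) a k * npow s k.
Proof.
move=> s1; set D := tsum _; set T := \sum_(k < N) a k * npow s k.
have T0 : 0 <= T by apply: sumr_ge0 => k _; rewrite mulr_ge0 ?npow_ge0.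
pose g n := if (n < N)%N then npow s n else 0.
have g0 n : 0 <= g n by rewrite /g; case: ifP; rewrite ?npow_ge0.
have [hs hE] : summ (fun n => a n * ln n%:R * g n) /\
    tsum (fun n => a n * ln n%:R * g n) = \sum_(k < N) a k * ln k%:R * npow s k.
  have [h ->] := @summ_finite (fun n => a n * ln n%:R * g n) N
    (fun n Nn => ltac:(by rewrite /g ltnNge Nn mulr0)).
  by split=> //; apply: eq_bigr => k _; rewrite /g ltn_ord.
have := conv g0; rewrite esum_summ //; last by move=> n; rewrite !mulr_ge0 ?ln_nat_ge0.
rewrite hE => E; rewrite -lee_fin E.
have -> : (D * T)%:E = \esum_(d in [set: nat]) (c d * npow s d * T)%:E.
  rewrite esum_summ; [by rewrite tsumZr //; exact: cs| |exact/summZr/cs].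
  by move=> n; rewrite !mulr_ge0 ?npow_ge0.
apply: le_esum => -[_|d _]; first by rewrite c00 !mul0r mul0e.
rewrite -mulrA EFinM; apply: lee_wpmul2l; first by rewrite lee_fin.
have [h hT] : summ (fun m => npow s d.+1 * (a m * g m)) /\
    tsum (fun m => npow s d.+1 * (a m * g m)) = npow s d.+1 * T.
  have [h ->] := @summ_finite (fun m => npow s d.+1 * (a m * g m)) N
    (fun n Nn => ltac:(by rewrite /g ltnNge Nn !mulr0)).
  by split=> //; rewrite mulr_sumr; apply: eq_bigr => k _; rewrite /g ltn_ord.
rewrite -hT -esum_summ //; last by move=> n; rewrite !mulr_ge0 ?npow_ge0.
apply: le_esum => m _; rewrite lee_fin mulrCA ler_wpM2l // /g.
case: ifP => h1; last by case: ifP; rewrite mulr_ge0 ?npow_ge0.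
by rewrite (leq_ltn_trans _ h1) ?leq_pmull // npowM.
Qed.

(* With respect to the weights [a n * n ^ -s], [n < N], the mean of [ln n] is at most
   [sum c n * n ^ -s], so Markov's inequality bounds the total mass uniformly in [N]. *)
Lemma dirichlet_summ s : 1 < s -> summ (fun n => a n * npow s n).
Proof.
move=> s1; set D := tsum (fun n => c n * npow s n).
have D0 : 0 <= D by apply: tsum_ge0 => n; rewrite mulr_ge0 ?npow_ge0.
(* For k >= K the logarithm exceeds 2 (D + 1), whence 2 (D + 1) (T N - T K) <= (D + 1) T N, that is,
   T N <= 2 T K. *)
pose K := (Num.truncn (expR (2 * (D + 1)))).+1.
pose x n := a n * npow s n.
have x0 n : 0 <= x n by rewrite mulr_ge0 ?npow_ge0.
pose T N := \sum_(k < N) x k.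
apply: (summ_bounded (B := 2 * T K) x0 _).1 => N; rewrite -/(T N).
have h1 : T N <= T K + \sum_(k < N) tail x K k.
  have [NK|/ltnW KN] := leqP N K; last by rewrite psum_tail // addrC subrK.
  rewrite ler_wpDr //; first by apply: sumr_ge0 => k _; rewrite /tail; case: ifP.
  rewrite /T -!(big_mkord xpredT x) (big_cat_nat _ NK) //= lerDl.
  exact: sumr_ge0.
have h2 : 2 * (D + 1) * \sum_(k < N) tail x K k <= \sum_(k < N) a k * ln k%:R * npow s k.
  rewrite mulr_sumr; apply: ler_sum => k _; rewrite /tail /x.
  case: ltnP => hk; first by rewrite mulr0 !mulr_ge0 ?npow_ge0 ?ln_nat_ge0.
  rewrite mulrA [_ * a k]mulrC; apply: ler_wpM2r; rewrite ?npow_ge0 //.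
  apply: ler_wpM2l => //.
  have k0 : (0 < k)%N by apply: leq_trans hk.
  rewrite -[leLHS]expRK ler_ln ?posrE ?expR_gt0 ?ltr0n //.
  by apply: le_trans (ltW (truncnS_gt _)) _; rewrite ler_nat.
have h3 := dirichlet_psum_ln N s1; rewrite -/D in h3.
have h4 : \sum_(k < N) a k * npow s k = T N by [].
rewrite h4 in h3.
have : 2 * (D + 1) * (T N - T K) <= (D + 1) * T N.
  apply: le_trans (_ : D * T N <= _); last first.
    by rewrite mulrDl lerDl mul1r; exact: sumr_ge0.
  apply: le_trans h3; apply: le_trans h2; apply: ler_wpM2l; lra.
have D1 : 0 < D + 1 by lra.
rewrite -mulrA mulrCA ler_pM2l //; lra.
Qed.

Lemma dirichlet_ln s : 1 < s -> summ (fun n => a n * ln n%:R * npow s n) /\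
  tsum (fun n => a n * ln n%:R * npow s n) =
  tsum (fun n => c n * npow s n) * tsum (fun n => a n * npow s n).
Proof.
move=> s1; set D := tsum (fun n => c n * npow s n); set Z := tsum (fun n => a n * npow s n).
have u0 n : 0 <= a n * ln n%:R * npow s n by rewrite !mulr_ge0 ?npow_ge0 ?ln_nat_ge0.
have E : \esum_(n in [set: nat]) (a n * ln n%:R * npow s n)%:E = (D * Z)%:E.
  rewrite conv; last exact: npow_ge0.
  transitivity (\esum_(d in [set: nat]) (c d * npow s d * Z)%:E).
    apply: eq_esum => d _; rewrite -[c d * _ * _]mulrA EFinM; congr (_ * _)%E.
    rewrite -tsumZ; last exact: dirichlet_summ.
    rewrite -esum_summ.
    - by apply: eq_esum => m _; rewrite npowM mulrCA.
    - by move=> m; rewrite !mulr_ge0 ?npow_ge0.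
    - exact/summZ/dirichlet_summ.
  have Z0 : 0 <= Z by apply: tsum_ge0 => m; rewrite mulr_ge0 ?npow_ge0.
  rewrite esum_summ; [by rewrite tsumZr //; exact: cs| |exact/summZr/cs].
  by move=> n; rewrite !mulr_ge0 ?npow_ge0.
have h : summ (fun n => a n * ln n%:R * npow s n) by apply: summ_esum => //; rewrite E ltry.
by split=> //; apply/EFin_inj; rewrite -esum_summ.
Qed.

Lemma dirichlet_derive (F : R -> R) s : 1 < s ->
  (forall t, 1 < t -> F t = tsum (fun n => a n * npow t n)) ->
  'D_1 F s = - tsum (fun n => a n * ln n%:R * npow s n).
Proof.
(* The second-order remainder carries ln(n)^2 and exp(|h| ln n), at most eta^(-2) n^(2 eta) and
   n^eta. Together they shift s by 3 eta, which stays above 1. *)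
move=> s1 FE; pose eta := (s - 1) / 4; have eta0 : 0 < eta by rewrite divr_gt0 ?subr_gt0.
have s3 : 1 < s - 3 * eta by rewrite /eta; lra.
pose K := (eta^-1) ^+ 2 * tsum (fun n => a n * npow (s - 3 * eta) n).
apply: (derive_quad (K := K) eta0) => h hh.
have sh1 : 1 < s + h by have := ler_norml h eta; rewrite hh => /esym/andP[]; rewrite /eta; lra.
have [sl _] := dirichlet_ln s1.
have ss := dirichlet_summ s1; have ssh := dirichlet_summ sh1; have ss3 := dirichlet_summ s3.
rewrite !FE // mulrN opprK -tsumZ // -tsumB // -tsumD; [|exact: summB|exact: summZ].
have -> : K * h ^+ 2 = tsum (fun n => h ^+ 2 * (eta^-1) ^+ 2 * (a n * npow (s - 3 * eta) n)).
  by rewrite tsumZ // /K; ring.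
apply: tsum_norm_le; last exact: summZ.
move=> n; have -> : a n * npow (s + h) n - a n * npow s n + h * (a n * ln n%:R * npow s n) =
  a n * (npow (s + h) n - npow s n + h * ln n%:R * npow s n) by ring.
rewrite normrM ger0_norm // [leRHS]mulrCA; apply: ler_wpM2l => //.
case: n => [|n].
  by rewrite !npow0 ?ln0 ?mulr0 ?mul0r ?subrr ?addr0 ?normr0 ?mulr_ge0 ?npow_ge0 ?sqr_ge0 // gt_eqF // (lt_trans ltr01).
set l := ln n.+1%:R; have l0 : 0 <= l by exact: ln_nat_ge0.
have -> : npow (s + h) n.+1 - npow s n.+1 + h * l * npow s n.+1 =
    npow s n.+1 * (expR (- h * l) - 1 - (- h * l)).
  by rewrite npowD [npow h _]npowE -/l; ring.
rewrite normrM ger0_norm ?npow_ge0 // ger0_norm ?expR_quad_ge0 //.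
apply: le_trans (ler_wpM2l (npow_ge0 _ _) (expR_quad _)) _.
rewrite normrM normrN (ger0_norm l0).
have e1 : expR (`|h| * l) <= npow (- eta) n.+1.
  by rewrite npowE opprK ler_expR ler_wpM2r.
have e2 : l <= eta^-1 * npow (- eta) n.+1 by exact: ln_le_npow.
have -> : npow (s - 3 * eta) n.+1 = npow s n.+1 * npow (- eta) n.+1 ^+ 3.
  by rewrite -[_ - _]/(s + _) npowD !npowE -expRM_natl; congr (_ * expR _); ring.
set E := npow (- eta) n.+1 in e1 e2 *; set P := npow s n.+1.
have E0 : 0 <= E by exact: npow_ge0.
rewrite [leRHS]mulrCA; apply: ler_wpM2l; first exact: npow_ge0.
have l2 : l ^+ 2 <= (eta^-1 * E) ^+ 2 by rewrite ler_sqr ?nnegrE // (le_trans l0).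
rewrite exprMn sqrrN -mulrA -[leRHS]mulrA; apply: ler_wpM2l; first exact: sqr_ge0.
apply: le_trans (ler_pM (sqr_ge0 _) (expR_ge0 _) l2 e1) _.
by rewrite exprMn -mulrA -exprSr.
Qed.

Lemma dirichlet_logderiv (F : R -> R) s : 1 < s -> 1 <= a 1%N ->
  (forall t, F t = fine (\esum_(n in [set: nat]) (a n * n%:R `^ (- t))%:E)) ->
  'D_1 F s / F s = - tsum (fun n => c n * npow s n).
Proof.
move=> s1 a1 FE.
have FE' t : 1 < t -> F t = tsum (fun n => a n * npow t n).
  move=> t1; rewrite FE esum_summ //; last exact: dirichlet_summ.
  by move=> n; rewrite mulr_ge0 ?npow_ge0.
rewrite (dirichlet_derive s1 FE') (dirichlet_ln s1).2 FE' // mulNr mulfK //.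
rewrite gt_eqF //; apply: lt_le_trans (psum_le_tsum 2 _ (dirichlet_summ s1)); last first.
  by move=> n; rewrite mulr_ge0 ?npow_ge0.
rewrite !big_ord_recl big_ord0 /= addr0 ltr_wpDl ?mulr_ge0 ?npow_ge0 //.
by rewrite mulr_gt0 //; [exact: lt_le_trans ltr01 a1|exact: (npow_gt0 s 0)].
Qed.

End Dirichlet.

(** * The von Mangoldt function *)

Section Mangoldt.
Variable R : realType.
Local Notation vM := (@vonMangoldt R).

Lemma vM_pow p j : prime p -> (0 < j)%N -> vM (p ^ j)%N = ln p%:R.
Proof.
by move=> pr_p; case: j => // j _; rewrite /vonMangoldt primesX // primes_prime // pdiv_pfactor.
Qed.

Lemma vM_prime p : prime p -> vM p = ln p%:R.
Proof. by move=> pr_p; rewrite -[X in vM X]expn1 vM_pow. Qed.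

Lemma vM_neq0 n : vM n != 0 -> exists p j, [/\ prime p, (0 < j)%N & n = (p ^ j)%N].
Proof.
rewrite /vonMangoldt; case: ifP => [|_]; last by rewrite eqxx.
case E: (primes n) => [|p [|]] // _ _.
have : p \in primes n by rewrite E mem_head.
rewrite mem_primes => /and3P[pr_p n0 pn].
exists p, (logn p n); split=> //; first by rewrite logn_gt0 E mem_head.
by rewrite [LHS](prod_prime_decomp n0) prime_decompE E /= big_seq1.
Qed.

Lemma vM_not_pow n : (forall p j, prime p -> (0 < j)%N -> n <> (p ^ j)%N) -> vM n = 0.
Proof.
move=> H; apply/eqP; apply: contraT => /vM_neq0 [p [j [pr_p j0 E]]].
by case: (H p j pr_p j0 E).
Qed.

Lemma vM_ge0 n : 0 <= vM n.
Proof. by rewrite /vonMangoldt; case: ifP => // _; exact: ln_nat_ge0. Qed.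

Lemma vM0 : vM 0%N = 0. Proof. by []. Qed.

Lemma vM_le_ln n : vM n <= ln n%:R.
Proof.
have [->|/vM_neq0 [p [j [pr_p j0 ->]]]] := eqVneq (vM n) 0; first exact: ln_nat_ge0.
have p0 := prime_gt0 pr_p.
rewrite vM_pow // ler_ln ?posrE ?ltr0n ?expn_gt0 ?p0 // ler_nat.
by rewrite -{1}[p]expn1 leq_exp2l // prime_gt1.
Qed.

(** Induction by n = p m: among the divisors of n that do not divide m, the only prime power is
    p^(v+1), with v the valuation of m at p. *)
Lemma sum_vM_dvd N n : (0 < n)%N -> (n <= N)%N -> \sum_(d < N.+1 | (d %| n)%N) vM d = ln n%:R.
Proof.
elim/ltn_ind: n => n IH n0 nN.
have [n1|n1] := leqP n 1.
  have -> : n = 1%N by apply/eqP; rewrite eqn_leq n1.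
  rewrite ln1 big1 // => d; rewrite dvdn1 => /eqP ->.
  by rewrite /vonMangoldt.
have pr_p := pdiv_prime n1; set p := pdiv n in pr_p.
have /dvdnP[m Em] := pdiv_dvd n; rewrite -/p in Em.
have m0 : (0 < m)%N by move: n0; rewrite Em muln_gt0 => /andP[].
have mn : (m < n)%N by rewrite Em ltn_Pmulr // prime_gt1.
have p0 := prime_gt0 pr_p.
have -> : ln n%:R = ln m%:R + ln p%:R :> R by rewrite Em natrM lnM // posrE ltr0n.
rewrite -(IH m mn m0 (leq_trans (ltnW mn) nN)).
set v := logn p m; have qN : (p ^ v.+1 < N.+1)%N.
  rewrite ltnS; apply: leq_trans nN; apply: dvdn_leq => //.
  by rewrite Em expnSr dvdn_pmul2r // pfactor_dvdn.
pose D := Ordinal qN.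
rewrite (bigID (fun d : 'I_N.+1 => (d %| m)%N)) /=; congr (_ + _).
  by apply: eq_bigl => d; rewrite andb_idl // => dm; rewrite Em dvdn_mulr.
have DP : (D %| n)%N && ~~ (D %| m)%N.
  by rewrite /= Em expnSr dvdn_pmul2r // -expnSr !pfactor_dvdn // leqnn ltnn.
rewrite (bigD1 D) //= vM_pow // big1 ?addr0 // => d /andP[/andP[dn dm] nD].
apply/eqP; apply: contraT => /vM_neq0 [r [j [pr_r j0 Ed]]]; case/negP: nD.
have rp : r = p.
  apply/eqP; apply: contraT => nrp; case/negP: dm; move: dn; rewrite Em Ed mulnC Gauss_dvdr //.
  by rewrite coprimeXl // prime_coprime // dvdn_prime2.
apply/eqP/val_inj => /=; rewrite Ed rp; congr (p ^ _)%N; apply/eqP; rewrite eqn_leq.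
move: dn dm; rewrite Ed rp !pfactor_dvdn // Em lognM // (lognE p p) pr_p p0 dvdnn /= divnn p0 logn1 addn1.
by rewrite -ltnNge => -> ->.
Qed.

Definition psi N : R := \sum_(n < N.+1) vM n.

Lemma psi_ge0 N : 0 <= psi N.
Proof. by apply: sumr_ge0 => n _; exact: vM_ge0. Qed.

Lemma psiS N : psi N.+1 = psi N + vM N.+1.
Proof. by rewrite /psi big_ord_recr. Qed.

Lemma ln_fact N K : (N <= K)%N -> ln N`!%:R = \sum_(d < K.+1) vM d * (N %/ d)%:R.
Proof.
elim: N => [|N IH] NK.
  by rewrite fact0 ln1 big1 // => d _; rewrite div0n mulr0.
rewrite factS natrM lnM ?posrE ?ltr0n ?fact_gt0 // (IH (ltnW NK)) -(sum_vM_dvd (ltn0Sn N) NK).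
rewrite [X in X + _]big_mkcond -big_split /=; apply: eq_bigr => -[[|d] ld] _ /=.
  by rewrite vM0 !mul0r addr0.
by rewrite divnS // natrD mulrDr; case: ifP; rewrite ?mulr1 ?mulr0.
Qed.

Lemma ln2_le1 : ln 2 <= 1 :> R.
Proof. by apply: le_trans (ln_le_sub1 _) _; rewrite ?ltr0n //; lra. Qed.

(** Chebyshev's argument with the central binomial coefficient, which is at most 4^N: in its
    logarithm, floor(2N/d) - 2 floor(N/d) is never negative and is at least 1 for N < d <= 2N. *)
Lemma psi_double N : psi (2 * N) - psi N <= 2 * N%:R.
Proof.
set K := (2 * N)%N; have NK : (N <= K)%N by rewrite /K; lia.
have E : ln K`!%:R - 2 * ln N`!%:R = ln 'C(K, N)%:R :> R.
  have -> : K`! = ('C(K, N) * (N`! * N`!))%N.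
    rewrite -(bin_fact NK); congr (_ * (_ * _`!))%N; rewrite /K; lia.
  rewrite !natrM !lnM ?posrE ?mulr_gt0 ?ltr0n ?fact_gt0 ?bin_gt0 //; ring.
have h1 : ln 'C(K, N)%:R <= 2 * N%:R :> R.
  apply: le_trans (_ : ln (2 ^ K)%:R <= _).
    rewrite ler_ln ?posrE ?ltr0n ?bin_gt0 ?expn_gt0 // ler_nat.
    have -> : (2 ^ K = \sum_(i < K.+1) 'C(K, i))%N.
      by rewrite -[2%N]/(1 + 1)%N expnDn; apply: eq_bigr => i _; rewrite !exp1n !muln1.
    by rewrite (bigD1 (Ordinal (NK : (N < K.+1)%N))) //= leq_addr.
  rewrite natrX lnXn ?ltr0n // -[_ *+ _]mulr_natl /K natrM -mulrA.
  by rewrite ler_wpM2l // -[leRHS]mulr1 ler_wpM2l // ln2_le1.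
apply: le_trans h1; rewrite -E (ln_fact NK) (ln_fact (leqnn K)) mulr_sumr -sumrB.
have -> : psi K - psi N = \sum_(d < K.+1) (if (N < d)%N then vM d else 0).
  rewrite /psi -!(big_mkord xpredT) (big_cat_nat (n := N.+1)) //= ?ltnS // addrAC subrr add0r.
  rewrite -(big_mkord xpredT (fun d => if (N < d)%N then vM d else 0)).
  rewrite [RHS](big_cat_nat (n := N.+1)) //= ?ltnS // [X in _ = X + _]big_nat.
  rewrite [X in _ = X + _]big1 ?add0r; last by move=> i /andP[_]; rewrite ltnS leqNgt => /negbTE ->.
  by apply: eq_big_nat => i /andP[-> _].
apply: ler_sum => d _; have -> : vM d * (K %/ d)%:R - 2 * (vM d * (N %/ d)%:R) =
  vM d * ((K %/ d)%:R - 2 * (N %/ d)%:R) by ring.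
have [Nd|dN] := ltnP N d.
  rewrite (divn_small Nd) mulr0 subr0 ler_peMr ?vM_ge0 // ler1n divn_gt0 //; first by rewrite -ltnS.
  exact: leq_ltn_trans Nd.
rewrite mulr_ge0 ?vM_ge0 // subr_ge0 -natrM ler_nat /K.
case: (posnP d) => [->|d0]; first by rewrite !divn0.
by rewrite leq_divRL // -mulnA leq_mul2l leq_divM orbT.
Qed.

(** Halving: for N = 2 k or 2 k + 1 the bound is at most 4 k + 2 k, plus 2 k for the last term in
    the odd case. *)
Lemma psi_le N : psi N <= 4 * N%:R.
Proof.
elim/ltn_ind: N => N IH.
case: N IH => [_|[_|N IH]].
- by rewrite /psi big_ord1 vM0 mulr0.
- by rewrite /psi !big_ord_recl big_ord0 vM0 /= add0r addr0; have -> : vM 1%N = 0 by []; rewrite mulr1.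
have [b [k [E kN]]] : exists (b : bool) k, N.+2 = (2 * k + b)%N /\ (0 < k)%N.
  exists (odd N.+2), (N.+2)./2; rewrite mul2n addnC odd_double_half; split=> //.
have hk : psi k <= 4 * k%:R by apply: IH; move: E; case: b; lia.
have h2 := psi_double k.
have k1 : 1 <= k%:R :> R by rewrite ler1n.
case: b E => E; last by rewrite E addn0 natrM; move: h2 hk k1; move: (psi _) (psi _) => x y; lra.
rewrite E addn1 psiS -[(2 * k).+1%:R]natr1 natrM.
have h3 : vM (2 * k).+1 <= 2 * k%:R.
  apply: le_trans (vM_le_ln _) _; apply: le_trans (ln_le_sub1 _) _; rewrite ?ltr0n //.
  by rewrite -natr1 addrK natrM.
by move: h2 hk h3 k1; move: (psi _) (psi _) (vM _) => x y w; lra.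
Qed.

Lemma ln_fact_le N : ln N`!%:R <= N%:R * ln N%:R :> R.
Proof.
elim: N => [|N IH]; first by rewrite fact0 ln1 mul0r.
rewrite factS natrM lnM ?posrE ?ltr0n ?fact_gt0 // -[X in X * ln _]natr1 mulrDl mul1r addrC lerD2r.
apply: le_trans IH _; rewrite ler_wpM2l //.
by case: N => [|N]; [rewrite ln0 // ln_nat_ge0|rewrite ler_ln ?posrE ?ltr0n // ler_nat].
Qed.

Lemma ln_fact_ge N : N%:R * ln N%:R - N%:R <= ln N`!%:R :> R.
Proof.
elim: N => [|N IH]; first by rewrite fact0 ln1 mul0r subr0.
rewrite factS natrM lnM ?posrE ?ltr0n ?fact_gt0 // -[X in X * ln _]natr1 -[X in _ - X]natr1.
have h : N%:R * (ln N.+1%:R - ln N%:R) <= 1 :> R.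
  case: N {IH} => [|N]; first by rewrite mul0r.
  rewrite mulrC -ler_pdivlMr ?ltr0n // mul1r; exact: ln_succ_le.
move: IH h; rewrite mulrBr; rewrite mulrDl mul1r.
move: (N%:R * ln N.+1%:R : R) (N%:R * ln N%:R : R) (ln N`!%:R : R) (ln N.+1%:R : R) (N%:R : R) => x y w l n.
lra.
Qed.

(** N times the sum lies between ln N! and ln N! + psi(N), since removing the floors in [ln_fact]
    costs at most 1 per term. *)
Lemma mertens N : (0 < N)%N ->
  ln N%:R - 1 <= \sum_(d < N.+1) vM d / d%:R <= ln N%:R + 4.
Proof.
move=> N0; have NR : 0 < N%:R :> R by rewrite ltr0n.
set S := \sum_(d < _) _; have E := ln_fact (leqnn N).
have h1 : ln N`!%:R <= N%:R * S.
  rewrite E mulr_sumr; apply: ler_sum => -[[|d] ld] _ /=; first by rewrite vM0 !mul0r mulr0.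
  rewrite mulrCA ler_wpM2l ?vM_ge0 // ler_pdivlMr ?ltr0n // -natrM ler_nat.
  exact: leq_divM.
have h2 : N%:R * S <= ln N`!%:R + psi N.
  rewrite E mulr_sumr /psi -big_split /=; apply: ler_sum => -[[|d] ld] _ /=.
    by rewrite vM0 !mul0r mulr0 addr0.
  rewrite mulrCA -[X in _ + X]mulr1 -mulrDr ler_wpM2l ?vM_ge0 //.
  rewrite ler_pdivrMr ?ltr0n // natr1 -natrM ler_nat ltnW //.
  by rewrite ltn_ceil.
have := ln_fact_le N; have := ln_fact_ge N; have := psi_le N => h3 h4 h5.
apply/andP; split; rewrite -(ler_pM2l NR).
  by rewrite mulrBr mulr1; exact: le_trans h4 h1.
rewrite mulrDr; apply: le_trans h2 _; apply: lerD => //.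
by rewrite mulrC.
Qed.

End Mangoldt.

(** * The Riemann zeta function at 1 *)

Section Zeta.
Variable R : realType.
Implicit Types (s : R) (n : nat).
Local Notation vM := (@vonMangoldt R).

Lemma tsum_shift (u : nat -> R) : summ u -> summ (fun n => u n.+1) /\
  tsum u = u 0%N + tsum (fun n => u n.+1).
Proof.
move=> hu; have h : (fun N => \sum_(k < N.+1) u k) @ \oo --> tsum u.
  by have := summ_cvg hu; rewrite -cvg_shiftS.
have : (fun N => \sum_(k < N) u k.+1) @ \oo --> tsum u - u 0%N.
  rewrite (_ : (fun N => _) = (fun N => \sum_(k < N.+1) u k - u 0%N)).
    exact: (cvgB h (cvg_cst (u 0%N))).
  by apply/funext => N; rewrite big_ord_recl /= addrC addKr.
by move=> /(@tsum_unique R (fun n => u n.+1)) [h1 ->]; split=> //; rewrite addrC subrK.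
Qed.

Lemma summ_vM s : 1 < s -> summ (fun n => vM n * npow s n).
Proof.
move=> s1; pose eta := (s - 1) / 2; have eta0 : 0 < eta by rewrite divr_gt0 ?subr_gt0.
have s2 : 1 < s - eta by rewrite /eta; lra.
apply: summ_le (summZ (k := eta^-1) (summ_npow s2)) => -[|n].
  by rewrite vM0 mul0r normr0 mulr_ge0 ?npow_ge0 // invr_ge0 ltW.
rewrite ger0_norm ?mulr_ge0 ?vM_ge0 ?npow_ge0 // npowD mulrCA mulrC ler_wpM2l ?npow_ge0 //.
exact: le_trans (vM_le_ln _ _) (ln_le_npow _ eta0).
Qed.

(** The convolution identity for the rational field, so that the lemmas on Dirichlet series also
    serve the Riemann zeta function. *)
Lemma riemann_conv (g : nat -> R) : (forall n, 0 <= g n) ->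
  \esum_(n in [set: nat]) ((0 < n)%N%:R * ln n%:R * g n)%:E =
  \esum_(d in [set: nat]) ((vM d)%:E *
    \esum_(m in [set: nat]) ((0 < m)%N%:R * g (d * m)%N)%:E)%E.
Proof.
move=> g0; have vM0' d : (0 <= (vM d)%:E)%E by rewrite lee_fin vM_ge0.
transitivity (\esum_(d in [set: nat]) \esum_(m in [set m | (0 < m)%N]) ((vM d)%:E * (g (d * m)%N)%:E)%E); last first.
  apply: eq_esum => d _; rewrite esumZl //; last by move=> m; rewrite lee_fin.
  congr (_ * _)%E; rewrite esum_mkcond; apply: eq_esum => m _.
  have -> : (m \in [set m | (0 < m)%N]) = (0 < m)%N by apply/idP/idP; rewrite inE.
  by case: (0 < m)%N; rewrite ?mul1r ?mul0r.
rewrite esum_esum; last by move=> d m _ _; rewrite mule_ge0 // lee_fin.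
rewrite (@esum_fiber _ _ _ (fun k => (vM k.1)%:E) (fun k => (k.1 * k.2)%N) (fun n => (g n)%:E)) //.
apply: eq_esum => n _; rewrite EFinM; congr (_ * _)%E.
case: n => [|n].
  by rewrite mul0r; apply/esym/esum1 => -[d m] [[_ /= m0] /eqP]; rewrite muln_eq0 (gtn_eqF m0) orbF => /eqP ->.
rewrite mul1r -(@sum_vM_dvd R n.+1 n.+1) //.
transitivity (\esum_(d in [set d | (d %| n.+1)%N]) (vM d)%:E); last first.
  rewrite (reindex_esum [set d | (d %| n.+1)%N] _ (fun d => (d, n.+1 %/ d)%N)) //; split.
  - move=> d dn; have d0 : (0 < d)%N := dvdn_gt0 (ltn0Sn n) dn.
    have h : (0 < n.+1 %/ d)%N by rewrite (divn_gt0 _ d0); exact: dvdn_leq.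
    have h' : (d * (n.+1 %/ d))%N = n.+1 by rewrite mulnC; exact: divnK.
    by split; [split|exact: h'].
  - by move=> d d' _ _ [].
  - move=> [d m] /= [[_ m0] E]; exists d; first by rewrite /= -E dvdn_mulr.
    by rewrite -E mulKn //; move: (ltn0Sn n); rewrite -E muln_gt0 => /andP[].
pose u d := if (d %| n.+1)%N then vM d else 0.
have [hu Eu] : summ u /\ tsum u = \sum_(k < n.+2) u k.
  apply: summ_finite => d nd; rewrite /u; case: ifP => // /dvdn_leq - /(_ isT).
  by rewrite leqNgt nd.
transitivity ((tsum u)%:E).
  by rewrite Eu big_mkcond.
rewrite -esum_summ //; last by move=> d; rewrite /u; case: ifP; rewrite ?vM_ge0.
rewrite [RHS]esum_mkcond; apply: eq_esum => d _; rewrite /u.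
have -> : (d \in [set d | (d %| n.+1)%N]) = (d %| n.+1)%N by apply/idP/idP; rewrite inE.
by case: (d %| n.+1)%N.
Qed.

Lemma zeta_ln s : 1 < s ->
  summ (fun n => ln n%:R * npow s n) /\
  tsum (fun n => ln n%:R * npow s n) = tsum (fun n => vM n * npow s n) * tsum (npow s).
Proof.
move=> s1; have sn0 : s != 0 by rewrite gt_eqF // (lt_trans ltr01).
have a0 n : 0 <= (0 < n)%N%:R :> R by [].
have [h1 h2] := dirichlet_ln a0 (vM_ge0 R) (vM0 R) riemann_conv summ_vM s1.
have E1 n : (0 < n)%N%:R * ln n%:R * npow s n = ln n%:R * npow s n.
  by case: n => [|n]; rewrite ?mul1r // npow0 // !mulr0.
have E2 n : (0 < n)%N%:R * npow s n = npow s n.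
  by case: n => [|n]; rewrite ?mul1r // npow0 // !mulr0.
by rewrite (eq_tsum E1) (eq_tsum E2) in h2; split=> //; exact: eq_summ h1.
Qed.

Lemma zeta_bounds s : 1 < s -> (s - 1)^-1 <= tsum (npow s) <= 1 + (s - 1)^-1.
Proof.
move=> s1; have s0 : 0 < s - 1 by rewrite subr_gt0.
have sn0 : s != 0 by rewrite gt_eqF // (lt_trans ltr01).
apply/andP; split; last by exact: (summ_bounded (npow_ge0 s) (fun N => psum_npow N s1)).2.
have h1 : (fun N => (s - 1)^-1 * (1 - npow (s - 1) N.+1)) @ \oo --> (s - 1)^-1 * (1 - 0).
  by apply: cvgMr; apply: cvgB; [exact: cvg_cst|exact: npow_cvg0].
rewrite subr0 mulr1 in h1.
rewrite -(cvg_lim _ h1) //; apply: limr_le; first by apply/cvg_ex; eexists; exact: h1.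
suff H N : (s - 1)^-1 * (1 - npow (s - 1) N.+1) <= \sum_(k < N.+1) npow s k.
  by near=> N; apply: le_trans (H N) (psum_le_tsum N.+1 (npow_ge0 s) (summ_npow s1)).
elim: N => [|N IH].
  by rewrite npowE ln1 mulr0 expR0 subrr mulr0; apply: sumr_ge0 => k _; exact: npow_ge0.
rewrite big_ord_recr /=; apply: le_trans (lerD IH (lexx _)).
have := npow_diff_le N s0; rewrite subrK => h.
rewrite -lerBlDl -mulrBr ler_pdivrMl //; lra.
Unshelve. all: by end_near. Qed.

Lemma npow_cvg (t : R) n : npow (s - t) n.+1 @[s --> (1 : R)^'+] --> npow (1 - t) n.+1.
Proof.
under eq_fun do rewrite npowE; rewrite npowE.
apply: cvg_at_right_filter; apply: (cvg_comp (fun s => - (s - t) * ln n.+1%:R) expR); last exact: continuous_expR.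
by apply: cvgMl; apply: cvgN; apply: cvgB; [exact: cvg_id|exact: cvg_cst].
Qed.

Lemma npow_cvg1 n : npow s n.+1 @[s --> (1 : R)^'+] --> npow 1 n.+1.
Proof. by have := @npow_cvg 0 n; rewrite subr0; under eq_fun do rewrite subr0. Qed.

Lemma npow_cvg1' n : npow (s - 1) n.+1 @[s --> (1 : R)^'+] --> (1 : R).
Proof.
have h := @npow_cvg 1 n.
by have E : npow (1 - 1) n.+1 = 1 :> R; [rewrite npowE subrr oppr0 mul0r expR0|rewrite E in h].
Qed.

(** With f(x) = x^(-s) (1 - (s - 1) ln x), the derivative of x^(1-s) ln x, this is f(n+1) minus the
    integral of f from n+1 to n+2. The integrals telescope to 0 over all n, and the differences are
    summable uniformly up to s = 1, where they become [zeta_err1], whose sum is Euler's constant. *)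
Definition zeta_err s n : R :=
  (1 - (s - 1) * ln n.+1%:R) * npow s n.+1 -
  (npow (s - 1) n.+2 * ln n.+2%:R - npow (s - 1) n.+1 * ln n.+1%:R).

Definition zeta_err1 n : R := n.+1%:R^-1 - (ln n.+2%:R - ln n.+1%:R).

Lemma ln_succ_near n : let y : R := n.+1%:R^-1 in let t : R := ln n.+2%:R - ln n.+1%:R in
  [/\ 0 < y, y <= 1, 0 <= t, t <= y & y - y ^+ 2 <= t].
Proof.
move=> y t; have n0 : 0 < n.+1%:R :> R by rewrite ltr0n.
have y0 : 0 < y by rewrite invr_gt0.
have y1 : y <= 1 by rewrite invf_le1 // ler1n.
have h1 : t <= y by exact: ln_succ_le.
have h2 : n.+2%:R^-1 <= t := ln_succ_ge R n.
have h3 : y - y ^+ 2 <= n.+2%:R^-1.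
  have -> : n.+2%:R^-1 = y / (1 + y) :> R.
    rewrite /y -[n.+2%:R]natr1; field.
    have n0' : 0 <= n%:R :> R by [].
    by apply/andP; split; rewrite gt_eqF //; lra.
  rewrite ler_pdivlMr; last by lra.
  by nra.
split=> //; last exact: le_trans h3 h2.
by apply: le_trans h2; rewrite invr_ge0.
Qed.

Lemma zeta_err_le s n : 1 < s -> s <= 2 -> `|zeta_err s n| <= 7 * npow (3 / 2) n.+1.
Proof.
move=> s1 s2; have [] := ln_succ_near n; set y := n.+1%:R^-1; set t := _ - _ => y0 y1 t0 ty yt.
set a : R := ln n.+1%:R; have a0 : 0 <= a by exact: ln_nat_ge0.
pose sg := s - 1; have sg0 : 0 < sg by rewrite subr_gt0. have sg1 : sg <= 1 by rewrite /sg; lra.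
set P := npow sg n.+1; have P0 : 0 <= P by exact: npow_ge0.
have P1 : P <= 1 by apply: npow_le1; exact: ltW.
pose e := expR (- sg * t) - 1 + sg * t.
have e0 : 0 <= e by have := expR_quad_ge0 (- sg * t); rewrite /e mulNr opprK.
have e1 : e <= t ^+ 2.
  have st0 : - sg * t <= 0 by rewrite mulNr oppr_le0 mulr_ge0 // ltW.
  have -> : e = expR (- sg * t) - 1 - (- sg * t) by rewrite /e; ring.
  apply: le_trans (expR_quad_le0 st0) _; rewrite exprMn sqrrN.
  by rewrite ler_piMl ?sqr_ge0 // expr_le1 // ltW.
(* [e] is the remainder of exp(-sg t) after its linear term. The first-order terms cancel: [y - t],
   [t ^+ 2] and [e] are all at most [y ^+ 2]. *)
have E : zeta_err s n = P * ((y - t) * (1 - sg * a) + sg * t ^+ 2 - e * (a + t)).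
  have E1 : npow s n.+1 = P * y by rewrite /P /y -npow_1 -npowD /sg subrK.
  have E2 : npow sg n.+2 = P * (1 - sg * t + e).
    have -> : 1 - sg * t + e = expR (- sg * t) by rewrite /e; ring.
    by rewrite /P !npowE -expRD; congr expR; rewrite /t; ring.
  have E3 : ln n.+2%:R = a + t by rewrite /t addrC subrK.
  by rewrite /zeta_err -/sg E1 E2 E3 -/P -/a; ring.
have b1 : `|(y - t) * (1 - sg * a)| <= y ^+ 2 * (1 + a).
  rewrite normrM; apply: ler_pM => //; first by rewrite ger0_norm; lra.
  apply: le_trans (ler_normB _ _) _; rewrite normr1 lerD2l.
  have sa : 0 <= sg * a by rewrite mulr_ge0 // ltW.
  by rewrite ger0_norm // ler_piMl.
have t2 : t ^+ 2 <= y ^+ 2 by rewrite ler_sqr ?nnegrE // ltW.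
have b2 : `|sg * t ^+ 2| <= y ^+ 2.
  rewrite ger0_norm; last by rewrite mulr_ge0 ?sqr_ge0 // ltW.
  by apply: le_trans t2; rewrite ler_piMl ?sqr_ge0.
have b3 : `|e * (a + t)| <= y ^+ 2 * (a + 1).
  rewrite ger0_norm; last by rewrite mulr_ge0 // addr_ge0.
  apply: ler_pM => //; [by rewrite addr_ge0|exact: le_trans t2|lra].
have b4 : `|zeta_err s n| <= (2 * a + 3) * y ^+ 2.
  rewrite E normrM (ger0_norm P0); apply: le_trans (ler_piMl _ P1) _ => //.
  apply: le_trans (ler_normB _ _) _; apply: le_trans (lerD (ler_normD _ _) (lexx _)) _.
  by move: b1 b2 b3; lra.
(* The constant 7 is 2 * 2 + 3: the logarithm [a] is at most twice the square root of n+1, and 1 is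
   at most that root. *)
apply: le_trans b4 _.
have -> : npow (3 / 2) n.+1 = npow (- (1 / 2)) n.+1 * y ^+ 2 :> R.
  rewrite /y -(npow_1 R n) expr2 -!npowD; congr npow; lra.
rewrite mulrA ler_wpM2r ?sqr_ge0 //.
have h1 : a <= 2 * npow (- (1 / 2)) n.+1.
  by have := @ln_le_npow R (1 / 2) n.+1; rewrite invf_div divr1; apply; lra.
have h2 : 1 <= npow (- (1 / 2)) n.+1 :> R.
  rewrite npowE opprK; apply: le_trans (expR_ge1Dx _); rewrite lerDl mulr_ge0 //; lra.
by move: h1 h2; lra.
Qed.

Lemma zeta_err_cvg n : zeta_err s n @[s --> 1^'+] --> zeta_err1 n.
Proof.
have -> : zeta_err1 n = (1 - (1 - 1) * ln n.+1%:R) * npow 1 n.+1 -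
    (1 * ln n.+2%:R - 1 * ln n.+1%:R).
  by rewrite /zeta_err1 subrr mul0r subr0 !mul1r npow_1.
apply: cvgB; [apply: cvgM; [apply: cvgB; [exact: cvg_cst|]|exact: npow_cvg1]|].
  apply: cvgMl; apply: cvgB; last exact: cvg_cst.
  exact/cvg_at_right_filter/cvg_id.
by apply: cvgB; apply: cvgMl; exact: npow_cvg1'.
Qed.

Lemma zeta_err1_le n : `|zeta_err1 n| <= 7 * npow (3 / 2) n.+1.
Proof.
have h' : `|zeta_err s n| @[s --> (1 : R)^'+] --> `|zeta_err1 n|.
  by apply: cvg_norm; exact: zeta_err_cvg.
rewrite -(cvg_lim _ h') //; apply: limr_le; first by apply/cvg_ex; eexists; exact: h'.
near=> s; apply: zeta_err_le; first by near: s; exact: nbhs_right_gt.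
by near: s; apply: nbhs_right_le; lra.
Unshelve. all: by end_near. Qed.

Lemma zeta_err_sum s : 1 < s -> s <= 2 ->
  tsum (zeta_err s) = tsum (npow s) * (1 - (s - 1) * tsum (fun n => vM n * npow s n)).
Proof.
move=> s1 s2; have sg0 : 0 < s - 1 by rewrite subr_gt0.
have sn0 : s != 0 by rewrite gt_eqF // (lt_trans ltr01).
have [hl El] := zeta_ln s1; have hz := summ_npow s1.
have [hz' Ez'] := tsum_shift hz; have [hl' El'] := tsum_shift hl.
rewrite npow0 // add0r in Ez'; rewrite npow0 // mulr0 add0r in El'.
pose G n : R := npow (s - 1) n.+1 * ln n.+1%:R.
have G0 : G @ \oo --> (0 : R).
  have s20 : 0 < (s - 1) / 2 by rewrite divr_gt0.
  have h : (fun n => ((s - 1) / 2)^-1 * npow ((s - 1) / 2) n.+1) @ \oo --> ((s - 1) / 2)^-1 * 0.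
    by apply: cvgMr; exact: npow_cvg0.
  rewrite mulr0 in h; apply: squeeze_cvgr (cvg_cst 0) h; near=> n.
  rewrite /G mulr_ge0 ?npow_ge0 ?ln_nat_ge0 //=.
  have := ln_le_npow n.+1 s20 => /(ler_wpM2l (npow_ge0 (s - 1) n.+1)) h1.
  apply: le_trans h1 _; rewrite mulrCA -npowD.
  by rewrite (_ : s - 1 - (s - 1) / 2 = (s - 1) / 2) //; lra.
have [hG EG] : summ (fun n => G n.+1 - G n) /\ tsum (fun n => G n.+1 - G n) = 0.
  apply: tsum_unique; have -> : (fun N => \sum_(k < N) (G k.+1 - G k)) = G.
    apply/funext => N; rewrite -(big_mkord xpredT (fun k => G k.+1 - G k)) telescope_sumr //.
    by rewrite /G ln1 mulr0 subr0.
  exact: G0.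
have -> : tsum (zeta_err s) = tsum (fun n => npow s n.+1) -
    (s - 1) * tsum (fun n => ln n.+1%:R * npow s n.+1) - tsum (fun n => G n.+1 - G n).
  rewrite -tsumZ // -tsumB //; last exact: summZ.
  rewrite -tsumB //; last by apply: summB => //; exact: summZ.
  by apply: eq_tsum => n; rewrite /zeta_err /G; ring.
by rewrite EG subr0 -El' -Ez' El; ring.
Unshelve. all: by end_near. Qed.

(** By [zeta_err_sum] the expression is the sum of [zeta_err s] divided by (s - 1) zeta(s); the
    numerator converges by [tannery] and the denominator tends to 1. *)
Lemma zeta_limit : exists c0 : R,
  ((s - 1)^-1 - tsum (fun n => vM n * npow s n)) @[s --> 1^'+] --> c0.
Proof.
exists (tsum zeta_err1 / 1).
have h1 : tsum (zeta_err s) @[s --> 1^'+] --> tsum zeta_err1.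
  have hv : summ (fun n => 7 * npow (3 / 2) n.+1 : R).
    by apply: summZ; apply: (tsum_shift (summ_npow _)).1; lra.
  apply: (tannery hv); [|exact: zeta_err1_le|exact: zeta_err_cvg].
  near=> s => n; apply: zeta_err_le; first by near: s; exact: nbhs_right_gt.
  by near: s; apply: nbhs_right_le; lra.
have h2 : (s - 1) * tsum (npow s) @[s --> 1^'+] --> (1 : R).
  have hs : s @[s --> 1^'+] --> (1 : R) by exact/cvg_at_right_filter/cvg_id.
  apply: (squeeze_cvgr _ (cvg_cst (1 : R)) hs); near=> s.
  have s1 : 1 < s by near: s; exact: nbhs_right_gt.
  have s0 : 0 < s - 1 by rewrite subr_gt0.
  have /andP[b1 b2] := zeta_bounds s1.
  rewrite -(ler_pdivrMl _ _ s0) mulr1 b1 /= -(ler_pdivlMl _ _ s0).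
  apply: le_trans b2 _; rewrite le_eqVlt; apply/orP; left; apply/eqP.
  by field; rewrite gt_eqF.
have h3 : tsum (zeta_err s) * ((s - 1) * tsum (npow s))^-1 @[s --> (1 : R)^'+] --> tsum zeta_err1 / 1.
  by apply: cvgM h1 _; apply: cvgV h2; exact: oner_neq0.
apply: cvg_trans h3; apply: near_eq_cvg; near=> s.
have s1 : 1 < s by near: s; exact: nbhs_right_gt.
have s2 : s <= 2 by near: s; apply: nbhs_right_le; lra.
have s0 : 0 < s - 1 by rewrite subr_gt0.
have /andP[b1 b2] := zeta_bounds s1.
have Z0 : 0 < tsum (npow s) by apply: lt_le_trans b1; rewrite invr_gt0.
rewrite /= zeta_err_sum //; field.
by rewrite !gt_eqF.
Unshelve. all: by end_near. Qed.

End Zeta.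

(** * A formula for the Euler-Kronecker constant *)

Section EulerKronecker.
Variable R : realType.
Implicit Types (s : R) (n q : nat).
Local Notation vM := (@vonMangoldt R).

Definition vMpp n : R := if prime n then 0 else vM n.

(** Majorant of the coefficients at powers of primes dividing q. For n = p^j the prime is recovered
    as [pdiv n], and [vM n] removes every n that is not a prime power. *)
Definition ramw q n : R :=
  if (pdiv n %| q)%N && (n == 1 %[mod mpart (pdiv n) q])%N
  then (totient (mpart (pdiv n) q))%:R * vM n else 0.

Lemma vMpp_ge0 n : 0 <= vMpp n.
Proof. by rewrite /vMpp; case: ifP; rewrite ?vM_ge0. Qed.

Lemma ramw_ge0 q n : 0 <= ramw q n.
Proof. by rewrite /ramw; case: ifP; rewrite // mulr_ge0 ?vM_ge0. Qed.

Lemma npow1E n : npow 1 n = n%:R^-1 :> R.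
Proof. by case: n => [|n]; [rewrite npow0 ?oner_neq0 // invr0|exact: npow_1]. Qed.

Lemma cyclotomic_coef q (c : nat -> R) : (1 < q)%N ->
  (forall n, (forall p j, prime p -> (0 < j)%N -> n <> (p ^ j)%N) -> c n = 0) ->
  (forall p j, prime p -> (0 < j)%N ->
        if (p %| q)%N
        then is_true (0 <= c (p ^ j)%N <=
          (if (p ^ j == 1 %[mod mpart p q])%N then (totient (mpart p q))%:R * ln p%:R else 0))
        else c (p ^ j)%N = if (p ^ j == 1 %[mod q])%N then (totient q)%:R * ln p%:R else 0) ->
  let main n := if prime n && (n == 1 %[mod q])%N then (totient q)%:R * vM n else 0 in
  forall n, 0 <= c n - main n <=
    (if (n == 1 %[mod q])%N then (totient q)%:R * vMpp n else 0) + ramw q n.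
Proof.
move=> q1 Hc0 Hc main n.
have [[p [j [pr_p j0 En]]]|nex] := pselect (exists p j, [/\ prime p, (0 < j)%N & n = (p ^ j)%N]); last first.
  have npow p j : prime p -> (0 < j)%N -> n <> (p ^ j)%N.
    by move=> pr_p j0 E; apply: nex; exists p, j.
  rewrite (Hc0 n npow) /main /ramw /vMpp (vM_not_pow R npow) !mulr0 !if_same subrr mulr0 if_same addr0.
  by rewrite lexx.
have vE : vM n = ln p%:R by rewrite En vM_pow.
have pd : pdiv n = p by rewrite En -(prednK j0) pdiv_pfactor.
have l0 : 0 <= ln p%:R :> R by exact: ln_nat_ge0.
have tl0 m : 0 <= (totient m)%:R * ln p%:R :> R by rewrite mulr_ge0.
have := Hc p j pr_p j0; rewrite -En.
case: ifPn => [pq /andP[h1 h2]|npq ->].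
  have -> : main n = 0.
    rewrite /main; case: ifP => // /andP[pr_n /eqP E].
    have pn : n = p.
      by apply/eqP; rewrite eq_sym -dvdn_prime2 // En dvdn_exp.
    move: E; rewrite pn (modn_small q1) => E.
    have : (p %| 1)%N by rewrite -E /dvdn modn_dvdm // modnn.
    by rewrite dvdn1 => /eqP p1; rewrite p1 in pr_p.
  rewrite subr0 h1 /= /ramw pd pq /= vE; apply: le_trans h2 _; rewrite lerDr.
  by case: ifP => // _; rewrite mulr_ge0 ?vMpp_ge0.
have r0 := ramw_ge0 q n.
rewrite /main /vMpp vE; case: (n == 1 %[mod q])%N; rewrite ?andbF ?andbT ?subrr ?lexx ?add0r //=.
by case: ifP => _; rewrite ?subrr ?subr0 ?mulr0 ?add0r ?lexx ?tl0 //= lerDl.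
Qed.

(** By [EHqE] these are the partial sums of the main coefficients minus the von Mangoldt function,
    which is what summation by parts needs. *)
Definition EHq q N : R := (totient q)%:R * EH_error N%:R q 1.

Lemma EHqE q N : (0 < q)%N -> EHq q N =
  \sum_(n < N.+1) ((if prime n && (n == 1 %[mod q])%N then (totient q)%:R * vM n else 0) - vM n).
Proof.
move=> q0; have t0 : (totient q)%:R != 0 :> R by rewrite pnatr_eq0 -lt0n totient_gt0.
rewrite /EHq /EH_error /chebyshev_psi natrK mulrBr mulrCA divff // mulr1 sumrB; congr (_ - _).
rewrite mulr_sumr big_mkcond; apply: eq_bigr => n _ /=.
by case: ifP.
Qed.

Lemma EHq_le q N : (0 < q)%N -> `|EHq q N| <= ((totient q)%:R + 1) * (4 * N%:R).
Proof.
move=> q0; apply: (@le_trans _ _ (((totient q)%:R + 1) * psi R N)).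
  rewrite EHqE // /psi mulr_sumr; apply: le_trans (ler_norm_sum _ _ _) _; apply: ler_sum => n _.
  apply: le_trans (ler_normB _ _) _; rewrite mulrDl mul1r (ger0_norm (vM_ge0 R n)) lerD2r.
  by case: ifP; rewrite ?normr0 ?ger0_norm ?mulr_ge0 ?vM_ge0.
by rewrite ler_wpM2l ?psi_le // addr_ge0.
Qed.

(** What remains of the EH saving N / ln(N)^2 after division by N^2. Its sum is dominated by the
    telescoping differences of 1 / ln n, which is why EH is used with A = 2. *)
Definition ilog n : R := (n%:R * ln n%:R ^+ 2)^-1.

Lemma ilog_ge0 n : 0 <= ilog n.
Proof. by rewrite invr_ge0 mulr_ge0 ?sqr_ge0. Qed.

Lemma ln_gt0_nat n : (1 < n)%N -> 0 < ln n%:R :> R.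
Proof. by move=> n1; apply: ln_gt0; rewrite ltr1n. Qed.

Lemma ilog_tele n : (1 < n)%N -> ilog n.+1 <= (ln n%:R)^-1 - (ln n.+1%:R)^-1.
Proof.
move=> n1; have a0 := ln_gt0_nat n1; have b0 := ln_gt0_nat (ltnW n1 : (1 < n.+1)%N).
have N0 : 0 < n.+1%:R :> R by rewrite ltr0n.
case: n n1 a0 b0 N0 => // n n1; have := ln_succ_ge R n; rewrite /ilog.
move: (ln n.+1%:R : R) (ln n.+2%:R : R) => a b; move: (n.+2%:R : R) => N h a0 b0 N0.
have -> : a^-1 - b^-1 = (b - a) / (a * b).
  by field; rewrite !gt_eqF.
rewrite invfM; apply: ler_pM; rewrite ?invr_ge0 ?sqr_ge0 //; first exact: ltW.
rewrite lef_pV2 ?posrE ?mulr_gt0 ?exprn_gt0 // expr2 ler_pM2r //.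
by rewrite -subr_ge0; apply: le_trans h; rewrite invr_ge0 ltW.
Qed.

Lemma psum_ilog M K : (1 < M)%N -> \sum_(n < K) tail ilog M.+1 n <= (ln M%:R)^-1.
Proof.
move=> M1; have i0 n : (1 < n)%N -> 0 <= (ln n%:R)^-1 :> R.
  by move=> n1; rewrite invr_ge0 ltW // ln_gt0_nat.
have [KM|MK] := leqP K M.+1.
  rewrite big1 ?i0 // => n _; rewrite /tail ifT //; exact: leq_trans (ltn_ord n) KM.
suff H k : \sum_(n < (M.+1 + k)%N) tail ilog M.+1 n <= (ln M%:R)^-1 - (ln (M + k)%N%:R)^-1.
  rewrite -(subnKC (ltnW MK)); apply: le_trans (H _) _; rewrite gerBl i0 //.
  by apply: leq_trans M1 _; rewrite leq_addr.
elim: k => [|k IH].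
  rewrite !addn0 subrr big1 // => n _; by rewrite /tail ltn_ord.
rewrite addnS big_ord_recr /= {2}/tail ltnNge leq_addr /=.
apply: le_trans (lerD IH (ilog_tele (leq_trans M1 (leq_addr k M)))) _.
by rewrite addrA subrK addnS.
Qed.

Lemma summ_ilog M : (1 < M)%N -> summ (tail ilog M.+1).
Proof.
move=> M1; apply: (summ_bounded (B := (ln M%:R)^-1) _ _).1 => [n|K]; last exact: psum_ilog.
by rewrite /tail; case: ifP; rewrite ?ilog_ge0.
Qed.

Section Formula.
Variables (q : nat) (c0 : R).
Hypothesis q1 : (1 < q)%N.
Hypothesis hc0 : ((s - 1)^-1 - tsum (fun n => vM n * npow s n)) @[s --> (1 : R)^'+] --> c0.

Let q0 : (0 < q)%N. Proof. exact: ltnW. Qed.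

Let w n := EHq q n * (npow 1 n - npow 1 n.+1).

Let EHq0 : EHq q 0 = 0.
Proof. by rewrite EHqE // big_ord1 /= vM0 subrr. Qed.

Lemma EHq_dom s n : 1 <= s -> s <= 2 ->
  `|EHq q n * (npow s n - npow s n.+1)| <= 2 * (`|EHq q n| * npow 2 n).
Proof.
move=> s1 s2; have s0 : 0 < s by apply: lt_le_trans s1.
case: n => [|n]; first by rewrite EHq0 !mul0r normr0 mul0r mulr0.
rewrite normrM mulrCA ler_wpM2l // ger0_norm.
  apply: le_trans (npow_diff_le _ s0) _; apply: ler_pM; rewrite ?npow_ge0 //; first exact: ltW.
  by apply: npow_le; lra.
by apply: le_trans (npow_diff_ge n s0); rewrite mulr_ge0 ?npow_ge0 // ltW.
Qed.

Lemma EHq_summ (C : R) N0 : (forall N, (N0 <= N)%N -> `|EH_error N%:R q 1| <= C * (N%:R / ln N%:R ^+ 2)) ->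
  summ (fun n => 2 * (`|EHq q n| * npow 2 n)).
Proof.
move=> H; apply: summZ; set M := maxn N0 2.
have -> : (fun n => `|EHq q n| * npow 2 n) =
    (fun n => (if (n < M.+1)%N then `|EHq q n| * npow 2 n else 0) + tail (fun n => `|EHq q n| * npow 2 n) M.+1 n).
  by apply/funext => n; rewrite /tail; case: ifP; rewrite ?addr0 ?add0r.
apply: summD.
  apply: (summ_finite (N := M.+1) _).1 => n Mn; by rewrite ltnNge Mn.
have M1 : (1 < M)%N by rewrite /M leq_max orbT.
apply: summ_le (summZ (k := (totient q)%:R * C) (summ_ilog M1)) => n; rewrite /tail.
case: ltnP => Mn; first by rewrite normr0 mulr0.
have nN0 : (N0 <= n)%N by apply: leq_trans (ltnW Mn); rewrite /M leq_max leqnn.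
rewrite ger0_norm; last by rewrite mulr_ge0 ?npow_ge0.
rewrite /EHq normrM (ger0_norm (ler0n _ _)) -!mulrA ler_wpM2l //.
have n0 : 0 < n%:R :> R by rewrite ltr0n; apply: leq_ltn_trans Mn.
apply: le_trans (ler_wpM2r (npow_ge0 _ _) (H n nN0)) _.
have -> : npow 2 n = n%:R^-1 ^+ 2 :> R.
  case: n n0 {Mn nN0} => [|n]; first by rewrite ltxx.
  by move=> _; rewrite -npow_1 expr2 -npowD; congr npow; lra.
rewrite /ilog le_eqVlt; apply/orP; left; apply/eqP.
have l0 : 0 < ln n%:R :> R by apply: ln_gt0_nat; apply: leq_trans (ltnW Mn).
by field; rewrite !gt_eqF.
Qed.

(** The coefficients split as [main + r]. Summation by parts turns the series of [main - vM] into
    one dominated uniformly for s in [1, 2], so the limit is taken termwise. [r] stays abstract, as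
    only its sign and its majorant are known. *)
Lemma EK_formula (C : R) N0 :
  (forall N, (N0 <= N)%N -> `|EH_error N%:R q 1| <= C * (N%:R / ln N%:R ^+ 2)) ->
  summ (fun n => (if (n == 1 %[mod q])%N then (totient q)%:R * vMpp n else 0) * npow 1 n) ->
  summ (fun n => ramw q n * npow 1 n) ->
  exists r : nat -> R, [/\ forall n, 0 <= r n,
    forall n, r n <= (if (n == 1 %[mod q])%N then (totient q)%:R * vMpp n else 0) + ramw q n,
    summ w & EK_const q = c0 - tsum w - tsum (fun n => r n * npow 1 n)].
Proof.
move=> HE sp sr.
have [a [c [[a0 a1] Ez conv Hc0 Hc]]] := cyclotomic_dirichlet R q0.
pose main n : R := if prime n && (n == 1 %[mod q])%N then (totient q)%:R * vM n else 0.
have Hr := cyclotomic_coef q1 Hc0 Hc; pose r n := c n - main n.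
have r0 n : 0 <= r n by have /andP[] := Hr n.
have r1 n : r n <= (if (n == 1 %[mod q])%N then (totient q)%:R * vMpp n else 0) + ramw q n.
  by have /andP[] := Hr n.
have main0 n : 0 <= main n by rewrite /main; case: ifP; rewrite // mulr_ge0 ?vM_ge0.
have mainle n : main n <= (totient q)%:R * vM n.
  by rewrite /main; case: ifP => // _; rewrite mulr_ge0 ?vM_ge0.
have sr1 : summ (fun n => r n * npow 1 n).
  apply: summ_le (summD sp sr) => n; rewrite ger0_norm ?mulr_ge0 ?npow_ge0 // -mulrDl.
  by rewrite ler_wpM2r ?npow_ge0.
have c0' n : 0 <= c n by have := r0 n; have := main0 n; rewrite /r; lra.
have c00 : c 0%N = 0.
  by apply: Hc0 => p j pr_p j0 /esym/eqP; rewrite expn_eq0 => /andP[/eqP p0]; rewrite p0 in pr_p.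
have main00 : main 0%N = 0 by [].
have r00 : r 0%N = 0 by rewrite /r c00 main00 subrr.
have rs s n : 1 <= s -> `|r n * npow s n| <= r n * npow 1 n.
  move=> s1; case: n => [|n]; first by rewrite r00 !mul0r normr0.
  by rewrite ger0_norm ?mulr_ge0 ?npow_ge0 // ler_wpM2l // npow_le.
have smain s : 1 < s -> summ (fun n => main n * npow s n).
  move=> s1; apply: summ_le (summZ (k := (totient q)%:R) (summ_vM s1)) => n.
  by rewrite ger0_norm ?mulr_ge0 ?npow_ge0 // mulrA ler_wpM2r ?npow_ge0.
have sr_s s : 1 < s -> summ (fun n => r n * npow s n).
  by move=> /ltW s1; apply: summ_le sr1 => n; exact: rs.
have cs s : 1 < s -> summ (fun n => c n * npow s n).
  move=> s1; apply: eq_summ (summD (smain s s1) (sr_s s s1)) => n.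
  by rewrite -mulrDl /r addrC subrK.
have sw := EHq_summ HE.
have sB s : 1 < s -> s <= 2 ->
    tsum (fun n => main n * npow s n) - tsum (fun n => vM n * npow s n) =
    tsum (fun n => EHq q n * (npow s n - npow s n.+1)).
  move=> s1 s2; have s1' := ltW s1; rewrite -tsumB; [|exact: smain|exact: summ_vM].
  have BE N : \sum_(n < N.+1) (main n - vM n) = EHq q N by rewrite EHqE.
  have [] := @abel_tsum R (fun n => main n - vM n) (npow s).
  (* The boundary term of the summation by parts vanishes for s > 1 by the Chebyshev bound [EHq_le]
     alone. *)
  - have sg0 : 0 < s - 1 by rewrite subr_gt0.
    have h : (fun K => ((totient q)%:R + 1) * 4 * npow (s - 1) K.+1) @ \oo --> ((totient q)%:R + 1) * 4 * (0 : R).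
      by apply: cvgMr; exact: npow_cvg0.
    rewrite mulr0 in h; rewrite -cvg_shiftS; apply: norm_cvg0.
    apply: (squeeze_cvgr _ (cvg_cst (0 : R)) h); near=> K.
    rewrite normr_ge0 /= normrM BE (ger0_norm (npow_ge0 _ _)).
    apply: le_trans (ler_wpM2r (npow_ge0 _ _) (EHq_le K.+1 q0)) _.
    have -> : npow s K.+1 = npow (s - 1) K.+1 * K.+1%:R^-1 by rewrite -npow_1 -npowD subrK.
    have K0 : K.+1%:R != 0 :> R by rewrite pnatr_eq0.
    by rewrite le_eqVlt; apply/orP; left; apply/eqP; field.
  - by apply: summ_le sw => n; rewrite BE; exact: EHq_dom.
  move=> _; under eq_tsum do rewrite mulrBl; move=> ->.
  by apply: eq_tsum => n; rewrite BE.
have sw1 : summ w by apply: summ_le sw => n; apply: EHq_dom; lra.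
exists r; split=> //; apply/cvg_lim => //.
have hw : tsum (fun n => EHq q n * (npow s n - npow s n.+1)) @[s --> (1 : R)^'+] --> tsum w.
  apply: (tannery sw).
  - near=> s => n; apply: EHq_dom; last by near: s; apply: nbhs_right_le; lra.
    by near: s; exact: nbhs_right_ge.
  - by move=> n; apply: EHq_dom; lra.
  - case=> [|n]; first by rewrite /w; under eq_fun do rewrite EHq0 mul0r; rewrite EHq0 mul0r; exact: cvg_cst.
    by apply: cvgMr; apply: cvgB; exact: npow_cvg1.
have hr : tsum (fun n => r n * npow s n) @[s --> (1 : R)^'+] --> tsum (fun n => r n * npow 1 n).
  apply: (tannery sr1).
  - by near=> s => n; apply: rs; near: s; exact: nbhs_right_ge.
  - by move=> n; apply: rs.
  - case=> [|n]; first by under eq_fun do rewrite r00 mul0r; rewrite r00 mul0r; exact: cvg_cst.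
    by apply: cvgMr; exact: npow_cvg1.
have h : (s - 1)^-1 - tsum (fun n => vM n * npow s n) -
    tsum (fun n => EHq q n * (npow s n - npow s n.+1)) - tsum (fun n => r n * npow s n)
    @[s --> (1 : R)^'+] --> c0 - tsum w - tsum (fun n => r n * npow 1 n).
  by apply: cvgB hr; apply: cvgB hw.
apply: cvg_trans h; apply: near_eq_cvg; near=> s.
have s1 : 1 < s by near: s; exact: nbhs_right_gt.
have s2 : s <= 2 by near: s; apply: nbhs_right_le; lra.
rewrite (dirichlet_logderiv a0 c0' c00 conv cs s1 a1 Ez) /= -(sB s s1 s2).
have -> : tsum (fun n => c n * npow s n) = tsum (fun n => main n * npow s n) + tsum (fun n => r n * npow s n).
  rewrite -tsumD; [|exact: smain|exact: sr_s].
  by apply: eq_tsum => n; rewrite -mulrDl /r addrC subrK.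
by ring.
Unshelve. all: by end_near. Qed.

End Formula.
End EulerKronecker.

(** * Average over proper prime powers *)

Section ProperPowers.
Variable R : realType.
Local Notation vM := (@vonMangoldt R).
Local Notation vMpp := (@vMpp R).

Lemma sum_eq_le1 N a : \sum_(n < N) ((n : nat) == a)%:R <= 1 :> R.
Proof.
have [aN|Na] := ltnP a N.
  rewrite (bigD1 (Ordinal aN)) //= eqxx big1 ?addr0 // => i ni.
  by case: eqP => // E; case/eqP: ni; apply: val_inj.
rewrite big1 // => i _; case: eqP => // E; exfalso.
by have := ltn_ord i; rewrite E ltnNge Na.
Qed.

(** Send n = p^k, k >= 2, to d = p^(k/2) with the exponent rounded down. Then n is d^2 or d^2 p, so
    each d is hit at most twice, with the same von Mangoldt value and d^2 <= n. *)
Lemma sum_vMpp_le (F : nat -> R) N : (forall n, 0 <= F n) ->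
  (forall m n, (0 < m)%N -> (m <= n)%N -> F n <= F m) ->
  \sum_(n < N) vMpp n * F n <= 2 * \sum_(d < N) vM d * F (d ^ 2)%N.
Proof.
move=> F0 Fmono.
pose G (d n : nat) : R := (n == (d ^ 2)%N)%:R + (n == (d ^ 2 * pdiv d)%N)%:R.
have G0 d n : 0 <= G d n by rewrite addr_ge0.
apply: (@le_trans _ _ (\sum_(n < N) \sum_(d < N) vM d * F (d ^ 2)%N * G d n)); last first.
  rewrite exchange_big mulr_sumr; apply: ler_sum => d _.
  rewrite -mulr_sumr mulrC; apply: ler_wpM2r; first by rewrite mulr_ge0 ?vM_ge0.
  by rewrite /G big_split /=; apply: lerD; exact: sum_eq_le1.
apply: ler_sum => n _.
have RHS0 d : 0 <= vM d * F (d ^ 2)%N * G d n by rewrite !mulr_ge0 ?vM_ge0.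
have [E|] := eqVneq (vMpp n) 0; first by rewrite E mul0r; apply: sumr_ge0 => d _.
rewrite /vMpp; case: ifPn => [_|npr]; first by rewrite eqxx.
move=> nz; have [p [k [pr_p k0 En]]] := vM_neq0 nz.
have k1 : (1 < k)%N.
  by rewrite ltn_neqAle k0 andbT; apply: contra npr => /eqP k1; rewrite En -k1 expn1.
have h0 : (0 < k./2)%N by case: k k1 {k0 En} => [|[]].
pose d := (p ^ k./2)%N.
have d0 : (0 < d)%N by rewrite expn_gt0 prime_gt0.
have En2 : n = (d ^ 2 * p ^ odd k)%N :> nat.
  by rewrite En /d -expnM -expnD muln2 addnC odd_double_half.
have dn : (d ^ 2 <= n)%N by rewrite En2 leq_pmulr // expn_gt0 prime_gt0.
have dN : (d < N)%N.
  by apply: leq_ltn_trans (ltn_ord n); apply: leq_trans dn; rewrite -{1}[d]expn1 leq_pexp2l.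
rewrite (bigD1 (Ordinal dN)) //= -[leLHS]addr0; apply: lerD; last by apply: sumr_ge0.
have -> : vM d = vM n by rewrite En !vM_pow.
rewrite -[leLHS]mulr1; apply: ler_pM; rewrite ?mulr_ge0 ?vM_ge0 //.
  by apply: ler_wpM2l; rewrite ?vM_ge0 //; apply: Fmono => //; rewrite expn_gt0 d0.
rewrite /G; have pd : pdiv d = p by rewrite /d -(prednK h0) pdiv_pfactor.
rewrite pd En2; case: (odd k); rewrite ?expn1 ?expn0 ?muln1 eqxx ?lerDl ?lerDr //.
Qed.

(** Summation by parts against psi(N) <= 4 N: the telescoping part contributes 8 / Q and the
    boundary term 4 / Q. *)
Lemma sum_vM_sq Q K : (0 < Q)%N ->
  \sum_(d < K) tail (fun d => vM d / (d ^ 2)%:R) Q.+1 d <= 12 / Q%:R.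
Proof.
move=> Q0; have QR : 0 < Q%:R :> R by rewrite ltr0n.
set u := tail _ _.
have u0 n : 0 <= u n by rewrite /u /tail; case: ifP; rewrite // mulr_ge0 ?vM_ge0.
have base : \sum_(d < Q.+1) u d = 0 by rewrite big1 // => d _; rewrite /u /tail ltn_ord.
suff H k : \sum_(d < (Q + k).+1) u d - psi R (Q + k) / ((Q + k).+1 ^ 2)%:R <=
    8 * (Q.+1%:R^-1 - (Q + k).+1%:R^-1).
  have H2 k : \sum_(d < (Q + k).+1) u d <= 12 / Q%:R.
    have h1 := H k; set K' := (Q + k)%N in h1 *.
    have h2 : psi R K' / (K'.+1 ^ 2)%:R <= 4 / Q%:R.
      have K'0 : 0 < K'.+1%:R :> R by rewrite ltr0n.
      apply: (@le_trans _ _ (4 * K'.+1%:R / (K'.+1 ^ 2)%:R)).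
        rewrite ler_wpM2r ?invr_ge0 //; apply: le_trans (psi_le _ _) _.
        by rewrite ler_wpM2l // ler_nat.
      rewrite natrX expr2 invfM mulrA mulfK ?gt_eqF // ler_wpM2l // lef_pV2 ?posrE //.
      by rewrite ler_nat /K'; lia.
    have h3 : Q.+1%:R^-1 <= Q%:R^-1 :> R by rewrite lef_pV2 ?posrE ?ltr0n // ler_nat.
    have h4 : 0 <= K'.+1%:R^-1 :> R by rewrite invr_ge0.
    by move: h1 h2 h3 h4; move: (psi _ _ / _) (Q.+1%:R^-1) (K'.+1%:R^-1) (Q%:R^-1) => a b c d; lra.
  have [KQ|/ltnW QK] := leqP K Q.+1.
    apply: le_trans (H2 0%N); rewrite addn0 -!(big_mkord xpredT u) (big_cat_nat _ KQ) //= lerDl.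
    exact: sumr_ge0.
  by case: K QK => // K; rewrite ltnS => QK; rewrite -(subnKC QK).
elim: k => [|k IH].
  rewrite addn0 base sub0r subrr mulr0 oppr_le0 mulr_ge0 ?psi_ge0 ?invr_ge0 //.
rewrite addnS; set K' := (Q + k)%N in IH *; rewrite big_ord_recr /= psiS.
have -> : u K'.+1 = vM K'.+1 / (K'.+1 ^ 2)%:R by rewrite /u /tail ifF // ltnNge ltnS leq_addr.
have ps := psi_le R K'.+1; rewrite psiS in ps.
have K0 : 0 < K'.+1%:R :> R by rewrite ltr0n.
have h : (psi R K' + vM K'.+1) * ((K'.+1 ^ 2)%:R^-1 - (K'.+2 ^ 2)%:R^-1) <=
    8 * (K'.+1%:R^-1 - K'.+2%:R^-1).
  have E2 : K'.+2%:R = K'.+1%:R + 1 :> R by rewrite natr1.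
  rewrite !natrX E2; move: (K'.+1%:R : R) K0 ps => x x0 ps.
  have d0 : 0 <= (x ^+ 2)^-1 - ((x + 1) ^+ 2)^-1.
    rewrite subr_ge0 lef_pV2 ?posrE ?exprn_gt0 ?addr_gt0 // ler_sqr ?nnegrE; lra.
  apply: le_trans (ler_wpM2r d0 ps) _.
  have -> : 4 * x * ((x ^+ 2)^-1 - ((x + 1) ^+ 2)^-1) = (8 * x + 4) / (x * (x + 1) ^+ 2).
    by field; rewrite !gt_eqF //; lra.
  have -> : 8 * (x^-1 - (x + 1)^-1) = (8 * x + 8) / (x * (x + 1) ^+ 2).
    by field; rewrite !gt_eqF //; lra.
  by rewrite ler_wpM2r ?invr_ge0 ?mulr_ge0 ?sqr_ge0 ?ltW //; lra.
move: IH h; move: (\sum_(d < K'.+1) u d) (psi R K') (vM K'.+1) ((K'.+1 ^ 2)%:R^-1) ((K'.+2 ^ 2)%:R^-1) (K'.+1%:R^-1) (K'.+2%:R^-1) (Q.+1%:R^-1) => S p v a b x y w.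
lra.
Qed.

(* The range extends to [2 Q + 1] because [truncn (2 * x)] may be [2 * truncn x + 1]. *)
Definition qrange Q := index_iota Q.+1 (2 * Q).+2.

Lemma mem_qrange Q q : q \in qrange Q -> (Q < q)%N /\ (q <= (2 * Q).+1)%N.
Proof. by rewrite mem_index_iota => /andP[]. Qed.

Lemma qrange_uniq Q : uniq (qrange Q). Proof. exact: iota_uniq. Qed.

Lemma size_qrange Q : size (qrange Q) = Q.+1.
Proof. by rewrite size_iota; lia. Qed.

(** A divisor q > Q of m is determined by its cofactor, which is at most m / Q. *)
Lemma dvd_count Q m : (0 < Q)%N -> (0 < m)%N ->
  (\sum_(q <- qrange Q) (q %| m) * Q <= m)%N /\ (\sum_(q <- qrange Q) (q %| m) <= Q.+1)%N.
Proof.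
move=> Q0 m0; split; last first.
  rewrite -(size_qrange Q) -sum1_size; apply: leq_sum => q _; exact: leq_b1.
apply: (@leq_trans (\sum_(q <- qrange Q) \sum_(j < m %/ Q) (q * j.+1 == m) * Q)%N).
  rewrite big_seq [leqRHS]big_seq; apply: leq_sum => q /mem_qrange [Qq _].
  case: (boolP (q %| m)%N) => // /dvdnP[[|j] E]; first by rewrite E in m0.
  have lj : (j < m %/ Q)%N by rewrite leq_divRL // E leq_mul2l ltnW ?orbT.
  have Ej : (q * j.+1 == m) = true by rewrite E mulnC eqxx.
  by rewrite (bigD1 (Ordinal lj)) //= Ej mul1n leq_addr.
rewrite exchange_big /=; apply: (@leq_trans (\sum_(j < m %/ Q) Q)%N); last first.
  by rewrite sum_nat_const card_ord leq_divM.
apply: leq_sum => j _; rewrite -big_distrl /= -[leqRHS]mul1n leq_mul2r; apply/orP; right.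
apply: (@leq_trans (count_mem (m %/ j.+1)%N (qrange Q))); last first.
  by rewrite count_uniq_mem ?qrange_uniq // leq_b1.
rewrite -sum1_count [leqRHS]big_mkcond /=; apply: leq_sum => q _.
case: eqP => // E; have -> : (m %/ j.+1)%N = q by move: (nat_of_ord j) E => i <-; rewrite mulnK.
by rewrite eqxx.
Qed.

Lemma totient_le n : (totient n <= n)%N.
Proof.
rewrite totient_count_coprime; apply: (@leq_trans (\sum_(0 <= i < n) 1)%N).
  by apply: leq_sum => i _; exact: leq_b1.
by rewrite sum_nat_const_nat subn0 muln1.
Qed.

Lemma sum_powers Q N : (0 < Q)%N ->
  \sum_(q <- qrange Q) \sum_(n < N)
    (if (n == 1 %[mod q])%N then (totient q)%:R * vMpp n else 0) * npow 1 n <= 168 * Q%:R.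
Proof.
move=> Q0; have QR : 0 < Q%:R :> R by rewrite ltr0n.
(* Bound for the sum over q of totient(q) / n with q dividing n - 1: each totient is at most 3 Q,
   and the number of q is at most n / Q, giving 3, and at most 2 Q, giving 6 Q^2 / n. *)
pose F n : R := Num.min 3 (6 * Q%:R ^+ 2 / n%:R).
have F0 n : 0 <= F n by rewrite /F le_min ler0n /= !mulr_ge0 ?invr_ge0 ?sqr_ge0.
rewrite exchange_big /=; apply: (@le_trans _ _ (\sum_(n < N) vMpp n * F n)).
  apply: ler_sum => n _.
  have [E|nz] := eqVneq (vMpp n) 0.
    by rewrite E mul0r big1 // => q _; rewrite mulr0 if_same mul0r.
  have n1 : (1 < n)%N.
    case: (nat_of_ord n) nz => [|[|k]] //; rewrite /vMpp /=; first by rewrite vM0 eqxx.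
    by have -> : vM 1%N = 0 by []; rewrite eqxx.
  have n0 : 0 < n%:R :> R by rewrite ltr0n ltnW.
  have v0 := vMpp_ge0 R n.
  have m0 : (0 < n.-1)%N by case: (nat_of_ord n) n1 => [|[]].
  have [c1 c2] := dvd_count Q0 m0; rewrite -big_distrl /= in c1.
  set cnt := (\sum_(q <- qrange Q) (q %| n.-1))%N in c1 c2.
  apply: (@le_trans _ _ (vMpp n * (3 * Q%:R * cnt%:R / n%:R))).
    rewrite npow1E -mulr_suml mulrA; apply: ler_wpM2r; first by rewrite invr_ge0 ltW.
    have -> : vMpp n * (3 * Q%:R * cnt%:R) =
        \sum_(q <- qrange Q) 3 * Q%:R * (q %| n.-1)%:R * vMpp n.
      by rewrite -mulr_suml -mulr_sumr /cnt natr_sum mulrC.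
    rewrite big_seq [leRHS]big_seq; apply: ler_sum => q /mem_qrange [Qq qQ].
    rewrite eqn_mod_dvd ?(ltnW n1) // subn1; case: (q %| n.-1)%N; rewrite ?mulr0 ?mul0r // mulr1.
    apply: ler_wpM2r => //; rewrite -natrM ler_nat.
    by apply: leq_trans (totient_le _) _; lia.
  apply: ler_wpM2l => //; rewrite /F le_min ler_pdivrMr // -!natrM -natrX -natrM ler_pM2r ?invr_gt0 // !ler_nat.
  apply/andP; split; nia.
apply: le_trans (sum_vMpp_le N F0 _) _.
  move=> m n m0 mn; rewrite /F le_min ge_min lexx /= ge_min; apply/orP; right.
  by rewrite ler_wpM2l ?mulr_ge0 ?sqr_ge0 // lef_pV2 ?posrE ?ltr0n ?ler_nat // (leq_trans m0).
(* The d <= Q are charged 3 each and summed by [psi_le]; the d > Q are charged 6 Q^2 / d^2 and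
   summed by [sum_vM_sq]. *)
have -> : 168 * Q%:R = 2 * (3 * (4 * Q%:R) + 6 * Q%:R ^+ 2 * (12 / Q%:R)) :> R.
  by field; rewrite gt_eqF.
rewrite ler_wpM2l //.
apply: (@le_trans _ _ (\sum_(d < N) ((if (d < Q.+1)%N then 3 * vM d else 0) +
    6 * Q%:R ^+ 2 * tail (fun d => vM d / (d ^ 2)%:R) Q.+1 d))).
  apply: ler_sum => d _; rewrite /tail; case: ifP => _.
    by rewrite mulr0 addr0 mulrC ler_wpM2r ?vM_ge0 // /F ge_min lexx.
  by rewrite add0r mulrCA ler_wpM2l ?vM_ge0 // /F ge_min lexx orbT.
rewrite big_split /= -mulr_sumr; apply: lerD; last first.
  by rewrite ler_wpM2l ?mulr_ge0 ?sqr_ge0 // sum_vM_sq.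
apply: (@le_trans _ _ (3 * psi R Q)); last by rewrite ler_wpM2l // psi_le.
rewrite /psi mulr_sumr -!(big_mkord xpredT (fun d => 3 * vM d)).
rewrite -(big_mkord xpredT (fun d => if (d < Q.+1)%N then 3 * vM d else 0)).
have v3 d : 0 <= 3 * vM d by rewrite mulr_ge0 ?vM_ge0.
have [NQ|/ltnW QN] := leqP N Q.+1.
  rewrite [leRHS](big_cat_nat _ NQ) //= -[leLHS]addr0; apply: lerD; last exact: sumr_ge0.
  by apply: ler_sum => d _; case: ifP.
rewrite (big_cat_nat _ QN) //= [X in _ + X]big_nat [X in _ + X]big1 ?addr0.
  by apply: ler_sum => d _; case: ifP.
by move=> d /andP[Qd _]; rewrite ltnNge Qd.
Qed.

End ProperPowers.

(** * Average over ramified primes *)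

Section Ramified.
Variable R : realType.
Local Notation vM := (@vonMangoldt R).
Local Notation ramw := (@ramw R).

Lemma ler_sum_sub (T : eqType) (s t : seq T) (F : T -> R) : uniq s -> uniq t ->
  {subset s <= t} -> (forall x, 0 <= F x) -> \sum_(x <- s) F x <= \sum_(x <- t) F x.
Proof.
move=> us ut st F0.
have ps : perm_eq s [seq x <- t | x \in s].
  apply: uniq_perm => //; first exact: filter_uniq.
  by move=> x; rewrite mem_filter /=; case: (boolP (x \in s)) => // /st ->.
rewrite (perm_big _ ps) big_filter big_mkcond /=; apply: ler_sum => x _.
by case: ifP.
Qed.

Lemma psum_geometric (x : R) f N : 0 <= x -> 2 * x <= 1 -> (0 < f)%N ->
  \sum_(j < N) (if (f <= j.+1)%N then x ^+ j.+1 else 0) <= 2 * x ^+ f.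
Proof.
move=> x0 x1 f0.
suff : \sum_(j < N) (if (f <= j.+1)%N then x ^+ j.+1 else 0) <=
    (if (N < f)%N then 0 else 2 * x ^+ f - x ^+ N).
  move=> h; apply: le_trans h _; case: ifP => _; first by rewrite mulr_ge0 ?exprn_ge0.
  by rewrite gerBl exprn_ge0.
elim: N => [|N IH]; first by rewrite big_ord0 f0.
rewrite big_ord_recr /=; have [Nf|fN] := ltnP N.+1 f.
  by rewrite addr0; apply: le_trans IH _; rewrite (ltnW Nf).
have xN : 0 <= x ^+ N by rewrite exprn_ge0.
move: IH; rewrite ltnNge; case: (leqP f N) => [fN' /= IH|Nf /= IH].
  rewrite exprS; nra.
have Ef : f = N.+1 by apply/eqP; rewrite eqn_leq fN Nf.
by rewrite {2}Ef; lra.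
Qed.

Definition ramidx q p : nat := ((p ^ res_deg q p).-1 %/ mpart p q)%N.

Lemma ramidxP q p : (0 < q)%N -> prime p ->
  [/\ (0 < res_deg q p)%N, (0 < ramidx q p)%N, (p ^ res_deg q p = 1 + mpart p q * ramidx q p)%N &
   forall k, (0 < k)%N -> (p ^ k = 1 %[mod mpart p q])%N -> (res_deg q p <= k)%N].
Proof.
move=> q0 pr_p; have [z pz] := C_prim_root_exists q0.
have [f0 E fmin] := res_degP pz pr_p.
have pf : (1 < p ^ res_deg q p)%N by rewrite -[1%N](expn0 p) ltn_exp2l ?prime_gt1.
have dv : (mpart p q %| (p ^ res_deg q p).-1)%N.
  by rewrite -subn1 -eqn_mod_dvd ?(ltnW pf) //; apply/eqP.
have E2 : (p ^ res_deg q p = 1 + mpart p q * ramidx q p)%N.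
  by rewrite /ramidx mulnC divnK // add1n prednK // ltnW.
split=> //; rewrite lt0n; apply/eqP => i0.
by move: pf; rewrite E2 i0 muln0 addn0.
Qed.

(** For each p | q the powers that occur are at least p^f, so the geometric series in 1/p is at most
    2 p^(-f); and p^f exceeds m i, hence totient(m) i. *)
Lemma psum_ramw q N : (1 < q)%N ->
  \sum_(n < N) ramw q n * npow 1 n <= 2 * \sum_(p <- primes q) ln p%:R / (ramidx q p)%:R.
Proof.
move=> q1; have q0 := ltnW q1.
pose H p j : R := if (res_deg q p <= j.+1)%N then
  (totient (mpart p q))%:R * ln p%:R * p%:R^-1 ^+ j.+1 else 0.
have H0 p j : 0 <= H p j.
  by rewrite /H; case: ifP => // _; rewrite !mulr_ge0 ?ln_nat_ge0 ?exprn_ge0 ?invr_ge0.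
apply: (@le_trans _ _ (\sum_(n < N) \sum_(p <- primes q) \sum_(j < N) H p j * ((n : nat) == (p ^ j.+1)%N)%:R)).
  apply: ler_sum => n _.
  have T0 p j : 0 <= H p j * ((n : nat) == (p ^ j.+1)%N)%:R by rewrite mulr_ge0.
  have [E|nz] := eqVneq (ramw q n) 0.
    by rewrite E mul0r; apply: sumr_ge0 => p _; apply: sumr_ge0 => j _.
  move: nz; rewrite /ramw; case: ifP => [/andP[]|_]; last by rewrite eqxx.
  have [->|nz] := eqVneq (vM n) 0; first by rewrite mulr0 eqxx.
  have [p [k [pr_p k0 En]]] := vM_neq0 nz.
  have -> : pdiv n = p by rewrite En -(prednK k0) pdiv_pfactor.
  move=> pq /eqP E1 _.
  have pin : p \in primes q by rewrite mem_primes pr_p q0 pq.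
  have [f0 i0 Ef fmin] := ramidxP q0 pr_p.
  have kN : (k.-1 < N)%N.
    rewrite prednK //; apply: leq_trans (ltnW (ltn_ord n)); rewrite En.
    by apply/ltnW/ltn_expl/prime_gt1.
  rewrite (bigD1_seq p) ?primes_uniq //= (bigD1 (Ordinal kN)) //=.
  rewrite (prednK k0) -En eqxx mulr1 {1}/H (prednK k0) fmin //; last by rewrite -En.
  rewrite {1 2}En vM_pow // npow1E natrX exprVn -addrA lerDl.
  rewrite addr_ge0 //; apply: sumr_ge0 => p' _; first exact: T0.
  by apply: sumr_ge0 => j _; exact: T0.
rewrite exchange_big /= mulr_sumr big_seq [leRHS]big_seq; apply: ler_sum => p.
rewrite mem_primes => /and3P[pr_p _ pq].
have [f0 i0 Ef fmin] := ramidxP q0 pr_p.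
have p0 : 0 < p%:R :> R by rewrite ltr0n prime_gt0.
rewrite exchange_big /=; apply: (@le_trans _ _ (\sum_(j < N) H p j)).
  apply: ler_sum => j _; rewrite -mulr_sumr -[leRHS]mulr1 ler_wpM2l //.
  exact: sum_eq_le1.
apply: (@le_trans _ _ ((totient (mpart p q))%:R * ln p%:R * (2 * p%:R^-1 ^+ res_deg q p))).
  apply: (@le_trans _ _ ((totient (mpart p q))%:R * ln p%:R * \sum_(j < N)
     (if (res_deg q p <= j.+1)%N then p%:R^-1 ^+ j.+1 else 0))).
    rewrite mulr_sumr; apply: ler_sum => j _; rewrite /H; case: ifP; rewrite ?mulr0 //.
  apply: ler_wpM2l; first by rewrite mulr_ge0 ?ln_nat_ge0.
  apply: psum_geometric => //; last first.
  by rewrite ler_pdivrMr // mul1r ler_nat prime_gt1.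
have -> : (totient (mpart p q))%:R * ln p%:R * (2 * p%:R^-1 ^+ res_deg q p) =
    2 * (ln p%:R * ((totient (mpart p q))%:R * p%:R^-1 ^+ res_deg q p)) :> R by ring.
apply: ler_wpM2l => //; apply: ler_wpM2l; first exact: ln_nat_ge0.
have I0 : 0 < (ramidx q p)%:R :> R by rewrite ltr0n.
rewrite exprVn ler_pdivrMr ?exprn_gt0 // mulrC ler_pdivlMr // -natrX -natrM ler_nat Ef.
by apply: leq_trans (leq_addl _ _); rewrite leq_mul2r totient_le orbT.
Qed.

Lemma sum_ln_primes q : (0 < q)%N -> \sum_(p <- primes q) ln p%:R <= ln q%:R :> R.
Proof.
move=> q0; rewrite -(sum_vM_dvd R q0 (leqnn q)).
rewrite -(big_mkord (fun d => d %| q)%N vM) -big_filter.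
have -> : \sum_(p <- primes q) ln p%:R = \sum_(p <- primes q) vM p.
  by apply: eq_big_seq => p; rewrite mem_primes => /and3P[pr_p _ _]; rewrite vM_prime.
apply: ler_sum_sub => [||p|p]; rewrite ?primes_uniq ?filter_uniq ?iota_uniq ?vM_ge0 //.
rewrite mem_primes mem_filter mem_index_iota => /and3P[_ _ pq].
by rewrite pq /= ltnS dvdn_leq.
Qed.

Lemma ram_count Q J P : (0 < Q)%N -> (0 < P)%N ->
  (\sum_(q <- qrange Q) \sum_(p <- primes q) ((P < p) && (ramidx q p <= J))
    <= (3 * Q %/ P).+1 * J.+1)%N.
Proof.
move=> Q0 P0; pose good (x : nat * nat) := (P < x.2)%N && (ramidx x.1 x.2 <= J)%N.
pose L := [seq (q, p) | q <- qrange Q, p <- primes q].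
have memL q p : (q, p) \in L -> [/\ q \in qrange Q, prime p, (0 < q)%N & (p %| q)%N].
  move=> /allpairsPdep[q' [p' [h1 + [-> ->]]]]; by rewrite mem_primes => /and3P[].
have -> : (\sum_(q <- qrange Q) \sum_(p <- primes q) ((P < p) && (ramidx q p <= J)))%N =
    size [seq x <- L | good x].
  rewrite size_filter -sum1_count [RHS]big_mkcond /L big_allpairs_dep /=.
  by apply: eq_bigr => q _; apply: eq_bigr => p _; rewrite /good /=; case: ifP.
pose g (x : nat * nat) := (mpart x.2 x.1, ramidx x.1 x.2).
pose T := [seq (a, b) | a <- iota 0 (3 * Q %/ P).+1, b <- iota 0 J.+1].
have -> : ((3 * Q %/ P).+1 * J.+1)%N = size T by rewrite size_allpairs !size_iota.
rewrite -(size_map g); apply: uniq_leq_size.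
  rewrite map_inj_in_uniq; last first.
    move=> [q p] [q' p']; rewrite !mem_filter => /andP[_ /memL[/mem_qrange[Qq qQ] pr_p q0 pq]].
    move=> /andP[_ /memL[/mem_qrange[Qq' qQ'] pr_p' q0' pq']].
    rewrite /g /= => -[Em Ei].
    have [f0 i0 Ef _] := ramidxP q0 pr_p; have [f0' i0' Ef' _] := ramidxP q0' pr_p'.
    have Ep : p = p'.
      have E : (p ^ res_deg q p = p' ^ res_deg q' p')%N by rewrite Ef Ef' Em Ei.
      by rewrite -(pdiv_pfactor (res_deg q p).-1 pr_p) -(pdiv_pfactor (res_deg q' p').-1 pr_p') !prednK // E.
    subst p'; congr (_, _); have E := mpartE p q; have E' := mpartE p q'; rewrite -Em in E'.
    rewrite -E -E'; congr (_ ^ _ * _)%N.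
    (* Given p and m the exponent is unique: a larger one would at least double a number exceeding
       Q, giving at least 2 Q + 2. *)
    have aux a b m : (Q < p ^ a * m)%N -> (p ^ b * m <= (2 * Q).+1)%N -> (b <= a)%N.
      move=> h1 h2; rewrite leqNgt; apply/negP => ab.
      have h3 : (p ^ a.+1 * m <= p ^ b * m)%N by rewrite leq_mul2r leq_pexp2l ?orbT ?prime_gt0.
      have p1 := prime_gt1 pr_p; move: h3; rewrite expnS -mulnA => h3.
      have h4 : (2 * (p ^ a * m) <= p * (p ^ a * m))%N by rewrite leq_mul2r p1 orbT.
      lia.
    apply/eqP; rewrite eqn_leq; apply/andP; split.
      by apply: (aux _ _ (mpart p q)); rewrite ?E ?E'.
    by apply: (aux _ _ (mpart p q)); rewrite ?E ?E'.
  apply: filter_uniq; apply: allpairs_uniq_dep; rewrite ?qrange_uniq //.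
    by move=> q _; exact: primes_uniq.
  by move=> [? ?] [? ?] _ _ /= [-> ->].
move=> _ /mapP[[q p] + ->]; rewrite mem_filter => /andP[/andP[/= Pp iJ]].
move=> /memL[/mem_qrange[Qq qQ] pr_p q0 pq].
(* Since P < p <= p^a, the part m satisfies m P <= q <= 3 Q. *)
apply: allpairs_f; rewrite mem_iota add0n ltnS //= leq_divRL //.
apply: (@leq_trans q); last by lia.
rewrite -[leqRHS](mpartE p q) mulnC leq_mul2r; apply/orP; right.
apply: leq_trans (ltnW Pp) _; rewrite -{1}[p]expn1; apply: leq_pexp2l; first exact: prime_gt0.
by rewrite logn_gt0 mem_primes pr_p q0.
Qed.

(** Three cases: index above J, where the ln p with p | q sum to at most ln q and are divided by J;
    p <= P, at most P primes of size ln P for each q; and the pairs counted by [ram_count], each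
    charged ln(3 Q). *)
Lemma ram_avg Q J P : (0 < Q)%N -> (0 < J)%N -> (0 < P)%N ->
  \sum_(q <- qrange Q) \sum_(p <- primes q) ln p%:R / (ramidx q p)%:R <=
  Q.+1%:R * (ln (3 * Q)%:R / J%:R + P%:R * ln P%:R) +
  ((3 * Q %/ P).+1 * J.+1)%:R * ln (3 * Q)%:R :> R.
Proof.
move=> Q0 J0 P0; set l3 : R := ln (3 * Q)%:R; set lP : R := ln P%:R.
have J0R : 0 < J%:R :> R by rewrite ltr0n.
have l30 : 0 <= l3 by exact: ln_nat_ge0.
have lP0 : 0 <= lP by exact: ln_nat_ge0.
have lnle q : q \in qrange Q -> ln q%:R <= l3.
  move=> /mem_qrange[Qq qQ]; rewrite ler_ln ?posrE ?ltr0n ?ler_nat; lia.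
apply: (@le_trans _ _ (\sum_(q <- qrange Q) (l3 / J%:R + P%:R * lP +
   \sum_(p <- primes q) ((P < p) && (ramidx q p <= J))%N%:R * l3))).
  rewrite big_seq [leRHS]big_seq; apply: ler_sum => q qin.
  have [Qq qQ] := mem_qrange qin; have q0 : (0 < q)%N by apply: leq_ltn_trans Qq.
  apply: (@le_trans _ _ (\sum_(p <- primes q) (ln p%:R / J%:R + (p <= P)%N%:R * lP +
     ((P < p) && (ramidx q p <= J))%N%:R * l3))).
    rewrite big_seq [leRHS]big_seq; apply: ler_sum => p; rewrite mem_primes => /and3P[pr_p _ pq].
    have [_ i0 _ _] := ramidxP q0 pr_p; have lp := ln_nat_ge0 R p.
    have i0R : 0 < (ramidx q p)%:R :> R by rewrite ltr0n.
    have lpJ : 0 <= ln p%:R / J%:R :> R by rewrite mulr_ge0 ?invr_ge0.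
    have lpi : ln p%:R / (ramidx q p)%:R <= ln p%:R :> R.
      by rewrite ler_pdivrMr // ler_peMr // ler1n.
    have [iJ|Ji] := leqP (ramidx q p) J.
      have [pP|Pp] := leqP p P.
        rewrite mul1r mul0r addr0; apply: le_trans lpi _; apply: (@le_trans _ _ lP); last by lra.
        by rewrite ler_ln ?posrE ?ltr0n ?ler_nat // prime_gt0.
      rewrite mul0r addr0 mul1r; apply: le_trans lpi _; apply: (@le_trans _ _ l3); last by lra.
      apply: le_trans (lnle q qin); rewrite ler_ln ?posrE ?ltr0n ?ler_nat // ?(dvdn_leq q0 pq) //.
      exact: prime_gt0.
    rewrite andbF mul0r addr0 -[leLHS]addr0; apply: lerD; last by rewrite mulr_ge0.
    by rewrite ler_wpM2l // lef_pV2 ?posrE // ler_nat ltnW.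
  rewrite !big_split /= lerD2r; apply: lerD.
    rewrite -mulr_suml ler_wpM2r ?invr_ge0 ?ler0n //.
    exact: le_trans (sum_ln_primes q0) (lnle q qin).
  rewrite -mulr_suml ler_wpM2r // -natr_sum ler_nat.
  have -> : (\sum_(p <- primes q) (p <= P) = size [seq p <- primes q | p <= P])%N.
    by rewrite size_filter -sum1_count [RHS]big_mkcond /=; apply: eq_bigr => p _; case: (p <= P)%N.
  rewrite -[leqRHS](size_iota 1); apply: uniq_leq_size; first by rewrite filter_uniq ?primes_uniq.
  move=> p; rewrite mem_filter mem_iota mem_primes => /andP[pP /and3P[pr_p _ _]].
  by rewrite prime_gt0 //= add1n ltnS.
rewrite big_split /= big_const_seq count_predT size_qrange iter_addr_0 -[_ *+ Q.+1]mulr_natl lerD2l.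
under eq_bigr do rewrite -mulr_suml -natr_sum.
by rewrite -mulr_suml -natr_sum ler_wpM2r // ler_nat ram_count.
Qed.

End Ramified.

(** * Average of 1/totient *)

Section TotientAverage.
Variable R : realType.

Definition sigma k : R := \sum_(d <- divisors k) d%:R.

(** Only the divisors with the two highest powers of p are kept; they already give the Euler factor
    1 - 1/p^2 of totient(k) sigma(k) / k^2. *)
Lemma sigma_pow_mul p a m : prime p -> (0 < m)%N -> coprime p m ->
  (p ^ a.+1 + p ^ a)%:R * sigma m <= sigma (p ^ a.+1 * m)%N.
Proof.
move=> pr_p m0 cpm; have p0 := prime_gt0 pr_p.
have -> : (p ^ a.+1 + p ^ a)%:R * sigma m =
    \sum_(d <- [seq (p ^ a.+1 * d)%N | d <- divisors m] ++ [seq (p ^ a * d)%N | d <- divisors m]) d%:R.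
  rewrite big_cat !big_map /= natrD mulrDl /sigma !mulr_sumr.
  by congr (_ + _); apply: eq_bigr => d _; rewrite natrM.
apply: ler_sum_sub => //; last 1 first.
- move=> d; rewrite mem_cat -dvdn_divisors ?muln_gt0 ?expn_gt0 ?p0 ?m0 //.
  case/orP => /mapP[e + ->]; rewrite -dvdn_divisors // => em; first by rewrite dvdn_mul.
  by rewrite dvdn_mul // dvdn_exp2l.
- have inj b : injective (muln (p ^ b)).
    by move=> x y /eqP; rewrite eqn_pmul2l ?expn_gt0 ?p0 // => /eqP.
  rewrite cat_uniq !map_inj_uniq ?divisors_uniq //= andbT.
  apply/hasPn => _ /mapP[d dm ->]; apply/negP => /mapP[e em /eqP].
  rewrite expnS -mulnA mulnCA eqn_pmul2l ?expn_gt0 ?p0 // => /eqP Ed.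
  move: dm; rewrite -dvdn_divisors // Ed => pm.
  have : (p %| m)%N by apply: dvdn_trans pm; rewrite dvdn_mulr.
  by move: cpm; rewrite prime_coprime // => /negP.
- exact: divisors_uniq.
Qed.

(* The products [phi(k) sigma(k) / k^2] are bounded below by the partial products
   [(P + 1) / (2 P)] of [\prod (1 - 1/n^2)]. *)
Lemma totient_sigma P k : (0 < P)%N -> (0 < k)%N ->
  (forall p, prime p -> (p %| k)%N -> (p <= P)%N) ->
  (k ^ 2 * P.+1)%:R <= (totient k)%:R * sigma k * (2 * P)%:R.
Proof.
case: P => // P _; elim: P k => [|P IH] k k0 hk.
  have -> : k = 1%N.
    apply/eqP; rewrite eqn_leq k0 andbT leqNgt; apply/negP => k1.
    have := hk _ (pdiv_prime k1) (pdiv_dvd k).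
    by rewrite leqNgt prime_gt1 // pdiv_prime.
  by rewrite /sigma big_seq1 mul1r mul1r; lra.
have tk0 : 0 <= (totient k)%:R * sigma k by rewrite mulr_ge0 ?sumr_ge0.
(* If P+2 is not a prime divisor of k, the previous bound applies, and (P + 1) / (2 P) decreases
   with P. *)
have [/andP[pr_p pk]|npk] := boolP (prime P.+2 && (P.+2 %| k)%N); last first.
  have {}IH : (k ^ 2 * P.+2)%:R <= (totient k)%:R * sigma k * (2 * P.+1)%:R.
    apply: IH => // p pr_p pk; have := hk p pr_p pk.
    rewrite leq_eqVlt => /orP[/eqP E|//]; by move: npk; rewrite -E pr_p pk.
  have PR : 0 < P.+1%:R :> R by rewrite ltr0n.
  have E2 : P.+2%:R = P.+1%:R + 1 :> R by rewrite natr1.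
  have E3 : P.+3%:R = P.+1%:R + 2 :> R by rewrite -natrD addn2.
  move: IH; rewrite (natrM _ (k ^ 2)) (natrM _ (k ^ 2)) (natrM _ 2) (natrM _ 2) natrX E3 E2.
  move: tk0; move: (_ * sigma k) (k%:R : R) (P.+1%:R : R) PR => t x y y0 t0 IH.
  rewrite -(ler_pM2r y0).
  apply: (@le_trans _ _ (x ^+ 2 * (y + 1) * (y + 1))).
    by have := sqr_ge0 x; nra.
  by have := IH; nra.
set p := P.+2 in pr_p pk hk *; have [m cpm Ek] := pfactor_coprime pr_p k0.
have a0 : (0 < logn p k)%N by rewrite logn_gt0 mem_primes pr_p k0.
have [a Ea] : {a | logn p k = a.+1} by exists (logn p k).-1; rewrite prednK.
have m0 : (0 < m)%N by move: k0; rewrite Ek muln_gt0 => /andP[].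
rewrite Ea mulnC in Ek.
have IHm : (m ^ 2 * p)%:R <= (totient m)%:R * sigma m * (2 * P.+1)%:R.
  apply: IH => // r pr_r rm; have := hk r pr_r; rewrite Ek dvdn_mull // => /(_ isT).
  rewrite leq_eqVlt => /orP[/eqP E|//].
  by move: cpm; rewrite prime_coprime // -E rm.
have sm := sigma_pow_mul a pr_p m0 cpm; rewrite -Ek in sm.
have tk : totient k = (P.+1 * p ^ a * totient m)%N.
  by rewrite Ek totient_coprime ?coprimeXl // totient_pfactor // mulnA.
have P0 : 0 < P.+1%:R :> R by rewrite ltr0n.
have tm0 : 0 <= (totient m)%:R :> R by [].
have pa0 : 0 < (p ^ a)%:R :> R by rewrite ltr0n expn_gt0.
have sm0 : 0 <= sigma m by rewrite sumr_ge0.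
(* The factor (p - 1) p^a (p^(a+1) + p^a) is p^(2a+2) (1 - 1/p^2), exactly the quotient of the
   successive bounds (p + 1) / (2 p) and p / (2 (p - 1)). *)
apply: (@le_trans _ _ ((totient k)%:R * ((p ^ a.+1 + p ^ a)%:R * sigma m) * (2 * p)%:R)); last first.
  by apply: ler_wpM2r => //; apply: ler_wpM2l.
have Ep : p%:R = P.+1%:R + 1 :> R by rewrite /p natr1.
have Ep1 : p.+1%:R = P.+1%:R + 2 :> R by rewrite /p -natrD addn2.
have EL : (k ^ 2 * p.+1)%:R = ((P.+1%:R + 1) * (p ^ a)%:R * m%:R) ^+ 2 * (P.+1%:R + 2) :> R.
  by rewrite natrM Ep1 natrX {1}Ek natrM expnS natrM Ep.
have Et : (totient k)%:R = P.+1%:R * (p ^ a)%:R * (totient m)%:R :> R by rewrite tk !natrM.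
have Es : (p ^ a.+1 + p ^ a)%:R = (P.+1%:R + 2) * (p ^ a)%:R :> R.
  by rewrite natrD expnS natrM Ep; ring.
move: IHm; rewrite EL Et Es (natrM _ (m ^ 2)) natrX (natrM _ 2) (natrM _ 2) Ep.
move: tm0 sm0 pa0 P0; move: (totient m)%:R (sigma m) (p ^ a)%:R P.+1%:R m%:R => t s A y M t0 s0 A0 y0 IHm.
have c0 : 0 <= (y + 1) * A ^+ 2 * (y + 2) by rewrite !mulr_ge0 ?sqr_ge0 //; lra.
have := ler_wpM2l c0 IHm.
by congr (_ <= _); ring.
Qed.

(** [totient_sigma] with P = k, where (k + 1) / (2 k) is at least 1/2. *)
Lemma totient_inv_le k : (0 < k)%N -> ((totient k)%:R)^-1 <= 2 * sigma k / k%:R ^+ 2.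
Proof.
move=> k0; have k0R : 0 < k%:R :> R by rewrite ltr0n.
have h := totient_sigma k0 k0 (fun p _ pk => dvdn_leq k0 pk).
have t0 : 0 < (totient k)%:R :> R by rewrite ltr0n totient_gt0.
rewrite -[leLHS]mul1r ler_pdivrMr // mulrAC ler_pdivlMr ?exprn_gt0 // mul1r.
have s0 : 0 <= sigma k by rewrite sumr_ge0.
rewrite -(ler_pM2r k0R); apply: le_trans (_ : (k ^ 2 * k.+1)%:R <= _).
  by rewrite -natrX -natrM ler_nat leq_mul2l leqnSn orbT.
by apply: le_trans h _; rewrite natrM; lra.
Qed.

Lemma sum_dvd d N : (0 < d)%N -> (\sum_(1 <= k < N.+1) (d %| k) = N %/ d)%N.
Proof.
move=> d0; elim: N => [|N IH]; first by rewrite big_geq // div0n.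
by rewrite big_nat_recr //= IH divnS // addnC.
Qed.

(** Each term is at most 2 sigma(k) / K^2, and exchanging sums bounds the sum of sigma below 2 K by
    (2 K)^2. *)
Lemma sum_totient_inv K : (0 < K)%N -> \sum_(K <= k < 2 * K) ((totient k)%:R)^-1 <= 8 :> R.
Proof.
move=> K0; have K0R : 0 < K%:R :> R by rewrite ltr0n.
have s0 k : 0 <= sigma k by rewrite sumr_ge0.
have KK : (K <= 2 * K)%N by lia.
apply: (@le_trans _ _ (2 / K%:R ^+ 2 * \sum_(1 <= k < 2 * K) sigma k)).
  rewrite [X in _ * X](big_cat_nat K0 KK) /= mulrDr -[leLHS]add0r; apply: lerD.
    by rewrite mulr_ge0 ?sumr_ge0 // mulr_ge0 ?invr_ge0 ?sqr_ge0.
  rewrite mulr_sumr !big_nat; apply: ler_sum => k /andP[Kk _].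
  have k0 : (0 < k)%N by apply: leq_trans Kk.
  apply: le_trans (totient_inv_le k0) _; rewrite mulrAC ler_wpM2r // ler_wpM2l //.
  by rewrite lef_pV2 ?posrE ?exprn_gt0 ?ltr0n // ler_sqr ?nnegrE ?ler_nat.
have h : \sum_(1 <= k < 2 * K) sigma k <= (2 * K)%:R * (2 * K)%:R.
  apply: (@le_trans _ _ (\sum_(1 <= k < 2 * K) \sum_(1 <= d < 2 * K) (d * (d %| k))%:R)).
    rewrite !big_nat; apply: ler_sum => k /andP[k0 kK].
    apply: (@le_trans _ _ (\sum_(d <- divisors k) (d * (d %| k))%:R)).
      rewrite /sigma big_seq [leRHS]big_seq; apply: ler_sum => d.
      by rewrite -dvdn_divisors // => ->; rewrite muln1.
    apply: ler_sum_sub; rewrite ?divisors_uniq ?iota_uniq // => d.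
    rewrite -dvdn_divisors // mem_index_iota => dk; rewrite (dvdn_gt0 k0 dk) /=.
    by apply: leq_ltn_trans kK; apply: dvdn_leq.
  rewrite exchange_big_nat /=.
  apply: (@le_trans _ _ (\sum_(1 <= d < 2 * K) (2 * K)%:R)).
    rewrite !big_nat; apply: ler_sum => d /andP[d0 _].
    rewrite -natr_sum -big_distrr /= ler_nat.
    have -> : (2 * K)%N = (2 * K).-1.+1 by lia.
    by rewrite sum_dvd // mulnC; apply: leq_trans (leq_divM _ _) _.
  by rewrite sumr_const_nat -[_ *+ _]mulr_natr ler_wpM2l // ler_nat leq_subr.
apply: le_trans (ler_wpM2l _ h) _; first by rewrite mulr_ge0 ?invr_ge0 ?sqr_ge0.
by rewrite natrM le_eqVlt; apply/orP; left; apply/eqP; field; rewrite gt_eqF.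
Qed.

End TotientAverage.

(** * Averages under the Elliott-Halberstam conjecture *)

Section EHAverages.
Variable R : realType.
Local Notation vM := (@vonMangoldt R).
Local Notation EHq := (@EHq R).
Local Notation psi := (@psi R).

Lemma tsum_sum (T : eqType) (s : seq T) (u : T -> nat -> R) : {in s, forall q, summ (u q)} ->
  summ (fun n => \sum_(q <- s) u q n) /\
  tsum (fun n => \sum_(q <- s) u q n) = \sum_(q <- s) tsum (u q).
Proof.
elim: s => [|q s IH] h.
  split; last by rewrite big_nil (eq_tsum (v := fun=> 0)) ?tsum0 // => n; rewrite big_nil.
  by apply: (summ_finite (N := 0) _).1 => n _; rewrite big_nil.
have hq : summ (u q) by apply: h; rewrite mem_head.
have [h1 h2] : _ /\ _ := IH (fun x xs => h x (mem_behead (s := q :: s) xs)).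
split.
  by apply: eq_summ (summD hq h1) => n; rewrite big_cons.
by rewrite big_cons -h2 -tsumD //; apply: eq_tsum => n; rewrite big_cons.
Qed.

Lemma sum_tsum_bounded (T : eqType) (s : seq T) (u : T -> nat -> R) B :
  (forall q n, 0 <= u q n) -> (forall K, \sum_(q <- s) \sum_(n < K) u q n <= B) ->
  {in s, forall q, summ (u q)} /\ \sum_(q <- s) tsum (u q) <= B.
Proof.
move=> u0 hB; have su : {in s, forall q, summ (u q)}.
  move=> q qs; apply: (summ_bounded (B := B) _ _).1 => // K; apply: le_trans (hB K).
  by rewrite (big_rem q) //= lerDl !sumr_ge0 // => *; rewrite sumr_ge0.
split=> //; rewrite -(tsum_sum su).2; apply: (summ_bounded _ _).2 => [n|K].
  by rewrite sumr_ge0.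
by rewrite exchange_big.
Qed.

(** EH with A = 2 for the residue class 1 and integral x, with explicit constants so that they can
    be fixed in the right order. *)
Definition EH_bound (eps C : R) N0 := forall N M, (N0 <= N)%N -> M%:R <= (N%:R : R) `^ (1 - eps) ->
  \sum_(1 <= m < M.+1) `|EH_error (N%:R : R) m 1| <= C * (N%:R / ln N%:R ^+ 2).

Lemma EH_boundP (eps : R) : EH_conjecture R -> 0 < eps ->
  exists C N0, 0 <= C /\ EH_bound eps C N0.
Proof.
move=> EH eps0; have [C [B [_ HB]]] := EH eps 2 eps0 (ltr0Sn _ 1).
(* The constant supplied by EH carries no sign; N >= 3 makes ln N positive. *)
exists `|C|, (maxn 3 (Num.truncn B).+1); split => // N M; rewrite geq_max => /andP[N3 BN] MN.
have BN' : B < N%:R by case: N N3 BN MN => // N _ BN _; rewrite -truncn_le_nat.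
have l0 : 0 < ln N%:R :> R by apply: ln_gt0_nat; apply: leq_trans N3.
have N0 : 0 < N%:R :> R by rewrite ltr0n; apply: leq_trans N3.
have f0 : 0 <= N%:R / ln N%:R ^+ 2 :> R by rewrite mulr_ge0 ?invr_ge0 ?sqr_ge0.
apply: (@le_trans _ _ (C * (N%:R / ln N%:R ^+ 2))); last by rewrite ler_wpM2r ?ler_norm.
have := HB _ BN'; rewrite (powR_mulrn 2 (ltW l0)); apply: le_trans.
have Mle : (M <= Num.truncn (N%:R `^ (1 - eps) : R))%N by rewrite truncn_ge_nat ?powR_ge0.
rewrite [leRHS](@big_cat_nat _ _ _ M.+1) //=.
rewrite -[leLHS]addr0; apply: lerD; last first.
  by apply: sumr_ge0 => m _; apply: bigmax_ge_id.
rewrite !big_nat; apply: ler_sum => m /andP[m0 _].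
(* The maximum ranges over a < m, so for m = 1 the class of 1 is represented by 0. *)
have m1 : (1 %% m < m)%N by rewrite ltn_pmod.
have -> : EH_error N%:R m 1 = EH_error N%:R m (Ordinal m1) :> R.
  rewrite /EH_error; congr (_ - _); apply: eq_bigl => p /=; by rewrite modn_mod.
apply: (@le_bigmax_cond _ _ _ _ (Ordinal m1) (fun a : 'I_m => coprime a m) (fun a => `|EH_error N%:R m a|)).
by rewrite /= coprime_modl coprime1n.
Qed.

(** For each N >= X all q are at most 3 Q <= N^(1-eps), so EH bounds the sum over q by 3 Q C times
    [ilog N]. The tail of [ilog] is at most 1 / ln 2 <= 2. *)
Lemma sum_EH_tail Q X C N0 (eps : R) : (0 < Q)%N -> (2 < X)%N -> (N0 <= X)%N -> 0 <= C ->
  (forall N, (X <= N)%N -> (3 * Q)%:R <= N%:R `^ (1 - eps) :> R) ->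
  EH_bound eps C N0 ->
  forall K, \sum_(q <- qrange Q) \sum_(N < K)
    tail (fun N => `|EHq q N * (npow 1 N - npow 1 N.+1)|) X N <= 6 * C * Q%:R.
Proof.
move=> Q0 X2 N0X C0 HX HE K; rewrite exchange_big /=.
apply: (@le_trans _ _ (\sum_(N < K) 3 * Q%:R * C * tail (@ilog R) X N)).
  apply: ler_sum => N _; rewrite /tail; case: ltnP => [_|XN]; first by rewrite big1 // mulr0.
  have N1 : (0 < N)%N by apply: leq_trans XN; apply: leq_trans X2.
  have NR : 0 < N%:R :> R by rewrite ltr0n.
  have HN := HE N (3 * Q)%N (leq_trans N0X XN) (HX N XN).
  apply: (@le_trans _ _ (\sum_(q <- qrange Q) 3 * Q%:R * (N%:R ^+ 2)^-1 * `|EH_error N%:R q 1|)).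
    rewrite big_seq [leRHS]big_seq; apply: ler_sum => q /mem_qrange[Qq qQ].
    rewrite normrM /EHq normrM (ger0_norm (ler0n _ _)).
    have -> : `|npow 1 N - npow 1 N.+1| = (N%:R * N.+1%:R)^-1 :> R.
      have NR1 : 0 < N.+1%:R :> R by rewrite ltr0n.
      have -> : npow 1 N - npow 1 N.+1 = (N%:R * N.+1%:R)^-1 :> R.
        have E : N.+1%:R = N%:R + 1 :> R by rewrite natr1.
        by rewrite !npow1E; move: NR1; rewrite E => NR1; field; rewrite !gt_eqF.
      by rewrite ger0_norm // invr_ge0 mulr_ge0.
    rewrite mulrAC ler_wpM2r //; apply: ler_pM; rewrite ?invr_ge0 ?mulr_ge0 //.
      by rewrite -natrM ler_nat; apply: leq_trans (totient_le _) _; lia.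
    by rewrite lef_pV2 ?posrE ?mulr_gt0 ?exprn_gt0 ?ltr0n // expr2 ler_wpM2l // ler_nat.
  rewrite -mulr_sumr; apply: (@le_trans _ _ (3 * Q%:R * (N%:R ^+ 2)^-1 * (C * (N%:R / ln N%:R ^+ 2)))).
    apply: ler_wpM2l; first by rewrite !mulr_ge0 ?invr_ge0 ?sqr_ge0.
    apply: le_trans HN; apply: ler_sum_sub; rewrite ?iota_uniq // => q.
    by move=> /mem_qrange[Qq qQ]; rewrite mem_index_iota; lia.
  have l0 : 0 < ln N%:R :> R.
    by apply: ln_gt0_nat; apply: leq_trans XN; apply: ltnW.
  by rewrite /ilog le_eqVlt; apply/orP; left; apply/eqP; field; rewrite !gt_eqF.
rewrite -mulr_sumr; have -> : 6 * C * Q%:R = 3 * Q%:R * C * 2 :> R by ring.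
apply: ler_wpM2l; first by rewrite !mulr_ge0.
case: X X2 {N0X HX} => // X X2; apply: le_trans (psum_ilog R K X2) _.
have l2 : 2^-1 <= ln 2 :> R by have := ln_succ_ge R 0; rewrite ln1 subr0.
rewrite invf_ple ?posrE //; last exact: ln_gt0_nat.
apply: le_trans l2 _; rewrite ler_ln ?posrE ?ler_nat ?ltr0n //; exact: ltnW.
Qed.

(* Writing [p = 1 + q k], a prime congruent to [1] modulo [q] is also congruent to
   [1] modulo the smaller number [k]. *)
Lemma sum_primes_switch Q X : (0 < Q)%N ->
  \sum_(q <- qrange Q) \sum_(p < X | prime p && (p == 1 %[mod q])%N) (totient q)%:R * (ln p%:R / p%:R) <=
  \sum_(1 <= k < (X %/ Q).+1) k%:R^-1 *
    \sum_(p < (1 + (2 * Q).+1 * k).+1 | prime p && (p == 1 %[mod k])%N) ln p%:R :> R.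
Proof.
move=> Q0.
pose G k p : R := if (p < (1 + (2 * Q).+1 * k).+1)%N && (prime p && (p == 1 %[mod k])%N)
  then k%:R^-1 * ln p%:R else 0.
have G0 k p : 0 <= G k p by rewrite /G; case: ifP => // _; rewrite mulr_ge0 ?invr_ge0 ?ln_nat_ge0.
apply: (@le_trans _ _ (\sum_(p < X) \sum_(1 <= k < (X %/ Q).+1) G k p)); last first.
  rewrite exchange_big /= !big_nat; apply: ler_sum => k _.
  rewrite mulr_sumr -(big_mkord xpredT (G k)).
  rewrite -(big_mkord (fun p => prime p && (p == 1 %[mod k])%N) (fun p => k%:R^-1 * ln p%:R)).
  rewrite [leRHS]big_mkcond /=; set Y := (_).+1.
  rewrite (eq_bigr (fun p => if (p < Y)%N then G k p else 0)); last first.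
    by move=> p _; case: ltnP => // Yp; rewrite /G -/Y ltnNge Yp.
  rewrite -[leLHS]big_mkcond /= -[leLHS]big_filter.
  apply: (@le_trans _ _ (\sum_(p <- index_iota 0 Y) G k p)).
    apply: ler_sum_sub; rewrite ?filter_uniq ?iota_uniq // => p.
    by rewrite mem_filter !mem_index_iota => /andP[].
  by rewrite !big_nat; apply: ler_sum => p /andP[_ pY]; rewrite /G -/Y pY /=.
under eq_bigr do rewrite big_mkcond.
rewrite exchange_big /=; apply: ler_sum => p _.
have [pr_p|npr] := boolP (prime p); last by rewrite big1 ?sumr_ge0 // => q _; case: ifP.
rewrite -big_mkcond /=; have p1 := prime_gt1 pr_p; have p0 := prime_gt0 pr_p.
have pR : 0 < p%:R :> R by rewrite ltr0n.
rewrite -big_filter; set s := [seq q <- _ | _].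
have sP q : q \in s -> [/\ (Q < q)%N, (q <= (2 * Q).+1)%N, (0 < p.-1 %/ q)%N & p = (1 + q * (p.-1 %/ q))%N :> nat].
  rewrite mem_filter => /andP[pq /mem_qrange[Qq qQ]]; split=> //.
    rewrite divn_gt0; last by apply: leq_ltn_trans Qq.
    by apply: dvdn_leq; [lia|rewrite -subn1 -eqn_mod_dvd].
  by rewrite mulnC divnK; [lia|rewrite -subn1 -eqn_mod_dvd].
apply: (@le_trans _ _ (\sum_(q <- s) G (p.-1 %/ q)%N p)).
  rewrite big_seq [leRHS]big_seq; apply: ler_sum => q /sP[Qq qQ k0 Ep].
  have kR : 0 < (p.-1 %/ q)%:R :> R by rewrite ltr0n.
  rewrite /G pr_p; set k := (p.-1 %/ q)%N in k0 Ep kR *.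
  have -> : (p == 1 %[mod k])%N by rewrite Ep eqn_mod_dvd // add1n subSS subn0 dvdn_mull.
  have -> : (p < (1 + (2 * Q).+1 * k).+1)%N by rewrite ltnS Ep leq_add2l leq_mul2r qQ orbT.
  rewrite /= mulrCA mulrC; apply: ler_wpM2r; first exact: ln_nat_ge0.
  (* totient(q) / p <= 1 / k, because totient(q) k <= q k < p. *)
  rewrite ler_pdivrMr // mulrC ler_pdivlMr // -natrM ler_nat Ep.
  by apply: leq_trans (leq_addl _ _); rewrite leq_mul2r totient_le orbT.
rewrite -(big_map (fun q => p.-1 %/ q)%N xpredT (fun k => G k p)).
apply: ler_sum_sub; rewrite ?iota_uniq //.
  rewrite map_inj_in_uniq; first by rewrite filter_uniq ?qrange_uniq.
  move=> q q' /sP[_ _ k0 Ep] /sP[_ _ k0' Ep'] E; rewrite E in k0 Ep.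
  have : (q * (p.-1 %/ q') = q' * (p.-1 %/ q'))%N by lia.
  by move/eqP; rewrite eqn_pmul2r // => /eqP.
move=> _ /mapP[q /sP[Qq qQ k0 Ep] ->]; rewrite mem_index_iota k0 /= ltnS leq_divRL //.
have h := ltn_ord p; rewrite [X in (X < _)%N]Ep in h.
apply: leq_trans (ltnW h); rewrite mulnC; apply: leq_trans (leq_addl _ _).
by rewrite leq_mul2r (ltnW Qq) orbT.
Qed.

(** On a block b <= k < 2 b all ranges are enlarged to a common x <= 7 Q b. Since b <= Q, 2 b is at
    most the square root of x, so EH with exponent 1/2 applies at x; the expected term psi(x) /
    totient(k) sums to at most 4 x * 8 = 32 x. The weight 1/k <= 1/b cancels b. *)
Lemma sum_primes_block Q i C N0 : (0 < Q)%N -> (N0 <= Q)%N -> (2 ^ i <= Q)%N -> 0 <= C ->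
  EH_bound 2^-1 C N0 ->
  \sum_(2 ^ i <= k < 2 ^ i.+1) k%:R^-1 *
    \sum_(p < (1 + (2 * Q).+1 * k).+1 | prime p && (p == 1 %[mod k])%N) ln p%:R <=
  7 * Q%:R * (C + 32) :> R.
Proof.
move=> Q0 N0Q iQ C0 HE; set b := (2 ^ i)%N; have b0 : (0 < b)%N by rewrite expn_gt0.
have -> : (2 ^ i.+1)%N = (2 * b)%N by rewrite expnS.
pose x := (1 + (2 * Q).+1 * (2 * b))%N.
have bR : 0 < b%:R :> R by rewrite ltr0n.
have x4 : (2 ^ 2 <= x)%N by rewrite /x; nia.
have l1 : 1 <= ln x%:R :> R.
  have l2 : 2^-1 <= ln 2 :> R by have := ln_succ_ge R 0; rewrite ln1 subr0.
  apply: (@le_trans _ _ (ln (2 ^ 2)%:R)); first by rewrite natrX lnXn // mulr2n; lra.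
  by rewrite ler_ln ?posrE ?ltr0n ?ler_nat //; apply: leq_trans x4.
have xb : x%:R <= 7 * Q%:R * b%:R :> R by rewrite -!natrM ler_nat /x; nia.
have Hx : \sum_(1 <= m < (2 * b).+1) `|EH_error x%:R m 1| <= C * x%:R.
  apply: le_trans (HE x (2 * b)%N _ _) _.
  - by apply: leq_trans N0Q _; rewrite /x; nia.
  - have -> : 1 - 2^-1 = 2^-1 :> R by lra.
    rewrite powR12_sqrt // -[leLHS]ger0_norm // -sqrtr_sqr ler_wsqrtr // -natrX ler_nat /x.
    by rewrite -[Q](subnKC iQ); nia.
  - rewrite ler_wpM2l // ler_pdivrMr; last by rewrite exprn_gt0 // (lt_le_trans ltr01).
    by rewrite ler_peMr // exprn_ege1.
apply: (@le_trans _ _ (b%:R^-1 * \sum_(b <= k < 2 * b) (`|EH_error x%:R k 1| + 4 * x%:R * (totient k)%:R^-1))).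
  rewrite mulr_sumr !big_nat; apply: ler_sum => k /andP[bk kb].
  have k0 : (0 < k)%N by apply: leq_trans bk.
  apply: ler_pM; rewrite ?invr_ge0 ?ler0n //.
  - by apply: sumr_ge0 => p _; exact: ln_nat_ge0.
  - by rewrite lef_pV2 ?posrE ?ltr0n // ler_nat.
  apply: (@le_trans _ _ (\sum_(p < x.+1 | prime p && (p == 1 %[mod k])%N) vM p)).
    have lex : ((1 + (2 * Q).+1 * k).+1 <= x.+1)%N by rewrite /x ltnS leq_add2l leq_mul2l ltnW ?orbT.
    rewrite -(big_mkord (fun p => prime p && (p == 1 %[mod k])%N) vM).
    rewrite (big_cat_nat _ lex) //= big_mkord -[leLHS]addr0; apply: lerD.
      by apply: ler_sum => p /andP[pr_p _]; rewrite vM_prime.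
    by apply: sumr_ge0 => p _; exact: vM_ge0.
  have -> : \sum_(p < x.+1 | prime p && (p == 1 %[mod k])%N) vM p =
      EH_error x%:R k 1 + psi x / (totient k)%:R.
    by rewrite /EH_error /chebyshev_psi natrK subrK.
  by apply: lerD; rewrite ?ler_norm // ler_wpM2r ?invr_ge0 // psi_le.
rewrite big_split /= -mulr_sumr ler_pdivrMl //.
apply: (@le_trans _ _ (C * x%:R + 4 * x%:R * 8)).
  apply: lerD; last by rewrite ler_wpM2l ?mulr_ge0 // sum_totient_inv.
  apply: le_trans Hx; apply: ler_sum_sub; rewrite ?iota_uniq // => k.
  by rewrite !mem_index_iota; lia.
have -> : C * x%:R + 4 * x%:R * 8 = (C + 32) * x%:R :> R by ring.
have C32 : 0 <= C + 32 by lra.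
by apply: le_trans (ler_wpM2l C32 xb) _; rewrite le_eqVlt; apply/orP; left; apply/eqP; ring.
Qed.

(** The k <= X / Q fall into at most 1 + log_2(X / Q) dyadic blocks, and 1 / ln 2 <= 2. Only ln(X /
    Q) appears, not ln X, and this is of size eps ln Q. *)
Lemma sum_primes_avg Q X C N0 : (0 < Q)%N -> (N0 <= Q)%N -> (Q <= X)%N -> (X %/ Q <= Q)%N -> 0 <= C ->
  EH_bound 2^-1 C N0 ->
  \sum_(q <- qrange Q) \sum_(p < X | prime p && (p == 1 %[mod q])%N) (totient q)%:R * (ln p%:R / p%:R) <=
  (1 + 2 * (ln X%:R - ln Q%:R)) * (7 * Q%:R * (C + 32)).
Proof.
move=> Q0 N0Q QX XQ C0 HE; apply: le_trans (sum_primes_switch X Q0) _.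
set L := (X %/ Q)%N; have L0 : (0 < L)%N by rewrite divn_gt0.
pose f k : R := k%:R^-1 *
  \sum_(p < (1 + (2 * Q).+1 * k).+1 | prime p && (p == 1 %[mod k])%N) ln p%:R.
change (\sum_(1 <= k < L.+1) f k <= (1 + 2 * (ln X%:R - ln Q%:R)) * (7 * Q%:R * (C + 32))).
have f0 k : 0 <= f k by rewrite mulr_ge0 ?invr_ge0 // sumr_ge0 // => p _; exact: ln_nat_ge0.
set I := (trunc_log 2 L).+1.
have H i : (i <= I)%N -> \sum_(1 <= k < 2 ^ i) f k <= i%:R * (7 * Q%:R * (C + 32)).
  elim: i => [|i IH] iI; first by rewrite big_geq ?mul0r.
  have i1 : (1 <= 2 ^ i)%N by rewrite expn_gt0.
  have i2 : (2 ^ i <= 2 ^ i.+1)%N by rewrite leq_pexp2l.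
  rewrite (big_cat_nat i1 i2) /= -natr1 mulrDl mul1r; apply: lerD; first exact: IH (ltnW iI).
  have iL : (2 ^ i <= L)%N.
    by apply: leq_trans (trunc_logP (isT : (1 < 2)%N) L0); rewrite leq_pexp2l.
  exact: sum_primes_block (leq_trans iL XQ) _ HE.
apply: (@le_trans _ _ (\sum_(1 <= k < 2 ^ I) f k)).
  have LI : (L.+1 <= 2 ^ I)%N by rewrite trunc_log_ltn.
  by rewrite [leRHS](big_cat_nat _ LI) //= lerDl sumr_ge0.
apply: le_trans (H I (leqnn _)) _; apply: ler_wpM2r.
  by rewrite !mulr_ge0 // addr_ge0.
have QR : 0 < Q%:R :> R by rewrite ltr0n.
have XR : 0 < X%:R :> R by rewrite ltr0n; apply: leq_trans QX.
rewrite /I -natr1 addrC lerD2l.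
have l2 : 2^-1 <= ln 2 :> R by have := ln_succ_ge R 0; rewrite ln1 subr0.
have h : (trunc_log 2 L)%:R * ln 2 <= ln X%:R - ln Q%:R :> R.
  rewrite -ln_div ?posrE // mulr_natl -lnXn // ler_ln ?posrE ?exprn_gt0 ?divr_gt0 //.
  rewrite ler_pdivlMr // -natrX -natrM ler_nat.
  by apply: leq_trans (leq_divM X Q); rewrite leq_mul2r trunc_logP ?orbT.
have T0 : 0 <= (trunc_log 2 L)%:R :> R by [].
by nra.
Qed.

End EHAverages.

(** * The main bound *)

Section MainBound.
Variable R : realType.
Local Notation vM := (@vonMangoldt R).
Local Notation EHq := (@EHq R).
Local Notation psi := (@psi R).

Lemma ln_nat_le m n : (0 < m)%N -> (m <= n)%N -> ln m%:R <= ln n%:R :> R.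
Proof. by move=> m0 mn; rewrite ler_ln ?posrE ?ltr0n ?ler_nat // (leq_trans m0). Qed.

Lemma truncn_double (x : R) : 0 <= x -> (Num.truncn (2 * x) <= (2 * Num.truncn x).+1)%N.
Proof.
move=> x0; have [_ h] := andP (truncn_itv x0); rewrite truncn_le_nat.
have -> : (2 * Num.truncn x).+2 = (2 * (Num.truncn x).+1)%N by lia.
by rewrite natrM ltr_pM2l.
Qed.

(** Summation by parts in reverse gives U, the main terms weighted by 1/n - 1/(K+1), minus the
    Mertens sum, plus psi(K) / (K + 1). The Mertens sum is ln K up to an error in [-1, 4] and the
    last term lies in [0, 4], hence the 5. *)
Lemma EHq_head q K : (0 < q)%N -> (0 < K)%N ->
  exists U : R, [/\ 0 <= U,
    U <= \sum_(p < K.+1 | prime p && (p == 1 %[mod q])%N) (totient q)%:R * (ln p%:R / p%:R) &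
    `|\sum_(N < K.+1) EHq q N * (npow 1 N - npow 1 N.+1) + ln K%:R - U| <= 5].
Proof.
move=> q0 K0.
pose main n : R := if prime n && (n == 1 %[mod q])%N then (totient q)%:R * vM n else 0.
have BE N : \sum_(n < N.+1) (main n - vM n) = EHq q N by rewrite EHqE.
pose W : R := npow 1 K.+1.
have W0 : 0 <= W by exact: npow_ge0.
have head : \sum_(N < K.+1) EHq q N * (npow 1 N - npow 1 N.+1) =
    \sum_(n < K.+1) main n * (npow 1 n - W) - \sum_(n < K.+1) vM n * npow 1 n + psi K * W.
  have := abel_psum (fun n => main n - vM n) (npow 1) K; rewrite BE.
  under [in X in _ = _ + X]eq_bigr do rewrite BE.
  move=> E; rewrite big_ord_recr /= -/W.
  have E1 : \sum_(n < K.+1) (main n - vM n) * npow 1 n =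
      \sum_(n < K.+1) main n * npow 1 n - \sum_(n < K.+1) vM n * npow 1 n.
    by rewrite -sumrB; apply: eq_bigr => n _; rewrite mulrBl.
  have E2 : \sum_(n < K.+1) main n * (npow 1 n - W) =
      \sum_(n < K.+1) main n * npow 1 n - (\sum_(n < K.+1) main n) * W.
    by rewrite mulr_suml -sumrB; apply: eq_bigr => n _; rewrite mulrBr.
  have E3 : EHq q K = \sum_(n < K.+1) main n - psi K by rewrite -BE sumrB.
  rewrite E1 in E; rewrite E2; move: E; rewrite E3.
  move: (\sum_(n < K.+1) main n * npow 1 n) (\sum_(n < K.+1) vM n * npow 1 n) (\sum_(n < K.+1) main n)
    (\sum_(n < K) _) (psi K) (npow 1 K) => a b c d f g E.
  have -> : d = a - b - (c - f) * g by rewrite E; ring.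
  by ring.
have main0 n : 0 <= main n by rewrite /main; case: ifP => // _; rewrite mulr_ge0 ?vM_ge0.
have main00 : main 0%N = 0 by [].
exists (\sum_(n < K.+1) main n * (npow 1 n - W)); split.
- apply: sumr_ge0 => -[[|n] nK] _ /=; first by rewrite main00 mul0r.
  rewrite mulr_ge0 // subr_ge0 /W !npow1E lef_pV2 ?posrE ?ltr0n // ler_nat; exact: ltnW.
- rewrite [leRHS]big_mkcond /=; apply: ler_sum => n _; rewrite /main; case: ifP => [/andP[pr_n _]|_]; last by rewrite mul0r.
  rewrite vM_prime // -mulrA npow1E; apply: ler_wpM2l => //; apply: ler_wpM2l; first exact: ln_nat_ge0.
  by rewrite gerBl.
rewrite head; have [m1 m2] := andP (mertens R K0).
have -> : \sum_(n < K.+1) vM n * npow 1 n = \sum_(d < K.+1) vM d / d%:R.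
  by apply: eq_bigr => n _; rewrite npow1E.
have p0 : 0 <= psi K * W by rewrite mulr_ge0 ?psi_ge0.
have p4 : psi K * W <= 4.
  apply: le_trans (ler_wpM2r W0 (psi_le R K)) _.
  by rewrite /W npow1E ler_pdivrMr ?ltr0n // ler_wpM2l // ler_nat.
move: m1 m2 p0 p4; move: (\sum_(d < K.+1) vM d / _) (psi K * W) (ln K%:R) (\sum_(n < K.+1) main n * _) => a b c d.
move=> h1 h2 h3 h4; rewrite ler_norml; apply/andP; split; lra.
Qed.

Lemma EK_bound q Q K c0 C N0 : (0 < Q)%N -> q \in qrange Q -> (3 * Q <= K)%N ->
  ((s - 1)^-1 - tsum (fun n => vM n * npow s n)) @[s --> (1 : R)^'+] --> c0 ->
  (forall N, (N0 <= N)%N -> `|EH_error (N%:R : R) q 1| <= C * (N%:R / ln N%:R ^+ 2)) ->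
  let pp n : R := (if (n == 1 %[mod q])%N then (totient q)%:R * vMpp R n else 0) * npow 1 n in
  let rm n : R := ramw R q n * npow 1 n in
  let T := tail (fun N => `|EHq q N * (npow 1 N - npow 1 N.+1)|) K.+1 in
  summ pp -> summ rm -> summ T ->
  `|EK_const q - ln q%:R| <= `|c0| + 5 + (ln K%:R - ln Q%:R) +
    \sum_(p < K.+1 | prime p && (p == 1 %[mod q])%N) (totient q)%:R * (ln p%:R / p%:R) +
    tsum T + (tsum pp + tsum rm).
Proof.
move=> Q0 qin QK hc0 HE pp rm T spp srm sT; have [Qq qQ] := mem_qrange qin.
have q1 : (1 < q)%N by lia.
have [r [r0 r1 sw ->]] := EK_formula q1 hc0 HE spp srm.
have [st ->] := tsum_tail K.+1 sw.
have K0 : (0 < K)%N by lia.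
have [U [U0 U1 HU]] := EHq_head (ltnW q1) K0.
set head := \sum_(k < K.+1) _ in HU *.
have hT : `|tsum (tail (fun n => EHq q n * (npow 1 n - npow 1 n.+1)) K.+1)| <= tsum T.
  by apply: tsum_norm_le sT => n; rewrite /T /tail; case: ifP; rewrite ?normr0.
have rpp n : r n * npow 1 n <= pp n + rm n.
  by rewrite /pp /rm -mulrDl ler_wpM2r ?npow_ge0.
have rp0 n : 0 <= r n * npow 1 n by rewrite mulr_ge0 ?npow_ge0.
have hr : tsum (fun n => r n * npow 1 n) <= tsum pp + tsum rm.
  have sr : summ (fun n => r n * npow 1 n).
    by apply: summ_le (summD spp srm) => n; rewrite ger0_norm.
  by rewrite -tsumD //; apply: le_tsum => //; exact: summD.
have hr0 := tsum_ge0 rp0.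
have lq : ln Q%:R <= ln q%:R :> R by apply: ln_nat_le => //; exact: ltnW.
have lk : ln q%:R <= ln K%:R :> R by apply: ln_nat_le; lia.
move: HU hT (ler_norm c0) (ler_norm (- c0)); rewrite normrN !ler_norml.
move: U1 hr hr0 lq lk U0; set S := \sum_(p < K.+1 | _) _; clearbody S.
move: (tsum (tail _ _)) (tsum T) (tsum pp) (tsum rm) (tsum _) (ln q%:R) (ln Q%:R) (ln K%:R) => t T' a b r' lq lQ lK.
move: (`|c0|) => c' U1 hr hr0 h1 h2 U0 /andP[h3 h4] /andP[h5 h6] h7 h8.
by apply/andP; split; lra.
Qed.

Lemma EH_bound_single (eps C : R) N0 Q q N : EH_bound eps C N0 -> q \in qrange Q -> (0 < Q)%N ->
  (N0 <= N)%N -> (3 * Q)%:R <= (N%:R : R) `^ (1 - eps) ->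
  `|EH_error (N%:R : R) q 1| <= C * (N%:R / ln N%:R ^+ 2).
Proof.
move=> HE /mem_qrange[Qq qQ] Q0 NN hN; apply: le_trans (HE N (3 * Q)%N NN hN).
have q0 : (1 <= q)%N by lia.
have q3 : (q <= (3 * Q).+1)%N by lia.
rewrite (big_cat_nat q0 q3) /= [X in _ + X]big_ltn; last by lia.
by rewrite addrCA lerDl addr_ge0 // sumr_ge0.
Qed.

Lemma EK_average (eps Ch C : R) Nh N0 c0 : 0 < eps -> eps <= 4^-1 -> 0 <= Ch -> 0 <= C ->
  EH_bound 2^-1 Ch Nh -> EH_bound eps C N0 ->
  ((s - 1)^-1 - tsum (fun n => vM n * npow s n)) @[s --> (1 : R)^'+] --> c0 ->
  exists Q1, forall Q J P, (Q1 <= Q)%N -> (0 < J)%N -> (0 < P)%N -> (P <= Q)%N ->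
  \sum_(q <- qrange Q) `|EK_const q - ln q%:R| <=
  Q%:R * (2 * `|c0| + 188 + 77 * (Ch + 32) + 6 * C + 4 * (P%:R * ln P%:R) +
    ln Q%:R * ((4 + 28 * (Ch + 32)) * eps + 8 / J%:R + 16 * J.+1%:R / P%:R)).
Proof.
move=> eps0 eps4 Ch0 C0 HEh HE hc0.
(* ln Q >= 10 ensures (1 + 2 eps) ln Q + 4 <= 2 ln Q, hence (K + 1) / Q <= Q, as the dyadic blocks
   require. *)
exists (maxn (maxn Nh N0) (Num.truncn (expR 10 : R)).+1) => Q J P.
rewrite !geq_max -andbA => /and3P[NhQ N0Q Q10] J0 P0 PQ.
have Q0 : (0 < Q)%N by apply: leq_ltn_trans Q10.
have QR : 0 < Q%:R :> R by rewrite ltr0n.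
have l10 : 10 <= ln Q%:R :> R.
  rewrite -(expRK 10) ler_ln ?posrE ?expR_gt0 // ltW //.
  by case: (Q) Q10 => // n; rewrite ltnS truncn_le_nat.
set l : R := ln Q%:R in l10 *.
(* Y is the point beyond which 3 Q <= N^(1-eps), so that EH covers all moduli in [qrange Q]. *)
pose rho : R := (1 - eps)^-1; pose Y : R := (3 * Q)%:R `^ rho.
have e1 : 0 < 1 - eps by lra.
have rho1 : 1 <= rho by rewrite -invr1 lef_pV2 ?posrE ?ltr01 //; lra.
have rho2 : rho <= 1 + 2 * eps.
  by rewrite -[leLHS]mul1r ler_pdivrMr //; nra.
have Q3 : 1 <= (3 * Q)%:R :> R by rewrite ler1n muln_gt0.
have Y3 : (3 * Q)%:R <= Y.
  by rewrite -[leLHS]powRr1 // /Y; apply: ler_powR.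
have Y0 : 0 < Y by apply: lt_le_trans Y3; rewrite (lt_le_trans ltr01).
pose K := Num.truncn Y.
have QK : (3 * Q <= K)%N by rewrite truncn_ge_nat // ltW.
have K0 : (0 < K)%N by rewrite (leq_trans _ QK) // muln_gt0.
have [KY YK] := andP (truncn_itv (ltW Y0)).
have HX N : (K.+1 <= N)%N -> (3 * Q)%:R <= (N%:R : R) `^ (1 - eps).
  move=> KN; have YN : Y <= N%:R by apply: le_trans (ltW YK) _; rewrite ler_nat.
  apply: le_trans (_ : Y `^ (1 - eps) <= _); last first.
    by apply: (ge0_ler_powR (ltW e1)); rewrite ?nnegrE // ltW.
  by rewrite /Y -powRrM mulVf ?gt_eqF // powRr1.
have ln3 : ln 3 <= 2 :> R by have := @ln_le_sub1 R 3 (ltr0Sn _ 2); lra.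
have l3 : ln (3 * Q)%:R = ln 3 + l :> R by rewrite natrM lnM ?posrE.
have l30 : 0 <= ln 3 :> R by exact: ln_nat_ge0.
have lX : ln K.+1%:R <= (1 + 2 * eps) * l + 4 :> R.
  apply: (@le_trans _ _ (ln (2 * Y))).
    rewrite ler_ln ?posrE ?mulr_gt0 ?ltr0n // -natr1.
    have : 1 <= K%:R :> R by rewrite ler1n.
    by move: KY; rewrite -/K; lra.
  (* The additive 4 comes from ln 2 <= 1 and rho ln 3 <= 3, as eps <= 1/4 makes rho at most 3/2. *)
  rewrite lnM ?posrE // /Y ln_powR l3.
  have := ln2_le1 R; have : rho * (ln 3 + l) <= (1 + 2 * eps) * (ln 3 + l) by rewrite ler_wpM2r //; lra.
  by nra.
have lK : ln K%:R <= (1 + 2 * eps) * l + 4 :> R.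
  by apply: le_trans lX; apply: ln_nat_le.
have XQ : (K.+1 %/ Q <= Q)%N.
  rewrite -[leqRHS](mulnK Q Q0); apply: leq_div2r; rewrite mulnn -(ler_nat R) natrX.
  rewrite -ler_ln ?posrE ?exprn_gt0 ?ltr0n // lnXn // -/l mulr2n; apply: le_trans lX _.
  by nra.
have QK1 : (Q <= K.+1)%N by apply: leqW; apply: leq_trans QK; rewrite leq_pmull.
have KN0 := leq_trans N0Q QK1.
have HEq q N : q \in qrange Q -> (K.+1 <= N)%N ->
    `|EH_error (N%:R : R) q 1| <= C * (N%:R / ln N%:R ^+ 2).
  by move=> qin KN; apply: EH_bound_single HE qin Q0 (leq_trans KN0 KN) (HX N KN).
pose pp q n : R := (if (n == 1 %[mod q])%N then (totient q)%:R * vMpp R n else 0) * npow 1 n.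
pose rm q n : R := ramw R q n * npow 1 n.
pose T q := tail (fun N => `|EHq q N * (npow 1 N - npow 1 N.+1)|) K.+1.
have pp0 q n : 0 <= pp q n.
  by rewrite /pp mulr_ge0 ?npow_ge0 //; case: ifP => // _; rewrite mulr_ge0 ?vMpp_ge0.
have rm0 q n : 0 <= rm q n by rewrite /rm mulr_ge0 ?npow_ge0 ?ramw_ge0.
have T0 q n : 0 <= T q n by rewrite /T /tail; case: ifP.
have [spp hpp] := sum_tsum_bounded pp0 (fun N => sum_powers R N Q0).
have K2 : (2 < K.+1)%N by rewrite ltnS (leq_trans _ QK) // (leq_trans _ (leq_mul (leqnn 3) Q0)).
have [sT hT] := sum_tsum_bounded T0 (sum_EH_tail Q0 K2 KN0 C0 HX HE).
have srm q : q \in qrange Q -> summ (rm q) /\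
    tsum (rm q) <= 2 * \sum_(p <- primes q) ln p%:R / (ramidx q p)%:R.
  move=> /mem_qrange[Qq qQ]; apply: summ_bounded => // N; apply: psum_ramw; exact: leq_trans Qq.
have ub q : q \in qrange Q -> `|EK_const q - ln q%:R| <= (`|c0| + 9 + 2 * eps * l) +
    \sum_(p < K.+1 | prime p && (p == 1 %[mod q])%N) (totient q)%:R * (ln p%:R / p%:R) +
    tsum (T q) + (tsum (pp q) + 2 * \sum_(p <- primes q) ln p%:R / (ramidx q p)%:R).
  move=> qin; have [s1 h1] := srm q qin.
  have := EK_bound Q0 qin QK hc0 (fun N => HEq q N qin) (spp q qin) s1 (sT q qin).
  move=> h; apply: le_trans h _; apply: lerD; last by rewrite lerD2l.
  by rewrite !lerD2r -/l; lra.
apply: (@le_trans _ _ (\sum_(q <- qrange Q) (`|c0| + 9 + 2 * eps * l +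
    \sum_(p < K.+1 | prime p && (p == 1 %[mod q])%N) (totient q)%:R * (ln p%:R / p%:R) +
    tsum (T q) + (tsum (pp q) + 2 * \sum_(p <- primes q) ln p%:R / (ramidx q p)%:R)))).
  by rewrite big_seq [leRHS]big_seq; apply: ler_sum => q /ub.
rewrite big_split /= big_split /= big_split /= big_const_seq count_predT size_qrange iter_addr_0.
rewrite -[_ *+ Q.+1]mulr_natl [X in _ + X]big_split /= -mulr_sumr.
have hU := sum_primes_avg Q0 NhQ QK1 XQ Ch0 HEh.
have hR := ram_avg R Q0 J0 P0.
move: hU hT hpp hR; rewrite l3 -/l.
set SU := \sum_(q <- _) \sum_(p < _ | _) _; set ST := \sum_(q <- _) tsum (T q).
set SP := \sum_(q <- _) tsum (pp q); set SR := \sum_(q <- _) \sum_(p <- _) _.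
clearbody SU ST SP SR => hU hT hpp hR.
have JR : 0 < J%:R :> R by rewrite ltr0n.
have PR : 0 < P%:R :> R by rewrite ltr0n.
have Q2 : Q.+1%:R <= 2 * Q%:R :> R by rewrite -natrM ler_nat mul2n -addnn -addn1 leq_add2l.
have hR' : SR <= 2 * Q%:R * (2 * l / J%:R + P%:R * ln P%:R) + 4 * Q%:R * J.+1%:R / P%:R * (2 * l).
  apply: le_trans hR _; apply: lerD.
    have i0 : 0 <= J%:R^-1 :> R by rewrite invr_ge0 ltW.
    apply: ler_pM; rewrite ?ler0n //.
      by rewrite addr_ge0 // mulr_ge0 ?ln_nat_ge0 //; lra.
    by rewrite lerD2r ler_wpM2r //; lra.
  apply: ler_pM; [by []|lra| |lra].
  rewrite natrM mulrAC; apply: ler_wpM2r => //; rewrite ler_pdivlMr // -!natrM ler_nat.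
  by rewrite mulSnr -[4%N]/(3 + 1)%N mulnDl mul1n leq_add // leq_divM.
have hA : Q.+1%:R * (`|c0| + 9 + 2 * eps * l) <= 2 * Q%:R * (`|c0| + 9 + 2 * eps * l).
  apply: ler_wpM2r => //; have := normr_ge0 c0; nra.
have hU' : SU <= (9 + 4 * eps * l) * (7 * Q%:R * (Ch + 32)).
  by apply: le_trans hU _; apply: ler_wpM2r; [rewrite !mulr_ge0 //; lra|lra].
have Qc : 0 <= Q%:R * (Ch + 32) by rewrite mulr_ge0 //; lra.
have Ei : 2 * (2 * Q%:R * (2 * l / J%:R + P%:R * ln P%:R) + 4 * Q%:R * J.+1%:R / P%:R * (2 * l)) =
    Q%:R * (4 * (P%:R * ln P%:R) + l * (8 / J%:R + 16 * J.+1%:R / P%:R)) by ring.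
apply: (@le_trans _ _ (2 * Q%:R * (`|c0| + 9 + 2 * eps * l) +
  (9 + 4 * eps * l) * (7 * Q%:R * (Ch + 32)) + 6 * C * Q%:R + (168 * Q%:R +
  Q%:R * (4 * (P%:R * ln P%:R) + l * (8 / J%:R + 16 * J.+1%:R / P%:R))))).
  by rewrite -Ei; apply: lerD; [apply: lerD; [apply: lerD|]|apply: lerD => //; lra].
(* The stated constants are slightly larger than the sum of the pieces; the difference is the
   nonnegative slack displayed below. *)
rewrite -subr_ge0.
have -> : Q%:R * (2 * `|c0| + 188 + 77 * (Ch + 32) + 6 * C + 4 * (P%:R * ln P%:R) +
    l * ((4 + 28 * (Ch + 32)) * eps + 8 / J%:R + 16 * J.+1%:R / P%:R)) -
  (2 * Q%:R * (`|c0| + 9 + 2 * eps * l) +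
  (9 + 4 * eps * l) * (7 * Q%:R * (Ch + 32)) + 6 * C * Q%:R + (168 * Q%:R +
  Q%:R * (4 * (P%:R * ln P%:R) + l * (8 / J%:R + 16 * J.+1%:R / P%:R)))) =
  2 * Q%:R + 14 * (Q%:R * (Ch + 32)) :> R by ring.
by lra.
Qed.

End MainBound.

Theorem theorem1p1 (R : realType) :
  EH_conjecture R ->
  forall e : R, 0 < e ->
  \forall Q \near +oo,
    Q^-1 * \sum_((Num.truncn Q).+1 <= q < (Num.truncn (2 * Q)).+1)
             `|@EK_const R q - ln (q%:R : R)|
    <= e * ln Q.
Proof.
move=> EH e e0; have [c0 hc0] := zeta_limit R.
have half_gt0 : 0 < 2^-1 :> R by rewrite invr_gt0.
have [Ch [Nh [Ch0 HEh]]] := EH_boundP EH half_gt0.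
pose K2 : R := 4 + 28 * (Ch + 32); have K20 : 0 < K2 by rewrite /K2; lra.
(* [K2] involves only the constant of EH with exponent 1/2, so eps may depend on it without
   circularity. *)
pose eps : R := Num.min 4^-1 (e / (4 * K2)).
have eps0 : 0 < eps by rewrite lt_min invr_gt0 ltr0n divr_gt0 ?mulr_gt0.
have eps4 : eps <= 4^-1 by rewrite ge_min lexx.
have epsK : K2 * eps <= e / 4.
  have h : eps <= e / (4 * K2) by rewrite ge_min lexx orbT.
  apply: le_trans (ler_wpM2l (ltW K20) h) _.
  by rewrite le_eqVlt; apply/orP; left; apply/eqP; field; rewrite gt_eqF.
have [C [N0 [C0 HE]]] := EH_boundP EH eps0.
have [Q1 HQ] := EK_average eps0 eps4 Ch0 C0 HEh HE hc0.
(* Four errors share e ln Q in quarters: the eps term, 8 / J, 16 (J + 1) / P and the bounded part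
   [K1]. J depends on e only and P on J; both are fixed before Q grows. *)
pose J := (Num.truncn (32 / e)).+1; pose P := (Num.truncn (64 * J.+1%:R / e)).+1.
have JR : 0 < J%:R :> R by rewrite ltr0n.
have PR : 0 < P%:R :> R by rewrite ltr0n.
have J4 : 8 / J%:R <= e / 4.
  have : 32 / e < J%:R by rewrite -truncn_le_nat.
  by rewrite ltr_pdivrMr // => h; rewrite ler_pdivrMr //; lra.
have P4 : 16 * J.+1%:R / P%:R <= e / 4.
  have : 64 * J.+1%:R / e < P%:R by rewrite -truncn_le_nat.
  by rewrite ltr_pdivrMr // => h; rewrite ler_pdivrMr //; lra.
have J0 : (0 < J)%N by [].
have P0 : (0 < P)%N by [].
have {HQ}HQ Q := HQ Q J P.
clearbody J P.
pose K1 : R := 2 * `|c0| + 188 + 77 * (Ch + 32) + 6 * C + 4 * (P%:R * ln P%:R).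
have K10 : 0 <= K1.
  have := normr_ge0 c0; have : 0 <= P%:R * ln P%:R :> R by rewrite mulr_ge0 ?ln_nat_ge0.
  by rewrite /K1; lra.
rewrite -/K1 -/K2 in HQ; clearbody K1 K2.
(* The exponential makes [K1], which contains P ln P and C, at most a quarter of e ln Q. *)
pose B : R := Num.max (expR (4 * K1 / e)) (maxn Q1 P).+1%:R.
exists B; split; first exact: num_real.
move=> Q BQ; have Q2 : (maxn Q1 P).+1%:R < Q by apply: le_lt_trans BQ; rewrite le_max lexx orbT.
have Q0 : 0 < Q by apply: lt_trans Q2; rewrite ltr0n.
have lK : 4 * K1 / e <= ln Q.
  rewrite -(expRK (4 * K1 / e)) ler_ln ?posrE ?expR_gt0 //.
  by apply: le_trans (ltW BQ); rewrite le_max lexx.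
set n := Num.truncn Q.
have nm : (maxn Q1 P <= n)%N.
  rewrite truncn_ge_nat; last exact: ltW.
  by apply: le_trans (ltW Q2); rewrite ler_nat.
move: nm; rewrite geq_max => /andP[Q1n Pn].
have n0 : (0 < n)%N by apply: leq_trans Pn.
have [nQ Qn] := andP (truncn_itv (ltW Q0)).
have nR : 0 < n%:R :> R by rewrite ltr0n.
have lnQ : ln n%:R <= ln Q by rewrite ler_ln ?posrE.
have lQ0 : 0 <= ln n%:R :> R by exact: ln_nat_ge0.
rewrite ler_pdivrMl //.
apply: (@le_trans _ _ (\sum_(q <- qrange n) `|@EK_const R q - ln (q%:R : R)|)).
  (* For real Q the range may reach 2 n + 1 with n the truncation of Q; [qrange n] includes that
     value. *)
  apply: ler_sum_sub; rewrite ?iota_uniq // => q; rewrite !mem_index_iota => /andP[-> /=].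
  by rewrite !ltnS => qn; apply: leq_trans qn _; exact/truncn_double/ltW.
apply: le_trans (HQ n Q1n J0 P0 Pn) _.
apply: ler_pM => //.
  by rewrite !addr_ge0 // mulr_ge0 // !addr_ge0 // ?mulr_ge0 ?invr_ge0 // ltW.
have h1 : K1 <= e / 4 * ln Q.
  by move: lK; rewrite ler_pdivrMr //; clear; lra.
have h2 : ln n%:R * (K2 * eps + 8 / J%:R + 16 * J.+1%:R / P%:R) <= ln Q * (3 * (e / 4)).
  apply: ler_pM => //; first by rewrite !addr_ge0 // ?mulr_ge0 ?invr_ge0 // ltW.
  by move: (K2 * eps) (8 / J%:R) (_ / P%:R) epsK J4 P4; clear => a b c; lra.
by move: (ln n%:R * _) (ln Q) h1 h2; clear => a b; lra.
Qed.
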